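(* Let $q\in(p,p_s^* )$, let $f\in L^{p'}(\Omega)$, and assume that $\Lambda\in\left[1,(q/p)^{1/4}\right)$. Suppose that for some $\lambda>0$ the problem $$-\mathscr{L}_\Phi u=\lambda|u|^{q-2}u \ \text{ in } \Omega,\qquad u=0\ \text{ in } \mathbb{R}^N\setminus\Omega$$ has a nontrivial weak solution. Then there exists $\lambda_1>0$ such that for all $\lambda\in(0,\lambda_1)$ the problem $$-\mathscr{L}_\Phi u=\lambda|u|^{q-2}u+f \ \text{ in } \Omega,\qquad u=0\ \text{ in } \mathbb{R}^N\setminus\Omega$$ has a nontrivial weak solution.
   Context: Let $N\ge 2$, let $\Omega\subset\mathbb{R}^N$ be a bounded open set, $s\in(0,1)$, $p>2-\frac{s}{N}$, $p'=\frac{p}{p-1}$, and $p_s^*=\frac{Np}{N-sp}$ if $sp<N$, $p_s^*=\infty$ if $sp\ge N$. Let $\Lambda\ge 1$. Let $\Phi:\mathbb{R}\to\mathbb{R}$ be continuous with $\Phi(0)=0$ and $\Lambda^{-1}|t|^p\le \Phi(t)t\le\Lambda|t|^p$ for all $t\in\mathbb{R}$. Let $K:\mathbb{R}^N\times\mathbb{R}^N\to\mathbb{R}$ be measurable with $\frac{1}{\Lambda|x-y|^{N+sp}}\le K(x,y)\le\frac{\Lambda}{|x-y|^{N+sp}}$ for all $x\ne y$ in $\mathbb{R}^N$ (the same $\Lambda$ in both conditions). The nonlocal operator $-\mathscr{L}_\Phi$ is defined by $$\langle-\mathscr{L}_\Phi u,\varphi\rangle=\int_{\mathbb{R}^N}\int_{\mathbb{R}^N}\Phi(u(x)-u(y))(\varphi(x)-\varphi(y))K(x,y)\,dx\,dy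 .$$ $W^{s,p}(\mathbb{R}^N)$ is the space of $u\in L^p(\mathbb{R}^N)$ with $[u]_{s,p}=\left(\int_{\mathbb{R}^{2N}}\frac{|u(x)-u(y)|^p}{|x-y|^{N+sp}}dx\,dy\right)^{1/p}<\infty$, and $W_0^{s,p}(\Omega)=\{u\in W^{s,p}(\mathbb{R}^N): u=0 \text{ a.e. in }\mathbb{R}^N\setminus\Omega\}$, normed by $\|u\|_{W_0^{s,p}(\Omega)}=[u]_{s,p}$. For $g\in L^{p'}(\Omega)$, a weak solution of $-\mathscr{L}_\Phi u=\lambda|u|^{q-2}u+g$ in $\Omega$, $u=0$ in $\mathbb{R}^N\setminus\Omega$, is a function $u\in W_0^{s,p}(\Omega)$ such that for every $\varphi\in C_c^\infty(\Omega)$ $$\int_{\mathbb{R}^N}\int_{\mathbb{R}^N}\Phi(u(x)-u(y))(\varphi(x)-\varphi(y))K(x,y)\,dx\,dy=\lambda\int_\Omega|u|^{q-2}u\,\varphi\,dx+\int_\Omega g\varphi\,dx .$$ (The first problem in the claim is the case $g=0$.) Nontrivial means not almost everywhere zero. *)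

(* Defs.v *)
From HB Require Import structures.
From mathcomp Require Import all_boot all_order all_algebra.
From mathcomp Require Import all_classical all_reals all_analysis.

Set Implicit Arguments.
Unset Strict Implicit.
Unset Printing Implicit Defensive.

Import Order.TTheory GRing.Theory Num.Theory.
Import numFieldNormedType.Exports.

Local Open Scope classical_set_scope.
Local Open Scope ring_scope.

(** R^n is 'rV[R]_n.  Its measurable sets are generated by the coordinates, as
    for the n.-tuple instance of the library; this is the Borel
    sigma-algebra of R^n. *)

Definition measure_rV_display : measure_display.
Proof. exact: default_measure_display. Qed.

Section measurable_rV.
Context (R : realType) (n : nat).

Let coord : 'I_n -> 'rV[R]_n -> R := fun i v => v ord0 i.

Let rV_set0 : g_sigma_preimage coord set0.
Proof. exact: sigma_algebra0. Qed.

Let rV_setC A : g_sigma_preimage coord A -> g_sigma_preimage coord (~` A).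
Proof. exact: sigma_algebraC. Qed.

Let rV_bigcup (F : _^nat) : (forall i, g_sigma_preimage coord (F i)) ->
  g_sigma_preimage coord (\bigcup_i (F i)).
Proof. exact: sigma_algebra_bigcup. Qed.

HB.instance Definition _ := @isMeasurable.Build measure_rV_display
  'rV[R]_n (g_sigma_preimage coord) rV_set0 rV_setC rV_bigcup.

End measurable_rV.

Section measurable_fun_rV.
Context (R : realType).

Lemma measurable_coord n (i : 'I_n) :
  measurable_fun [set: 'rV[R]_n] (fun v : 'rV[R]_n => v ord0 i : R).
Proof.
move=> _ Y mY; rewrite setTI; apply: sub_sigma_algebra.
case: n i => [|n] i; first by case: i.
rewrite -bigcup_mkord_ord; exists i => //=.
by exists Y => //; rewrite setTI inord_val.
Qed.

Lemma measurable_fun_rV d (T : measurableType d) n (f : T -> 'rV[R]_n) :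
  (forall i, measurable_fun setT (fun t => f t ord0 i : R)) ->
  measurable_fun setT f.
Proof.
move=> mf; pose coord i (v : 'rV[R]_n) : R := v ord0 i.
apply: (@measurability _ _ _ _ _ _
  (\big[setU/set0]_(i < n) preimage_set_system setT (coord i) measurable)) => //.
rewrite {}/coord; case: n f mf => [|n] f mf.
  by rewrite big_ord0 => A [B []].
rewrite -bigcup_mkord_ord => _ [_ [i Ii [A mA <-]] <-].
rewrite !setTI -comp_preimage.
by have := mf (inord i) measurableT A mA; rewrite setTI.
Qed.

Definition rV_cons n (z : measurableTypeR R * 'rV[R]_n) : 'rV[R]_n.+1 :=
  row_mx z.1%:M z.2.

Definition rV_uncons n (v : 'rV[R]_n.+1) :
    measurableTypeR R * 'rV[R]_n :=
  (v ord0 ord0, @rsubmx R 1 1 n v).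

Lemma rV_consK n : cancel (@rV_cons n) (@rV_uncons n).
Proof.
move=> [x v]; rewrite /rV_uncons /rV_cons row_mxKr; congr (_, _).
have -> : ord0 = lshift n ord0 :> 'I_(1 + n) by exact: val_inj.
by rewrite (@row_mxEl _ 1 1 n) mxE eqxx.
Qed.

Lemma measurable_rV_cons n : measurable_fun setT (@rV_cons n).
Proof.
apply: measurable_fun_rV => i.
rewrite /rV_cons.
case: (split_ordP (i : 'I_(1 + n))) => j ->.
  rewrite (_ : (fun _ => _) = fst) //.
  by apply/funext => z; rewrite (@row_mxEl _ 1 1 n) !ord1 mxE.
rewrite (_ : (fun _ => _) = (fun v : 'rV[R]_n => v ord0 j) \o snd).
  by apply: measurableT_comp => //; exact: measurable_coord.
by apply/funext => z /=; rewrite (@row_mxEr _ 1 1 n).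
Qed.

Lemma measurable_rV_uncons n : measurable_fun setT (@rV_uncons n).
Proof.
apply: measurable_fun_pair; first exact: measurable_coord.
apply: measurable_fun_rV => i.
rewrite (_ : (fun _ => _) = fun v : 'rV[R]_(1 + n) => v ord0 (rshift 1 i)).
  exact: (@measurable_coord n.+1).
by apply/funext => v; rewrite mxE.
Qed.

End measurable_fun_rV.

(** The product of the one-dimensional Lebesgue measure with mu, on R^(n+1). *)

Section lebesgue_rV.
Context (R : realType).

Definition prod_rV n (mu : set 'rV[R]_n -> \bar R) :=
  pushforward (lebesgue_measure \x mu)%E (@rV_cons R n).

Section prod_rV_measure.
Context (n : nat) (mu : {sigma_finite_measure set 'rV[R]_n -> \bar R}).

Let nu : {measure set (measurableTypeR R * 'rV[R]_n)%type -> \bar R} :=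
  (@lebesgue_measure R \x mu)%E.

Let prod_rV0 : prod_rV mu set0 = 0%E.
Proof. exact: (measure0 nu). Qed.

Let prod_rV_ge0 A : (0 <= prod_rV mu A)%E.
Proof. exact: (measure_ge0 nu). Qed.

Let prod_rV_sigma_additive : semi_sigma_additive (prod_rV mu).
Proof.
have mc := @measurable_rV_cons R n.
exact: (@measure_semi_sigma_additive _ _ _
  (measure_function_pushforward__canonical__measure_function_Measure nu mc)).
Qed.

HB.instance Definition _ := isMeasure.Build _ _ _ (prod_rV mu)
  prod_rV0 prod_rV_ge0 prod_rV_sigma_additive.

Let prod_rV_sigma_finite : sigma_finite setT (prod_rV mu).
Proof.
have /sigma_finiteP[F [TF ndF Foo]] := sigma_finiteT (@lebesgue_measure R).
have /sigma_finiteP[G [TG ndG Goo]] := sigma_finiteT mu.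
exists (fun k => @rV_uncons R n @^-1` (F k `*` G k)).
  rewrite -preimage_bigcup (_ : \bigcup_k _ = setT) ?preimage_setT//.
  apply/seteqP; split=> // -[x v] _ /=.
  have [i _ Fx] : (\bigcup_k F k) x by rewrite -TF.
  have [j _ Gv] : (\bigcup_k G k) v by rewrite -TG.
  exists (maxn i j) => //; split => /=.
  - by move: x Fx; exact/subsetPset/ndF/leq_maxl.
  - by move: v Gv; exact/subsetPset/ndG/leq_maxr.
move=> k; have [mF Fk] := Foo k; have [mG Gk] := Goo k.
have mFG : measurable (F k `*` G k) by exact: measurableX.
split; first by rewrite -[X in measurable X]setTI; exact: measurable_rV_uncons.
rewrite /prod_rV /pushforward (_ : _ @^-1` _ = F k `*` G k); last first.
  by apply/funext => z; congr ((F k `*` G k) _); exact: rV_consK.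
by rewrite product_measure1E// lte_mul_pinfty// ge0_fin_numE.
Qed.

HB.instance Definition _ := Measure_isSigmaFinite.Build _ _ _ (prod_rV mu)
  prod_rV_sigma_finite.

End prod_rV_measure.

Fixpoint lebesgue_rV n : {sigma_finite_measure set 'rV[R]_n -> \bar R} :=
  match n with
  | 0 => \d_ (0 : 'rV[R]_0)
  | n.+1 => prod_rV (lebesgue_rV n)
  end.

Lemma lebesgue_rV_box n (a b : 'rV[R]_n) : (forall i, a ord0 i <= b ord0 i) ->
  lebesgue_rV n [set v : 'rV[R]_n | forall i, a ord0 i <= v ord0 i <= b ord0 i] =
  (\prod_i (b ord0 i - a ord0 i))%:E.
Proof.
elim: n a b => [a b _|n IHn a b ab].
  by rewrite big_ord0 /= diracE mem_set// => -[].
pose a' : 'rV[R]_n := \row_i a ord0 (lift ord0 i).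
pose b' : 'rV[R]_n := \row_i b ord0 (lift ord0 i).
rewrite [LHS](_ : _ = (lebesgue_measure \x lebesgue_rV n)%E
    (`[a ord0 ord0, b ord0 ord0] `*`
     [set v : 'rV[R]_n | forall i, a' ord0 i <= v ord0 i <= b' ord0 i])); last first.
  congr ((_ \x _)%E _).
  have E0 z : rV_cons z ord0 ord0 = z.1 :> R by have := congr1 fst (rV_consK z).
  have ES (z : measurableTypeR R * 'rV[R]_n) i :
      rV_cons z ord0 (lift ord0 i) = z.2 ord0 i.
    rewrite /rV_cons (_ : lift _ _ = rshift 1 i); last exact: val_inj.
    by rewrite (@row_mxEr _ 1 1 n).
  apply/seteqP; split => z.
    move=> zab; split; first by have := zab ord0; rewrite /= in_itv/= E0.
    by move=> i; have := zab (lift ord0 i); rewrite ES !mxE.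
  case; rewrite /= in_itv/= => z1 z2 i; case: (unliftP ord0 i) => [j ->|->].
    by rewrite ES; have := z2 j; rewrite !mxE.
  by rewrite E0.
rewrite product_measure1E; last 2 first.
- exact: measurable_itv.
- rewrite (_ : mkset _ = \bigcap_(i in [set: 'I_n])
      ((fun v : 'rV[R]_n => v ord0 i) @^-1` `[a' ord0 i, b' ord0 i])).
    apply: fin_bigcap_measurable => [|i _]; first exact: finite_finset.
    by rewrite -[X in measurable X]setTI; apply: measurable_coord => //.
  apply/seteqP; split => v /= vab i; first by rewrite /= in_itv /= => _; exact: vab.
  by have := vab i I; rewrite /= in_itv.
rewrite IHn; last by move=> i; rewrite !mxE.
rewrite [X in (X * _)%E](lebesgue_measure_itv `[a ord0 ord0, b ord0 ord0]).
rewrite /= lte_fin big_ord_recl.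
under eq_bigr do rewrite !mxE.
case: ltP => [_|ba]; first by rewrite -EFinD -EFinM.
rewrite mul0e (_ : b ord0 ord0 = a ord0 ord0) ?subrr ?mul0r//.
by apply/le_anti; rewrite ab ba.
Qed.

End lebesgue_rV.

Section fractional_sobolev.
Context (R : realType) (N : nat).
Implicit Types (u phi g : 'rV[R]_N -> R) (Omega : set 'rV[R]_N) (s p q : R).

Local Notation mu := (lebesgue_rV R N).

(** The library norm of 'rV[R]_N is the sup norm. *)
Definition enorm (v : 'rV[R]_N) : R := Num.sqrt (\sum_i v ord0 i ^+ 2).

(** Lebesgue measurability of a function on R^N x R^N: it agrees with a Borel
    function outside a Lebesgue-null set.  The library integral of such a
    function is its Lebesgue integral, being unaffected by null sets. *)
Definition lebesgue_measurable2 (K : 'rV[R]_N -> 'rV[R]_N -> R) : Prop :=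
  exists2 k : 'rV[R]_N * 'rV[R]_N -> R, measurable_fun setT k &
    {ae (mu \x mu)%E, forall z, K z.1 z.2 = k z}.

(** L^r(Omega); g is a representative, only its values on Omega matter. *)
Definition Lp_on Omega (r : R) g : Prop := g \_ Omega \in Lfun mu r%:E.

Definition gagliardo s p u : \bar R :=
  ((\int[mu \x mu]_z
      (`|u z.1 - u z.2| `^ p / enorm (z.1 - z.2) `^ (N%:R + s * p))%:E)
   `^ p^-1)%E.

Definition Wsp s p u : Prop :=
  u \in Lfun mu p%:E /\ (gagliardo s p u < +oo)%E.

Definition Wsp0 Omega s p u : Prop :=
  Wsp s p u /\ {ae mu, forall x, ~ Omega x -> u x = 0}.

Definition critical_exponent s p : \bar R :=
  if s * p < N%:R then (N%:R * p / (N%:R - s * p))%:E else +oo%E.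

(** [:: i1; ...; ik] stands for the partial derivative d_i1 ... d_ik. *)
Definition iter_partial (l : seq 'I_N) phi : 'rV[R]_N -> R :=
  foldr (fun i h => 'D_(delta_mx ord0 i) h) phi l.

Definition smooth phi : Prop := forall l : seq 'I_N,
  continuous (iter_partial l phi) /\
  forall x i, derivable (iter_partial l phi) x (delta_mx ord0 i).

Definition support_of phi : set 'rV[R]_N := closure [set x | phi x != 0].

(** C_c^oo(Omega), each function being extended by 0 to R^N. *)
Definition test_function Omega phi : Prop :=
  [/\ smooth phi, compact (support_of phi) & support_of phi `<=` Omega].

(** < - L_Phi u, phi >; the integral converges absolutely, by Hoelder, for u in
    W^{s,p}(R^N) and phi a test function, hence equals the iterated one. *)
Definition nonlocal_form (Phi : R -> R) (K : 'rV[R]_N -> 'rV[R]_N -> R)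
    u phi : R :=
  \int[(mu \x mu)%E]_z
    (Phi (u z.1 - u z.2) * (phi z.1 - phi z.2) * K z.1 z.2).

(** Weak solution of - L_Phi u = lambda |u|^(q-2) u + g in Omega, u = 0 outside. *)
Definition weak_solution (Phi : R -> R) (K : 'rV[R]_N -> 'rV[R]_N -> R)
    Omega s p q (lambda : R) g u : Prop :=
  Wsp0 Omega s p u /\
  forall phi, test_function Omega phi ->
    nonlocal_form Phi K u phi =
    lambda * (\int[mu]_(x in Omega) (`|u x| `^ (q - 2) * u x * phi x)) +
    \int[mu]_(x in Omega) (g x * phi x).

Definition nontrivial u : Prop := ~ {ae mu, forall x, u x = 0}.

End fractional_sobolev.

(* Main.v *)
Require Import Defs.
From HB Require Import structures.
From mathcomp Require Import all_boot all_order all_algebra.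
From mathcomp Require Import all_classical all_reals all_analysis.
From mathcomp Require Import measurable_realfun.
From mathcomp Require Import lra ring.

(** The solutions are critical points of
      I(u) = int int P(u(x) - u(y)) K - (lambda / q) int |u|^q - int f u,   P' = Phi,
    which has the mountain-pass geometry when lambda is small.  On the span of
    finitely many Lipschitz functions vanishing off Omega, a finite-dimensional
    mountain pass yields u with I'(u) = 0 along the span and
    alpha <= I(u) <= beta, where alpha > 0 and beta do not depend on the span.
    Since P(t) >= |t|^p / (p Lambda) and Phi(t) t <= Lambda |t|^p,
      q I(u) - I'(u) u >= (q / (p Lambda) - Lambda) rho(u) - (q - 1) int f u,
    where rho(u) = int int |u(x) - u(y)|^p K, so Lambda^2 < q / p bounds the
    seminorms.  Families with bounded seminorm are precompact in L^q, being
    uniformly approximated by their dyadic averages; hence an a.e. limit u exists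
    along which every Galerkin equation holds.  A.e. convergence suffices to pass
    to the limit in Phi(u(x) - u(y)), whose growth of order p - 1 makes its product
    with a fixed increment equi-integrable.  If the limit were 0, then
    P(t) <= (Lambda^2 / p) Phi(t) t would force the energies, which are at least
    alpha, to have a nonpositive limit. *)

Set Implicit Arguments.
Unset Strict Implicit.
Unset Printing Implicit Defensive.

Import Order.TTheory GRing.Theory Num.Theory.
Import numFieldNormedType.Exports.

Local Open Scope classical_set_scope.
Local Open Scope ring_scope.

(** * Mountain pass in finite dimension *)

(** No monotonicity of [Phi] is available, so the usual argument for strong convergence of
    almost-critical sequences in W_0^{s,p} breaks down. Hence the Galerkin detour: critical points
    on a span are exact, which gives I'(u) u = 0 without error term; the equation is tested only
    against fixed functions, for which a.e. convergence is enough; and the energy of the limit is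
    never computed. Uniformity in the span has two sources. The barrier rho = r is proved at once
    for all Lipschitz functions vanishing off Omega, and every span contains one fixed e0, whose ray
    carries the path that defines beta. The load f is not small, so r is taken large first and
    lambda small in terms of r. The finite lists of functions form an uncountable directed family.
    The limit is therefore taken along an ultrafilter on functions, from which a sequence is
    extracted separately for each test function, always with the same limit u. *)

Section minimax.
Context (R : realType) (n : nat).
Implicit Types (x : 'rV[R]_n) (F : 'rV[R]_n -> R) (D : 'rV[R]_n -> 'rV[R]_n).

Lemma continuous_dotmx (T : topologicalType) (f g : T -> 'rV[R]_n) :
  continuous f -> continuous g ->
  continuous (fun t => \sum_i f t ord0 i * g t ord0 i).
Proof.
move=> cf cg; apply: continuous_big => [|i _ t].
  by move=> z; apply: cvgD; [exact: cvg_fst|exact: cvg_snd].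
apply: (@cvgM _ _ _ _ (fun t => f t ord0 i) (fun t => g t ord0 i)).
- apply: (@continuous_comp _ _ _ f (fun v => v ord0 i) t); first exact: cf.
  exact: coord_continuous.
- apply: (@continuous_comp _ _ _ g (fun v => v ord0 i) t); first exact: cg.
  exact: coord_continuous.
Qed.

(** By the mean value theorem the drop over a step is r times D x . D (x - r' D x) for some r' <= r.
    On the compact set 0 <= F <= beta this product stays uniformly close to |D x|^2 >= m, so half of
    m survives. *)
Lemma gradient_step_descent F D (beta m : R) :
  continuous F -> continuous D ->
  (forall x h (t : R), is_derive t 1 (fun t : R => F (x + t *: h))
     (\sum_i D (x + t *: h) ord0 i * h ord0 i)) ->
  bounded_set [set x | 0 <= F x <= beta] -> 0 < m ->
  exists2 d : R, 0 < d & forall x (r : R), 0 <= F x <= beta -> 0 <= r <= d ->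
    m <= \sum_i D x ord0 i * D x ord0 i ->
    F (x - r *: D x) <= F x - r * (m / 2).
Proof.
move=> cF cD dF bF m0.
(* The loss of slope along a step; it is continuous and vanishes at step length 0. *)
pose h (z : 'rV[R]_n * R) : R :=
  \sum_i D z.1 ord0 i * D z.1 ord0 i -
  \sum_i D z.1 ord0 i * D (z.1 - z.2 *: D z.1) ord0 i.
have cD1 : continuous (fun z : 'rV[R]_n * R => D z.1).
  by move=> z; apply: continuous_comp; [exact: cvg_fst|exact: cD].
have cD2 : continuous (fun z : 'rV[R]_n * R => D (z.1 - z.2 *: D z.1)).
  move=> z; apply: (@continuous_comp _ _ _ (fun z : 'rV[R]_n * R => z.1 - z.2 *: D z.1)); last exact: cD.
  apply: cvgB; first exact: cvg_fst.
  by apply: cvgZ; [exact: cvg_snd|exact: cD1].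
have ch : continuous h.
  move=> z; apply: cvgB; first exact: continuous_dotmx.
  exact: continuous_dotmx.
have h0 x : h (x, 0) = 0 by rewrite /h/= scale0r subr0 subrr.
have cK : compact [set x | 0 <= F x <= beta].
  apply: bounded_closed_compact => //.
  rewrite (_ : [set _ | _] = F @^-1` `[0, beta]); last first.
    by apply/seteqP; split => x /=; rewrite in_itv.
  by apply: closed_comp; [move=> ? _; exact: cF|exact: itv_closed].
(* Compactness turns the pointwise smallness of [h] into one step length valid for all x. *)
have H : \forall d \near (0%R:R)^'+, [set x | 0 <= F x <= beta] `<=`
    (fun x => forall r : R, 0 <= r <= d -> h (x, r) <= m / 2).
  move/compact_near_coveringP : cK; apply => x Kx.
  have : \forall z \near (x, 0), h z <= m / 2.
    have /cvgrPdist_lt/(_ (m/2)) := ch (x, 0).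
    rewrite h0 => /(_ (divr_gt0 m0 (ltr0n _ 2))).
    by apply: filterS => z; rewrite sub0r normrN => /ltW; exact: le_trans (ler_norm _).
  move=> -[[A B]/= [xA /nbhs_ballP[e /= e0 eB]] AB].
  exists (A, [set d : R | d < e]) => /=.
    by split => //; exact: nbhs_right_lt.
  move=> [y d]/= [Ay de] r /andP[r0 rd]; apply: AB; split => //=.
  by apply: eB; rewrite /ball/= sub0r normrN ger0_norm// (le_lt_trans rd).
have [d [d0 Hd]] : exists d : R, 0 < d /\ forall x, 0 <= F x <= beta -> forall r : R, 0 <= r <= d -> h (x, r) <= m / 2.
  have := @filter_ex _ _ (at_right_proper_filter (0:R)) _ (filterI H (nbhs_right_gt 0)).
  by move=> [d [Hd d0]]; exists d; split => // x Kx; exact: Hd.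
exists d => // x r Fx rd mD.
have [r0|r0] := eqVneq r 0; first by rewrite r0 scale0r mul0r !subr0.
have {}r0 : 0 < r by rewrite lt_neqAle eq_sym r0; case/andP: rd.
pose g (t : R) := F (x + t *: (- (r *: D x))).
have [|th] := @MVT R g (fun t => \sum_i D (x + t *: (- (r *: D x))) ord0 i * (- (r *: D x)) ord0 i) 0 1 ltr01 (fun t _ => dF _ _ t).
  apply: continuous_subspaceT => t.
  by apply: differentiable_continuous; apply/derivable1_diffP; have [] := dF x (- (r *: D x)) t.
rewrite in_itv/= => /andP[th0 th1].
rewrite /g scale1r scale0r addr0 subr0 mulr1 => /eqP; rewrite subr_eq => /eqP ->.
rewrite addrC lerD2l.
have thr : 0 <= th * r <= d.
  rewrite mulr_ge0 ?(ltW th0) ?(ltW r0)//=.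
  by case/andP: rd => _; apply: le_trans; rewrite ger_pMl// ltW.
have := Hd x Fx (th * r) thr; rewrite /h/= lerBlDr -lerBlDl => hh.
under eq_bigr do rewrite !mxE mulrN mulrCA scalerN scalerA.
rewrite sumrN -mulr_sumr lerN2 ler_pM2l//.
under eq_bigr do rewrite mulrC.
apply: le_trans hh.
by lra.
Qed.

(** Boundedness of the energy band makes it compact and takes the place of the Palais-Smale
    condition: if [D] had no zero on alpha <= F <= beta, its squared length would have a positive
    minimum there. *)
Theorem mountain_pass_rV F D (rho : 'rV[R]_n -> R) (e : 'rV[R]_n)
    (alpha beta r : R) :
  continuous F -> continuous D ->
  (forall x h (t : R), is_derive t 1 (fun t : R => F (x + t *: h))
     (\sum_i D (x + t *: h) ord0 i * h ord0 i)) ->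
  bounded_set [set x | 0 <= F x <= beta] ->
  continuous rho -> rho 0 < r < rho e ->
  0 < alpha -> (forall x, rho x = r -> alpha <= F x) ->
  F 0 = 0 -> F e <= 0 -> (forall t, 0 <= t <= 1 -> F (t *: e) <= beta) ->
  exists2 x, D x = 0 & alpha <= F x <= beta.
Proof.
move=> cF cD dF bF crho /andP[rho0 rhoe] a0 aF F0 Fe Fbeta.
have cross (g : R -> 'rV[R]_n) : continuous g -> g 0 = 0 -> g 1 = e ->
    exists2 t, 0 <= t <= 1 & alpha <= F (g t).
  move=> cg g0 g1; have [||t] := @IVT R (rho \o g) 0 1 r ler01.
  - apply: continuous_subspaceT => t.
    by apply: continuous_comp; [exact: cg|exact: crho].
  - rewrite /= g0 g1 ge_min (ltW rho0)/= le_max (ltW rhoe) orbT//.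
  - by rewrite in_itv/= => t01 gt; exists t => //; exact: aF.
have [t0 t001 at0] : exists2 t, 0 <= t <= 1 & alpha <= F (t *: e).
  apply: cross; rewrite ?scale0r ?scale1r//.
  by move=> t; apply: cvgZ => //; exact: cvg_cst.
pose D2 x := \sum_i D x ord0 i * D x ord0 i.
have cD2 : continuous D2 by exact: continuous_dotmx.
have [x0 x0in x0min] : exists2 c, c \in [set x | alpha <= F x <= beta] &
    forall t, t \in [set x | alpha <= F x <= beta] -> D2 c <= D2 t.
  apply: EVT_min_rV; last exact: continuous_subspaceT.
  - by exists (t0 *: e) => /=; rewrite at0 Fbeta.
  - apply: bounded_closed_compact.
      case: bF => M [Mr HM]; exists M; split=> // y My x /= /andP[ax Fx].
      by apply: (HM y My) => /=; rewrite (le_trans (ltW a0) ax).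
    rewrite (_ : [set _ | _] = F @^-1` `[alpha, beta]); last first.
      by apply/seteqP; split => x /=; rewrite in_itv.
    by apply: closed_comp; [move=> ? _; exact: cF|exact: itv_closed].
apply: contrapT => noc.
have m0 : 0 < D2 x0.
  rewrite lt_neqAle sumr_ge0 ?andbT; last by move=> i _; rewrite -expr2 sqr_ge0.
  apply/eqP => /esym/eqP.
  rewrite psumr_eq0 => [/allP D0|i _]; last by rewrite -expr2 sqr_ge0.
  apply: noc; exists x0; last by move: x0in; rewrite inE.
  apply/rowP => i; rewrite mxE; apply/eqP.
  by have := D0 i (mem_index_enum i); rewrite mulf_eq0 orbb.
(* With half of the minimum as threshold, the cut-off in [D2] can vanish continuously exactly where
   the descent estimate ceases to apply. *)
have [d d0 step] := gradient_step_descent cF cD dF bF (divr_gt0 m0 (ltr0n _ 2)).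
(* The truncated gradient step [eta] fixes [F <= 0] and lowers [F] by at least
   [eps] on [alpha <= F <= beta], where [D2] is bounded below.  Iterating it on
   the segment from 0 to [e] would push the whole path below [alpha], although
   every such path meets [rho = r]. *)
pose s x := d * Num.min 1 (Num.max 0 (F x / alpha)) *
  Num.min 1 (Num.max 0 (D2 x - D2 x0 / 2)).
pose eta x := x - s x *: D x.
have cs : continuous s.
  have cmin (h : 'rV[R]_n -> R) : continuous h -> continuous (fun x => Num.min 1 (Num.max 0 (h x))).
    move=> ch x; apply: (@continuous_min _ _ (cst 1) (fun x => Num.max 0 (h x))).
      exact: cst_continuous.
    by apply: (@continuous_max _ _ (cst 0) h); [exact: cst_continuous|exact: ch].
  have c1 : continuous (fun x => F x / alpha).
    by move=> y; apply: (@continuousM _ _ F (cst alpha^-1)); [exact: cF|exact: cst_continuous].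
  have c2 : continuous (fun x => D2 x - D2 x0 / 2).
    by move=> y; apply: (@continuousB _ _ _ D2); [exact: cD2|exact: cst_continuous].
  move=> x; apply: (@continuousM _ _ _ (fun x => Num.min 1 (Num.max 0 (D2 x - D2 x0 / 2)))); last exact: (cmin _ c2 x).
  by apply: (@continuousM _ _ (cst d)); [exact: cst_continuous|exact: (cmin _ c1 x)].
have ceta : continuous eta.
  move=> x; apply: (@continuousB _ _ _ id); first by move=> ?.
  by apply: (@continuousZ _ _ _ s D); [exact: cs|exact: cD].
have eta_fix x : F x <= 0 -> eta x = x.
  move=> Fx; rewrite /eta /s; have -> : Num.max 0 (F x / alpha) = 0.
    by apply/max_idPl; rewrite pmulr_lle0 ?invr_gt0.
  by rewrite (_ : Num.min 1 0 = 0) ?mulr0 ?mul0r ?scale0r ?subr0//; apply/min_idPr.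
have s_ge0 x : 0 <= s x <= d.
  rewrite /s !mulr_ge0 ?(ltW d0)//=; try by rewrite le_min ler01 le_max lexx.
  rewrite -mulrA ger_pMr//; apply: mulr_ile1; rewrite ?le_min ?ler01 ?le_max ?lexx//=.
  - by rewrite ge_min lexx.
  - by rewrite ge_min lexx.
have eta_step x : F x <= beta -> F (eta x) <= F x - s x * (D2 x0 / 2 / 2).
  move=> Fx; have [F0x|/ltW Fx0] := leP (F x) 0.
    rewrite eta_fix//.
    suff -> : s x = 0 by rewrite mul0r subr0.
    rewrite /s; have -> : Num.max 0 (F x / alpha) = 0.
      by apply/max_idPl; rewrite pmulr_lle0 ?invr_gt0.
    by rewrite (_ : Num.min 1 0 = 0) ?mulr0 ?mul0r//; apply/min_idPr.
  have [D2x|D2x] := leP (D2 x0 / 2) (D2 x).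
    by apply: step => //; rewrite Fx0.
  rewrite /eta; suff -> : s x = 0 by rewrite scale0r mul0r !subr0.
  rewrite /s; have -> : Num.max 0 (D2 x - D2 x0 / 2) = 0.
    by apply/max_idPl; rewrite subr_le0 ltW.
  by rewrite (_ : Num.min 1 0 = 0) ?mulr0//; apply/min_idPr.
have eta_le x : F x <= beta -> F (eta x) <= F x.
  move=> Fx; apply: le_trans (eta_step _ Fx) _.
  have /andP[s0 _] := s_ge0 x.
  by rewrite gerBl mulr_ge0// !divr_ge0// ltW.
(* On the band the first cut-off equals 1 and the second is at least [Num.min 1 (D2 x0 / 2)],
   because [D2 x0] is the minimum of [D2] there. *)
pose eps := d * Num.min 1 (D2 x0 / 2) * (D2 x0 / 2 / 2).
have eps0 : 0 < eps by rewrite /eps !mulr_gt0// lt_min ltr01 divr_gt0.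
have eta_eps x : alpha <= F x <= beta -> F (eta x) <= F x - eps.
  move=> /andP[Fa Fb]; apply: le_trans (eta_step _ Fb) _; rewrite lerD2l lerN2.
  rewrite /eps ler_pM2r; last by rewrite !divr_gt0.
  have -> : s x = d * Num.min 1 (Num.max 0 (D2 x - D2 x0 / 2)).
    rewrite /s (_ : Num.min 1 (Num.max 0 (F x / alpha)) = 1) ?mulr1//.
    by apply/min_idPl; rewrite le_max ler_pdivlMr// mul1r Fa orbT.
  rewrite ler_pM2l// le_min ge_min lexx/= ge_min; apply/orP; right.
  rewrite le_max lerBrDr -splitr x0min ?orbT// inE/=; exact/andP.
pose g k := iter k (fun h : R -> 'rV[R]_n => eta \o h) (fun t : R => t *: e).
have cg k : continuous (g k).
  elim: k => [|k IH] t; first by apply: cvgZ => //; exact: cvg_cst.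
  by apply: continuous_comp; [exact: IH|exact: ceta].
have g0 k : g k 0 = 0.
  by elim: k => [|k IH] /=; rewrite ?scale0r// /comp IH eta_fix ?F0.
have g1 k : g k 1 = e.
  by elim: k => [|k IH] /=; rewrite ?scale1r// /comp IH eta_fix.
have gF k t : 0 <= t <= 1 ->
    F (g k t) <= Num.max alpha (beta - k%:R * eps) /\ F (g k t) <= beta.
  move=> t01; elim: k => [|k [IH IHb]].
    by rewrite mul0r subr0 le_max Fbeta// orbT.
  have gk1 : g k.+1 t = eta (g k t) by [].
  split; last by rewrite gk1 (le_trans (eta_le _ IHb)).
  rewrite le_max gk1; have [Fa|Fa] := leP alpha (F (g k t)).
    have := eta_eps _ (introT andP (conj Fa IHb)) => h.
    move: IH; rewrite le_max => /orP[IH|IH].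
      by rewrite (le_trans h)// lerBlDr (le_trans IH)// lerDl ltW.
    apply/orP; right; apply: le_trans h _.
    by rewrite -natr1 mulrDl mul1r opprD addrA lerD2r.
  by rewrite (le_trans (eta_le _ IHb) (ltW Fa)).
have [k kb] : exists k : nat, beta - k%:R * eps <= alpha.
  exists (Num.truncn ((beta - alpha) / eps)).+1.
  rewrite lerBlDr -lerBlDl -ler_pdivrMr//.
  by rewrite ltW// truncnS_gt.
(* After k steps the values are only known to be at most alpha; one more step makes them strictly
   smaller. *)
have [t t01 aFt] := cross (g k.+1) (cg _) (g0 _) (g1 _).
have [Fk Fkb] := gF k t t01.
move: Fk; rewrite (max_idPl kb) => Fk.
have gk1 : g k.+1 t = eta (g k t) by [].
move: aFt; rewrite gk1; have [Fa|Fa] := leP alpha (F (g k t)).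
  have := eta_eps _ (introT andP (conj Fa Fkb)); move=> h1 h2.
  by have := le_trans h2 h1; rewrite leNgt => /negP; apply; rewrite ltrBlDr (le_lt_trans Fk)// ltrDl.
move=> h; have := le_trans h (eta_le _ Fkb).
by rewrite leNgt Fa.
Qed.

End minimax.

(** * Calculus on the line: powers, signs of derivatives, primitives *)

Section scalar.
Context (R : realType).
Implicit Types (t a b : R).

Lemma is_derive_norm_powR r t : 1 < r ->
  is_derive t 1 (fun x => `|x| `^ r) (r * (`|t| `^ (r - 2) * t)).
Proof.
move=> r1.
have r0 : 0 < r by rewrite (lt_trans ltr01).
have pos (x : R) : 0 < x -> is_derive x 1 (fun x => `|x| `^ r) (r * (`|x| `^ (r - 2) * x)).
  move=> x0; rewrite gtr0_norm// mulrC [_ * x]mulrC.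
  have -> : x * x `^ (r - 2) * r = r * x `^ (r - 1).
    rewrite mulrC; congr (_ * _).
    rewrite [in LHS](_ : r - 2 = (r - 1) - 1); last by ring.
    by rewrite mulr_powRB1 ?ltW// subr_gt0.
  have h : is_derive x 1 (fun x : R => x `^ r) (r * x `^ (r - 1)).
    apply: DeriveDef; first by apply: derivable_powR; rewrite in_itv/= andbT.
    by rewrite -derive1E powR_derive1// in_itv/= andbT.
  apply: near_eq_is_derive h.
  near=> y; rewrite gtr0_norm//.
  by near: y; exact: lt_nbhsr.
have [t0|t0|<-] := ltgtP 0 t; first exact: pos.
  have tN : 0 < - t by rewrite oppr_gt0.
  have := pos _ tN => h.
  have hN : is_derive t 1 (fun x : R => - x) (-1).
    by apply: is_deriveN.
  have := @is_derive1_comp R (fun x => `|x| `^ r) (fun x : R => - x) t _ _ h hN.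
  rewrite [X in is_derive _ _ _ X](_ : _ = r * (`|t| `^ (r - 2) * t)); last first.
    rewrite normrN; change ((r * (`|t| `^ (r - 2) * - t)) * (-1) = r * (`|t| `^ (r - 2) * t)); ring.
  apply: near_eq_is_derive.
  by near=> y; rewrite /= normrN.
rewrite mulr0 mulr0.
have h : h^-1 *: (`|h *: (1:R) + (0:R) : R| `^ r - `|0:R| `^ r) @[h --> (0:R)^'] --> (0:R).
  apply/cvgrPdist_lt => e e0; near=> h.
  have h0 : h != 0 by near: h; exact: nbhs_dnbhs_neq.
  rewrite sub0r normrN addr0 /GRing.scale/= mulr1 normr0 powR0 ?gt_eqF// subr0.
  rewrite normrM normfV norm_powR// normr_id -(mulr_powRB1 _ r0)//.
  rewrite mulKf ?normr_eq0//.
  have -> : e = (e `^ (r - 1)^-1) `^ (r - 1).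
    by rewrite -powRrM mulVf ?powRr1 ?ltW// subr_eq0 gt_eqF.
  apply: gt0_ltr_powR; rewrite ?subr_gt0 ?nnegrE ?powR_ge0//.
  near: h; apply: dnbhs0_lt; exact: powR_gt0.
apply: DeriveDef; first by apply/cvg_ex; exists 0.
exact: cvg_lim h.
Unshelve. all: by end_near. Qed.

(** [H] decreases before 0 and increases after it. This compares a potential with a power through
    their derivatives alone. *)
Lemma derive_sign_ge0 (H dH : R -> R) : H 0 = 0 ->
  (forall t, is_derive t 1 H (dH t)) -> (forall t, 0 <= dH t * t) ->
  forall t, 0 <= H t.
Proof.
move=> H0 dHH sg t.
have cH : continuous H.
  move=> x; apply: differentiable_continuous; apply/derivable1_diffP.
  by have [] := dHH x.
have [t0|t0|<-] := ltgtP 0 t; last by rewrite H0.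
- have [|c] := @MVT R H dH 0 t t0 (fun x _ => dHH x).
    exact: continuous_subspaceT.
  rewrite in_itv/= => /andP[c0 _]; rewrite H0 !subr0 => ->.
  by rewrite mulr_ge0 ?(ltW t0)// -(pmulr_lge0 _ c0).
- have [|c] := @MVT R H dH t 0 t0 (fun x _ => dHH x).
    exact: continuous_subspaceT.
  rewrite in_itv/= => /andP[_ c0]; rewrite H0 sub0r => /eqP.
  rewrite eqr_oppLR sub0r mulrN opprK => /eqP ->.
  by rewrite mulr_le0 ?(ltW t0)// -(nmulr_lge0 _ c0).
Qed.

Lemma continuous_primitive (f : R -> R) : continuous f ->
  exists2 P : R -> R, P 0 = 0 & forall t, is_derive t 1 P (f t).
Proof.
move=> cf.
pose F (m x : R) := \int[@lebesgue_measure R]_(t in `[m, x]) f t.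
have dF (m x : R) : m < x -> is_derive x 1 (F m) (f x).
  move=> mx.
  have int : (@lebesgue_measure R).-integrable `[m, x + 1] (EFin \o f).
    apply: continuous_compact_integrable; first exact: segment_compact.
    exact: continuous_subspaceT.
  have xx1 : x < x + 1 by rewrite ltrDl.
  have [d1 d2] := continuous_FTC1_closed xx1 int mx (cf x).
  by apply: DeriveDef => //; rewrite -derive1E.
have FE (m m' x : R) : m' <= m -> m < 0 -> m < x -> F m x - F m 0 = F m' x - F m' 0.
  move=> m'm m0 mx.
  pose G y := F m y - F m' y.
  have dG (y : R) : m < y -> is_derive y 1 G 0.
    move=> my; rewrite -(subrr (f y)); apply: is_deriveB; apply: dF => //.
    exact: le_lt_trans my.
  suff : G x = G 0 by rewrite /G; lra.
  have key (a b : R) : m < a -> a < b -> G a = G b.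
    move=> ma ab; have [||c _] := @MVT R G (fun=> 0) a b ab.
    - by move=> z; rewrite in_itv/= => /andP[az _]; apply/dG/(lt_trans ma).
    - apply: derivable_within_continuous => z; rewrite in_itv/= => /andP[az _].
      by have [] := dG z (lt_le_trans ma az).
    - by rewrite mul0r => /eqP; rewrite subr_eq0 => /eqP.
  have [x0|x0|->//] := ltgtP 0 x; first by rewrite -(key 0 x).
  exact: key.
(* The fundamental theorem differentiates [F m] only to the right of m, so the base point moves with
   x. By [FE] the difference does not depend on it, and near t a fixed base point can be used. *)
pose P x := F (- (`|x| + 1)) x - F (- (`|x| + 1)) 0.
exists P; first by rewrite /P subrr.
move=> t.
have h : is_derive t 1 (fun x => F (- (`|t| + 2)) x - F (- (`|t| + 2)) 0) (f t).
  rewrite -[X in is_derive _ _ _ X]subr0; apply: is_deriveB.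
  apply: dF; rewrite ltrNl; have := ler_norm (- t); rewrite normrN; lra.
apply: near_eq_is_derive h.
near=> x; rewrite /P; apply/esym/FE; last 2 first.
- by have := normr_ge0 x; lra.
- by rewrite ltrNl; have := ler_norm (- x); rewrite normrN; lra.
rewrite lerN2; suff : `|x| <= `|t| + 1 by lra.
have : `|t - x| < 1 by near: x; exact: nbhsx_ballx.
by have := ler_normD t (x - t); rewrite (distrC t); rewrite addrC subrK; lra.
Unshelve. all: by end_near. Qed.

End scalar.

(** * Limits of integrals *)

Section integral.
Context d (T : measurableType d) (R : realType).
Variable mu : {measure set T -> \bar R}.
Implicit Types (f g h G A : T -> R).
Local Notation int f := (mu.-integrable setT (EFin \o f)).
Local Notation mfun f := (measurable_fun setT f).

Lemma ge0_integrable f : mfun f -> (forall x, 0 <= f x) ->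
  (\int[mu]_x (f x)%:E < +oo)%E -> int f.
Proof.
move=> mf f0 fy; apply/integrableP; split; first exact/measurable_EFinP.
by under eq_integral do rewrite /= ger0_norm//.
Qed.

Lemma le_integrableR f g : mfun f -> (forall x, `|f x| <= g x) -> int g -> int f.
Proof.
move=> mf fg ig; apply: le_integrable ig => //; first exact/measurable_EFinP.
by move=> x _ /=; rewrite lee_fin (le_trans (fg x))// ler_norm.
Qed.

Lemma integrable_mfun f : int f -> mfun f.
Proof. by move=> /integrableP[/measurable_EFinP]. Qed.

Lemma integrableDR f g : int f -> int g -> int (fun x => f x + g x).
Proof. by move=> fi gi; have := integrableD measurableT fi gi; apply: eq_integrable. Qed.

Lemma integrableBR f g : int f -> int g -> int (fun x => f x - g x).
Proof. by move=> fi gi; have := integrableB measurableT fi gi; apply: eq_integrable. Qed.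

Lemma integrableZR k f : int f -> int (fun x => k * f x).
Proof. by move=> fi; have := integrableZl measurableT k fi; apply: eq_integrable. Qed.

Lemma integrable_normR f : int f -> int (fun x => `|f x|).
Proof. by move=> fi; have := integrable_abse fi; apply: eq_integrable. Qed.

Lemma RintegralE f : int f -> (\int[mu]_x f x)%:E = (\int[mu]_x (f x)%:E)%E.
Proof. by move=> fi; rewrite /Rintegral fineK// integrable_fin_num. Qed.

Lemma fatou_ae (A_ : nat -> T -> R) A (M : \bar R) :
  (forall n, mfun (A_ n)) -> mfun A -> (forall n x, 0 <= A_ n x) ->
  {ae mu, forall x, A_ ^~ x @ \oo --> A x} ->
  (forall n, \int[mu]_x (A_ n x)%:E <= M)%E -> (\int[mu]_x (A x)%:E <= M)%E.
Proof.
move=> mA_ mA A0 cvA AM.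
have mA_E n : measurable_fun setT (EFin \o A_ n) by exact/measurable_EFinP.
have mlim : measurable_fun setT (fun x => limn_einf (fun n => (A_ n x)%:E)).
  rewrite (_ : (fun _ => _) = (fun x => - limn_esup (-%E \o (fun n => (A_ n x)%:E)))%E); last first.
    by apply/funext => x; rewrite limn_esupN oppeK.
  apply: measurableT_comp => //.
  apply: (@measurable_fun_limn_esup _ _ _ _ (fun n x => (- (A_ n x)%:E)%E)) => n.
  apply: (measurableT_comp (@oppe_measurable R setT) (mA_E n)).
have AE : {ae mu, forall x, setT x -> (A x)%:E = limn_einf (fun n => (A_ n x)%:E)}.
  apply: filterS cvA => x cA _.
  have /cvg_limn_einf_sup : (fun n => (A_ n x)%:E) @ \oo --> (A x)%:E.
    by apply: cvg_EFin => //; exact: nearW.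
  by case.
have lim0 x : (0 <= limn_einf (fun n => (A_ n x)%:E))%E.
  by rewrite limn_einf_lim; apply: lime_ge; [exact: is_cvg_einfs|apply: nearW => n; apply: le_ereal_inf_tmp => _ [m _ <-]; rewrite lee_fin].
rewrite (@ae_eq_integral _ _ _ mu setT (fun x => limn_einf (fun n => (A_ n x)%:E)))//; last first.
  exact/measurable_EFinP.
have A0E n x : setT x -> (0 <= (EFin \o A_ n) x)%E by rewrite lee_fin.
apply: le_trans (fatou mu measurableT mA_E A0E) _.
rewrite limn_einf_lim; apply: lime_le; first exact: is_cvg_einfs.
apply: nearW => n; apply: le_trans (AM n).
by apply: ereal_inf_lbound; exists n => //=.
Qed.

Lemma dominated_cvg_Rintegral (h_ : nat -> T -> R) h G :
  (forall n, mfun (h_ n)) -> mfun h ->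
  {ae mu, forall x, h_ ^~ x @ \oo --> h x} ->
  int G -> (forall n x, `|h_ n x| <= G x) ->
  \int[mu]_x h_ n x @[n --> \oo] --> \int[mu]_x h x.
Proof.
move=> mh_ mh cvh iG hG.
have [|||||ih _ cv] := @dominated_convergence _ _ _ mu setT measurableT (fun n => EFin \o h_ n) (EFin \o h) (EFin \o G).
- by move=> n; exact/measurable_EFinP.
- exact/measurable_EFinP.
- by apply: filterS cvh => x cx _; apply: cvg_EFin => //; exact: nearW.
- exact: iG.
- by apply: aeW => x n _; rewrite /= lee_fin.
apply/fine_cvg; rewrite RintegralE//.
Qed.

(** A Vitali-type theorem: domination up to e times functions of bounded integral stands for
    equi-integrability and tightness. Young's inequality yields such bounds for products like
    Phi(u_n) v, which have no fixed dominating function at hand. *)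
Lemma cvg_Rintegral_unif (h_ A_ : nat -> T -> R) h (M : R) :
  (forall n, mfun (h_ n)) -> mfun h -> (forall n, mfun (A_ n)) ->
  (forall n x, 0 <= A_ n x) ->
  (forall n, \int[mu]_x (A_ n x)%:E <= M%:E)%E ->
  {ae mu, forall x, h_ ^~ x @ \oo --> h x} ->
  (forall e : R, 0 < e -> exists2 G, int G &
     forall n x, `|h_ n x| <= e * A_ n x + G x) ->
  int h /\ \int[mu]_x h_ n x @[n --> \oo] --> \int[mu]_x h x.
Proof.
move=> mh_ mh mA A0 AM cvh dom.
have M0 : 0 <= M.
  by rewrite -lee_fin (le_trans _ (AM 0%N))// integral_ge0// => x _; rewrite lee_fin.
have iA n : int (A_ n).
  by apply: ge0_integrable => //; apply: le_lt_trans (AM n) _; rewrite ltry.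
have ih_ n : int (h_ n).
  have [G iG hG] := dom 1 ltr01.
  apply: (@le_integrableR _ (fun x => 1 * A_ n x + G x)) => //.
  by apply: integrableDR => //; exact: integrableZR.
(* Truncate [h_] at height [G]: the truncations converge by domination, and the
   remainders have integral at most [e * M]. *)
pose clip (g y : R) : R := Num.max (- `|g|) (Num.min `|g| y).
have clip_le (g y : R) : `|clip g y| <= `|g|.
  rewrite /clip ler_norml; have g0 := normr_ge0 g.
  rewrite le_max lexx/= ge_max ge_min lexx andbT; lra.
have clip_diff (g y a : R) : 0 <= a -> `|y| <= a + g -> `|y - clip g y| <= a.
  rewrite /clip => a0 yg.
  have := ler_norm g; have := ler_norm y; have := ler_norm (- y); rewrite normrN.
  have gg := normr_ge0 g.
  case: (leP `|g| y) => gy; case: (leP (- `|g|) _) => gy'; rewrite ler_norml; lra.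
have cont_clip (g : R) : continuous (clip g).
  move=> y; apply: (@continuous_max _ _ (cst _) (fun y => Num.min `|g| y)).
    exact: cst_continuous.
  by apply: (@continuous_min _ _ (cst _) id); [exact: cst_continuous|move=> ?].
have mclip G g : mfun G -> mfun g -> mfun (fun x => clip (G x) (g x)).
  move=> mG mg; apply: measurable_maxr.
    apply: measurableT_comp => //; exact: measurableT_comp.
  by apply: measurable_minr => //; exact: measurableT_comp.
(* Truncation costs e * M twice, for [h_ n] and, by Fatou, for [h]; the integrals of the truncations
   eventually differ by at most e. *)
have main (e : R) : 0 < e -> int h /\ \forall n \near \oo, `|\int[mu]_x h_ n x - \int[mu]_x h x| <= 2 * e * M + e.
  move=> e0; have [G iG hG] := dom e e0.
  have mG := integrable_mfun iG.
  have iGn := integrable_normR iG.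
  pose c_ n x := clip (G x) (h_ n x); pose c x := clip (G x) (h x).
  have mc_ n : mfun (c_ n) by exact: mclip.
  have mc : mfun c by exact: mclip.
  have ic_ n : int (c_ n) by apply: le_integrableR iGn => // x; exact: clip_le.
  have ic : int c by apply: le_integrableR iGn => // x; exact: clip_le.
  have cvc : {ae mu, forall x, c_ ^~ x @ \oo --> c x}.
    apply: filterS cvh => x cx.
    exact: (@continuous_cvg _ _ _ _ _ (fun n => h_ n x) (clip (G x)) (h x) (cont_clip _ _) cx).
  have cvI := dominated_cvg_Rintegral mc_ mc cvc iGn (fun n x => clip_le _ _).
  have hc_ n : (\int[mu]_x (`|h_ n x - c_ n x|)%:E <= (e * M)%:E)%E.
    apply: (@le_trans _ _ (\int[mu]_x (e%:E * (A_ n x)%:E))%E).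
      apply: ge0_le_integral => //.
      - by apply/measurable_EFinP; apply: measurableT_comp => //; exact: measurable_funB.
      - by under eq_fun do rewrite -EFinM; apply/measurable_EFinP; exact: measurable_funM.
      - move=> x _; rewrite -EFinM lee_fin; apply: clip_diff => //.
        by rewrite mulr_ge0// ltW.
    rewrite ge0_integralZl_EFin//; last exact: ltW.
    - by rewrite EFinM lee_wpmul2l// lee_fin ltW.
    - by move=> x _; rewrite lee_fin.
    - exact/measurable_EFinP.
  have hc : (\int[mu]_x (`|h x - c x|)%:E <= (e * M)%:E)%E.
    apply: fatou_ae hc_ => //.
    - by move=> n; apply: measurableT_comp => //; exact: measurable_funB.
    - by apply: measurableT_comp => //; exact: measurable_funB.
    - apply: filterS2 cvh cvc => x cx ccx.
      by apply: cvg_norm; exact: cvgB.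
  have ihc : int (fun x => h x - c x).
    have ihcn : int (fun x => `|h x - c x|).
      apply: ge0_integrable => //; last by apply: le_lt_trans hc _; rewrite ltry.
      by apply: measurableT_comp => //; exact: measurable_funB.
    by apply: le_integrableR ihcn => //; exact: measurable_funB.
  have ih : int h.
    have := integrableDR ihc ic; apply: eq_integrable => // x _ /=.
    by rewrite subrK.
  split => //.
  have bd f g : int f -> int g -> (\int[mu]_x (`|f x - g x|)%:E <= (e * M)%:E)%E ->
      `|\int[mu]_x f x - \int[mu]_x g x| <= e * M.
    move=> fi gi fg; rewrite -RintegralB//.
    have fgi := integrableBR fi gi.
    apply: le_trans (le_normr_Rintegral _ fgi) _ => //.
    by rewrite -lee_fin RintegralE//; exact: integrable_normR.
  move/cvgrPdist_le : cvI => /(_ _ e0); apply: filterS => n cn.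
  have b1 := bd _ _ (ih_ n) (ic_ n) (hc_ n).
  have b2 := bd _ _ ih ic hc.
  rewrite distrC in cn; rewrite distrC in b2.
  have := ler_normD (\int[mu]_x h_ n x - \int[mu]_x c_ n x) (\int[mu]_x c_ n x - \int[mu]_x c x).
  have := ler_normD (\int[mu]_x h_ n x - \int[mu]_x c x) (\int[mu]_x c x - \int[mu]_x h x).
  rewrite !addrA !subrK; move: b1 b2 cn; lra.
split; first by have [] := main 1 ltr01.
apply/cvgrPdist_le => e e0.
have e'0 : 0 < e / (2 * M + 1) by rewrite divr_gt0//; lra.
have [_] := main _ e'0; apply: filterS => n; rewrite distrC => /le_trans; apply.
rewrite -[X in _ + X]mul1r -mulrA mulrCA mulrA -[X in X + _]mulrA [X in X + _]mulrCA.
rewrite (_ : _ + _ = e) //; field; lra.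
Qed.

End integral.

(** Dominated convergence speaks of sequences, so continuity of integrals in a parameter is reduced
    to sequences. *)
Lemma seq_continuous (R : realType) (V : pseudoMetricType R) (f : V -> R) :
  (forall (u : nat -> V) l, u n @[n --> \oo] --> l -> f (u n) @[n --> \oo] --> f l) ->
  continuous f.
Proof.
move=> H x; apply/cvgrPdist_lt => e e0; apply: contrapT => nfx.
have /choice[u Hu] : forall n, exists y, ball x n.+1%:R^-1 y /\ ~ `|f x - f y| < e.
  move=> n; apply: contrapT => /forallNP h; apply: nfx.
  apply/nbhs_ballP; exists n.+1%:R^-1; first by rewrite /= invr_gt0.
  move=> y xy; apply: contrapT => nxy; exact: (h y (conj xy nxy)).
have ux : u n @[n --> \oo] --> x.
  apply/cvg_ballP => d d0.
  have := near_infty_natSinv_lt (PosNum d0); apply: filterS => n /ltW nd.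
  by have [+ _] := Hu n; exact: le_ball.
have /cvgrPdist_lt/(_ _ e0) [n _ /(_ n (leqnn n))] := H u x ux.
by have [_] := Hu n.
Qed.

Section powR_bounds.
Context (R : realType).
Implicit Types a b r : R.

(** The sum is at most twice the larger term; no convexity enters, so r < 1 is covered. *)
Lemma norm_powRD_le a b r : 0 <= r ->
  `|a + b| `^ r <= 2 `^ r * (`|a| `^ r + `|b| `^ r).
Proof.
move=> r0; wlog ab : a b / `|a| <= `|b|.
  move=> h; have [/h//|/ltW/h] := leP `|a| `|b|.
  by rewrite addrC [X in _ * X]addrC.
apply: (@le_trans _ _ ((2 * `|b|) `^ r)).
  rewrite ge0_ler_powR// ?nnegrE ?mulr_ge0//.
  by rewrite (le_trans (ler_normD _ _))// mulr_natl mulr2n lerD2r.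
by rewrite powRM// ler_wpM2l ?powR_ge0// lerDr powR_ge0.
Qed.

Lemma norm_le_powR a b r : 0 <= r -> `|a| <= b -> `|a| `^ r <= b `^ r.
Proof.
by move=> r0 ab; rewrite ge0_ler_powR// nnegrE// (le_trans _ ab).
Qed.

End powR_bounds.

(** * Superposition operators in weighted L^r *)

Section superposition.
Context d (T : measurableType d) (R : realType).
Variable mu : {measure set T -> \bar R}.
Variable (k : T -> R) (r : R).
Implicit Types (a b : T -> R).
Hypotheses (mk : measurable_fun setT k) (k0 : forall x, 0 <= k x) (r1 : 1 < r).
Local Notation int f := (mu.-integrable setT (EFin \o f)).
Local Notation mfun f := (measurable_fun setT f).

Let r0 : 0 <= r. Proof. by rewrite ltW// (lt_trans ltr01). Qed.
Let rgt0 : 0 < r. Proof. by rewrite (lt_trans ltr01). Qed.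

(** The weight lets one theory serve both the increments u(x) - u(y) against the kernel and u itself
    against Lebesgue measure. *)
Definition weighted_Lp (a : T -> R) :=
  mfun a /\ int (fun x => `|a x| `^ r * k x).

Lemma measurable_norm_powR a : mfun a -> mfun (fun x => `|a x| `^ r).
Proof.
move=> ma; apply: (@measurableT_comp _ _ _ _ _ _ (@powR R ^~ r)).
  exact: measurable_powR.
exact: measurableT_comp.
Qed.

Lemma measurable_norm_powRk a : mfun a -> mfun (fun x => `|a x| `^ r * k x).
Proof. by move=> ma; apply: measurable_funM => //; exact: measurable_norm_powR. Qed.

Lemma weighted_LpD a b : weighted_Lp a -> weighted_Lp b ->
  weighted_Lp (fun x => a x + b x).
Proof.
move=> [ma ia] [mb ib]; have mab : mfun (fun x => a x + b x) by exact: measurable_funD.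
split => //.
have := integrableZR (2 `^ r) (integrableDR ia ib).
apply: le_integrableR => [|x]; first exact: measurable_norm_powRk.
rewrite ger0_norm ?mulr_ge0 ?powR_ge0//.
by rewrite -mulrDl mulrA ler_wpM2r// norm_powRD_le.
Qed.

Lemma weighted_LpZ c a : weighted_Lp a -> weighted_Lp (fun x => c * a x).
Proof.
move=> [ma ia]; have mca : mfun (fun x => c * a x) by exact: measurable_funM.
split => //; have := integrableZR (`|c| `^ r) ia.
apply: le_integrableR => [|x]; first exact: measurable_norm_powRk.
by rewrite ger0_norm ?mulr_ge0 ?powR_ge0// normrM powRM// mulrA.
Qed.

Lemma weighted_Lp_norm a : weighted_Lp a -> weighted_Lp (fun x => `|a x|).
Proof.
move=> [ma ia]; split; first exact: measurableT_comp.
by under [X in int X]eq_fun do rewrite normr_id.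
Qed.

Lemma weighted_Lp0 : weighted_Lp (fun=> 0).
Proof.
split => //; under [X in int X]eq_fun do rewrite normr0 powR0 ?gt_eqF// mul0r.
exact: integrable0.
Qed.

Lemma weighted_Lp_sum n (b : 'I_n -> T -> R) :
  (forall i, weighted_Lp (b i)) -> weighted_Lp (fun x => \sum_i b i x).
Proof.
elim: n b => [b _|n IH b bi].
  by under eq_fun do rewrite big_ord0; exact: weighted_Lp0.
under eq_fun do rewrite big_ord_recl.
by apply: weighted_LpD => //; apply: IH => i; exact: bi.
Qed.

Variables (psi Psi : R -> R) (C : R).
Hypotheses (psi_cont : continuous psi) (dPsi : forall t : R, is_derive t 1 Psi (psi t)).
Hypotheses (Psi0 : Psi 0 = 0) (psi_le : forall t : R, `|psi t| <= C * `|t| `^ (r - 1)).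

Let C0 : 0 <= C.
Proof. by have := psi_le 1; rewrite normr1 powR1 mulr1; exact: le_trans. Qed.

Let Psi_cont : continuous Psi.
Proof.
move=> x; apply: differentiable_continuous; apply/derivable1_diffP.
by have [] := dPsi x.
Qed.

Lemma primitive_growth (t : R) : `|Psi t| <= C * `|t| `^ r.
Proof.
have key (c : R) : `|c| <= `|t| -> `|psi c * t| <= C * `|t| `^ r.
  move=> ct; rewrite normrM.
  apply: (@le_trans _ _ (C * `|t| `^ (r - 1) * `|t|)).
    rewrite ler_wpM2r// (le_trans (psi_le _))// ler_wpM2l// norm_le_powR//.
    by rewrite subr_ge0 ltW.
  by rewrite -mulrA [X in _ * X]mulrC mulr_powRB1.
have [t0|t0|<-] := ltgtP 0 t; last first.
- by rewrite Psi0 normr0 mulr_ge0 ?powR_ge0.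
- have [|c] := @MVT R Psi psi t 0 t0 (fun x _ => dPsi x).
    exact: continuous_subspaceT.
  rewrite in_itv/= => /andP[tc c0]; rewrite Psi0 sub0r => h.
  rewrite -normrN h sub0r mulrN normrN key//.
  by rewrite !ltr0_norm// lerN2 ltW.
- have [|c] := @MVT R Psi psi 0 t t0 (fun x _ => dPsi x).
    exact: continuous_subspaceT.
  rewrite in_itv/= => /andP[tc c0]; rewrite Psi0 !subr0 => h.
  by rewrite h key// !gtr0_norm// ltW.
Qed.

(** A common majorant of both factors turns the product into a pure r-th power, which replaces
    Hoelder's inequality in all the dominations below. *)
Lemma superposition_bound (u b B : R) : `|u| <= B -> `|b| <= B ->
  `|psi u * b| <= C * B `^ r.
Proof.
move=> uB bB; have B0 : 0 <= B by exact: le_trans uB.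
rewrite normrM; apply: (@le_trans _ _ (C * B `^ (r - 1) * B)).
  apply: ler_pM => //; apply: le_trans (psi_le _) _.
  by rewrite ler_wpM2l// norm_le_powR// subr_ge0 ltW.
by rewrite -mulrA [X in _ * X]mulrC mulr_powRB1.
Qed.

Lemma measurable_superposition a : mfun a -> mfun (fun x => Psi (a x) * k x).
Proof.
move=> ma; apply: measurable_funM => //; apply: measurableT_comp => //.
exact: continuous_measurable_fun.
Qed.

Lemma measurable_dsuperposition a b : mfun a -> mfun b ->
  mfun (fun x => psi (a x) * b x * k x).
Proof.
move=> ma mb; apply: measurable_funM => //; apply: measurable_funM => //.
by apply: measurableT_comp => //; exact: continuous_measurable_fun.
Qed.

Lemma integrable_superposition a : weighted_Lp a -> int (fun x => Psi (a x) * k x).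
Proof.
move=> [ma ia]; have := integrableZR C ia.
apply: le_integrableR => [|x]; first exact: measurable_superposition.
by rewrite normrM mulrA (ger0_norm (k0 x)) ler_wpM2r// primitive_growth.
Qed.

Lemma integrable_dsuperposition a b : weighted_Lp a -> weighted_Lp b ->
  int (fun x => psi (a x) * b x * k x).
Proof.
move=> La Lb; have [_ iab] := weighted_LpD (weighted_Lp_norm La) (weighted_Lp_norm Lb).
have := integrableZR C iab.
apply: le_integrableR => [|x].
  by apply: measurable_dsuperposition; [case: La|case: Lb].
rewrite normrM (ger0_norm (k0 x)) mulrA ler_wpM2r//.
rewrite (ger0_norm (addr_ge0 _ _))//.
by apply: superposition_bound; rewrite ?lerDl ?lerDr.
Qed.

Lemma superposition_is_derive a b (t : R) : weighted_Lp a -> weighted_Lp b ->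
  is_derive t 1 (fun t => \int[mu]_x (Psi (a x + t * b x) * k x))
    (\int[mu]_x (psi (a x + t * b x) * b x * k x)).
Proof.
move=> La Lb.
pose f (t : R) x := Psi (a x + t * b x) * k x.
(* [B] majorises both [b] and every [a + s * b] with [|s - t| <= 1]. *)
pose B x := `|a x| + (`|t| + 1) * `|b x|.
have LB : weighted_Lp B.
  by apply: weighted_LpD; [exact: weighted_Lp_norm|apply/weighted_LpZ/weighted_Lp_norm].
have B0 x : 0 <= B x by rewrite /B addr_ge0// mulr_ge0// addr_ge0.
pose G x := C * (`|B x| `^ r * k x).
have G0 x : 0 <= G x by rewrite !mulr_ge0// powR_ge0.
have iG : int G by apply: integrableZR; case: LB.
have tt : `]t - 1, t + 1[%classic t by rewrite /= in_itv/=; lra.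
have Lf (s : R) : weighted_Lp (fun x => a x + s * b x).
  by apply: weighted_LpD => //; exact: weighted_LpZ.
have df (s : R) x : is_derive s 1 (f ^~ x) (psi (a x + s * b x) * b x * k x).
  have h1 : is_derive s 1 (fun s : R => a x + s * b x) (b x).
    have h := is_deriveM (is_derive_id s (1:R)) (is_derive_cst (b x) s (1:R)).
    apply: (is_derive_eq (is_deriveD (is_derive_cst (a x) s (1:R)) h)).
    by rewrite scaler0 !add0r /GRing.scale/= mulr1.
  have h2 := @is_derive1_comp R Psi (fun s : R => a x + s * b x) s _ _ (dPsi _) h1.
  apply: (is_derive_eq (is_deriveM h2 (is_derive_cst (k x) s (1:R)))).
  by rewrite scaler0 add0r/= /GRing.scale/= mulrC.
have p1 (s : R) x : partial1of2 f s x = psi (a x + s * b x) * b x * k x.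
  by rewrite partial1of2E; have [_ ->] := df s x.
have cvd : h^-1 *: (\int[mu]_x f (h + t) x - \int[mu]_x f t x) @[h --> (0:R)^'] -->
    \int[mu]_x (psi (a x + t * b x) * b x * k x).
  have := @cvg_differentiation_under_integral R _ T mu f setT measurableT t (t - 1) (t + 1) tt _ _ G G0 iG _.
  rewrite (_ : (fun y => partial1of2 f t y) = (fun x => psi (a x + t * b x) * b x * k x)); last first.
    by apply/funext => x; rewrite p1.
  apply.
  - by move=> s _; exact: integrable_superposition.
  - by move=> s x _ _; have [] := df s x.
  - move=> s x; rewrite /= in_itv/= => st _; rewrite p1 normrM (ger0_norm (k0 x)) /G mulrA.
    rewrite ler_wpM2r// (ger0_norm (B0 x)); apply: superposition_bound.
      rewrite /B (le_trans (ler_normD _ _))// lerD2l normrM ler_wpM2r//.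
      have := ler_normD t (s - t); rewrite addrC subrK.
      suff : `|s - t| <= 1 by lra.
      by rewrite ler_norml; lra.
    rewrite /B; have := normr_ge0 t; have := normr_ge0 (a x); have := normr_ge0 (b x); nra.
apply: DeriveDef.
  apply/cvg_ex; exists (\int[mu]_x (psi (a x + t * b x) * b x * k x)).
  by under eq_fun do rewrite scaler1.
by rewrite /derive; under eq_fun do rewrite scaler1; exact: cvg_lim cvd.
Qed.

End superposition.

Section continuity_rV.
Context d (T : measurableType d) (R : realType).
Variable mu : {measure set T -> \bar R}.

Lemma coord_le_norm n (v : 'rV[R]_n) i : `|v ord0 i| <= `|v|.
Proof. by rewrite [leRHS]/Num.norm/= mx_normrE (le_bigmax _ _ (ord0, i)). Qed.

Lemma continuity_under_integral_rV n (g : 'rV[R]_n -> T -> R) :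
  (forall c, measurable_fun setT (g c)) -> (forall x, continuous (g ^~ x)) ->
  (forall M : R, exists2 G, mu.-integrable setT (EFin \o G) &
     forall (c : 'rV[R]_n) x, (forall i, `|c ord0 i| <= M) -> `|g c x| <= G x) ->
  continuous (fun c => \int[mu]_x g c x).
Proof.
move=> mg cg dom; apply: seq_continuous => u l ul.
(* The sequence eventually stays within distance 1 of its limit, so one dominating function serves
   its tail. *)
have [G iG hG] := dom (`|l| + 1).
have /cvgrPdist_le /(_ 1 ltr01) [N _ Nu] := ul.
rewrite -(cvg_shiftn N).
apply: (dominated_cvg_Rintegral _ _ _ iG) => [m|||m x] //.
- apply: aeW => x; apply: (@continuous_cvg _ _ _ _ _ (fun m => u (m + N)%N) (g^~ x)).
    exact: cg.
  by rewrite (cvg_shiftn N).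
- apply: hG => i.
  have : `|l - u (m + N)%N| <= 1 by apply: Nu; rewrite /= leq_addl.
  have := coord_le_norm l i; have := coord_le_norm (l - u (m + N)%N) i.
  rewrite !mxE => h1 h2 h3.
  have := ler_distD (l ord0 i) (u (m + N)%N ord0 i) 0.
  by rewrite !subr0 distrC; lra.
Qed.

End continuity_rV.

Section nemytskii.
Context d (T : measurableType d) (R : realType).
Variable mu : {measure set T -> \bar R}.
Variables (k : T -> R) (r : R).
Hypotheses (mk : measurable_fun setT k) (k0 : forall x, 0 <= k x) (r1 : 1 < r).
Local Notation Lp := (weighted_Lp mu k r).
Local Notation mfun f := (measurable_fun setT f).

Let r0 : 0 <= r. Proof. by rewrite ltW// (lt_trans ltr01). Qed.

Definition lincomb n (bs : 'I_n -> T -> R) (c : 'rV[R]_n) (x : T) : R :=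
  \sum_i c ord0 i * bs i x.

Variables (n : nat) (bs : 'I_n -> T -> R).
Hypothesis Lbs : forall i, Lp (bs i).

Let S (M : R) x := M * \sum_i `|bs i x|.

Let LS M : Lp (S M).
Proof.
apply: weighted_LpZ => //; apply: weighted_Lp_sum => // i; exact: weighted_Lp_norm.
Qed.

Lemma weighted_Lp_lincomb c : Lp (lincomb bs c).
Proof. by apply: weighted_Lp_sum => // i; exact: weighted_LpZ. Qed.

Let lincomb_le (c : 'rV[R]_n) (M : R) x : (forall i, `|c ord0 i| <= M) -> `|lincomb bs c x| <= S M x.
Proof.
move=> cM; rewrite /lincomb /S mulr_sumr (le_trans (ler_norm_sum _ _ _))//.
by apply: ler_sum => i _; rewrite normrM ler_wpM2r.
Qed.

Lemma lincomb_continuous x : continuous (fun c => lincomb bs c x).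
Proof.
apply: continuous_big => [|i _].
  by move=> z; apply: cvgD; [exact: cvg_fst|exact: cvg_snd].
move=> c; apply: (@continuousM _ _ (fun c : 'rV[R]_n => c ord0 i) (cst (bs i x))).
  exact: coord_continuous.
exact: cst_continuous.
Qed.

Variables (h : R -> R) (C : R).
Hypothesis (ch : continuous h).

Lemma nemytskii_continuous : (forall t, `|h t| <= C * `|t| `^ r) ->
  continuous (fun c => \int[mu]_x (h (lincomb bs c x) * k x)).
Proof.
move=> hC; have C0 : 0 <= C.
  by have := hC 1; rewrite normr1 powR1 mulr1; exact: le_trans.
apply: continuity_under_integral_rV.
- move=> c; apply: measurable_funM => //; apply: measurableT_comp.
    exact: continuous_measurable_fun.
  by case: (weighted_Lp_lincomb c).
- move=> x c; apply: (@continuousM _ _ (fun c => h (lincomb bs c x)) (cst (k x))).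
    apply: (@continuous_comp _ _ _ (fun c => lincomb bs c x) h); last exact: ch.
    exact: lincomb_continuous.
  exact: cst_continuous.
- move=> M; exists (fun x => C * (`|S M x| `^ r * k x)).
    by apply: integrableZR; case: (LS M).
  move=> c x cM; rewrite normrM (ger0_norm (k0 x)) mulrA ler_wpM2r//.
  apply: le_trans (hC _) _; rewrite ler_wpM2l// norm_le_powR//.
  by apply: le_trans (lincomb_le x cM) _; exact: ler_norm.
Qed.

Lemma dnemytskii_continuous (w : T -> R) : Lp w ->
  (forall t, `|h t| <= C * `|t| `^ (r - 1)) ->
  continuous (fun c => \int[mu]_x (h (lincomb bs c x) * w x * k x)).
Proof.
move=> Lw hC; have C0 : 0 <= C.
  by have := hC 1; rewrite normr1 powR1 mulr1; exact: le_trans.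
have [mw _] := Lw.
apply: continuity_under_integral_rV.
- move=> c; apply: measurable_funM => //; apply: measurable_funM => //.
  apply: measurableT_comp; first exact: continuous_measurable_fun.
  by case: (weighted_Lp_lincomb c).
- move=> x c; apply: (@continuousM _ _ (fun c => h (lincomb bs c x) * w x) (cst (k x))).
    apply: (@continuousM _ _ (fun c => h (lincomb bs c x)) (cst (w x))).
      apply: (@continuous_comp _ _ _ (fun c => lincomb bs c x) h); last exact: ch.
      exact: lincomb_continuous.
    exact: cst_continuous.
  exact: cst_continuous.
- move=> M.
  have Lb : Lp (fun x => `|S M x| + `|w x|).
    by apply: weighted_LpD => //; exact: weighted_Lp_norm.
  exists (fun x => C * (`| `|S M x| + `|w x| | `^ r * k x)).
    by apply: integrableZR; case: Lb.
  move=> c x cM; rewrite normrM (ger0_norm (k0 x)) mulrA ler_wpM2r//.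
  rewrite [X in _ <= _ * X `^ _]ger0_norm ?addr_ge0//; apply: (superposition_bound r1 hC).
    by apply: le_trans (lincomb_le x cM) _; rewrite (le_trans (ler_norm _))// lerDl.
  by rewrite lerDr.
Qed.

End nemytskii.

(** * Null sets in products and integrals of a.e. equal functions *)

Section almost_everywhere_product.
Context d1 d2 (T1 : measurableType d1) (T2 : measurableType d2) (R : realType).
Variables (m1 : {sigma_finite_measure set T1 -> \bar R}) (m2 : {sigma_finite_measure set T2 -> \bar R}).

Lemma ae_prod_fst (Q : T1 -> Prop) : {ae m1, forall x, Q x} ->
  {ae (m1 \x m2)%E, forall z, Q z.1}.
Proof.
move=> [A [mA A0 QA]]; exists (A `*` setT); split.
- exact: measurableX.
- transitivity (m1 A * m2 setT)%E; first exact: product_measure1E.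
  by rewrite A0 mul0e.
- by move=> z /= nQ; split => //; exact: QA.
Qed.

Lemma ae_prod_snd (Q : T2 -> Prop) : {ae m2, forall x, Q x} ->
  {ae (m1 \x m2)%E, forall z, Q z.2}.
Proof.
move=> [A [mA A0 QA]]; exists (setT `*` A); split.
- exact: measurableX.
- transitivity (m1 setT * m2 A)%E; first exact: product_measure1E.
  by rewrite A0 mule0.
- by move=> z /= nQ; split => //; exact: QA.
Qed.

End almost_everywhere_product.

Section almost_everywhere_integral.
Context d (T : measurableType d) (R : realType).
Variable mu : {measure set T -> \bar R}.

Import HBNNSimple.

(* The functions need not be measurable: simple functions below [f] are cut off
   on a null set outside of which [f] and [g] agree. *)
Let ae_le_integral (f g : T -> \bar R) : (forall x, 0 <= f x)%E -> (forall x, 0 <= g x)%E ->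
  {ae mu, forall x, f x = g x} -> (\int[mu]_x f x <= \int[mu]_x g x)%E.
Proof.
move=> f0 g0 [A [mA A0 fgA]].
have mAc : measurable (~` A) by exact: measurableC.
rewrite !ge0_integralTE//; apply: ge_ereal_sup => _ [h hf <-].
apply: ereal_sup_ubound; exists (proj_nnsfun h mAc) => [x|].
  rewrite /=; have [xA|xA] := pselect (A x).
    by rewrite mindicE memNset ?mulr0//; apply.
  rewrite mindicE mem_set// mulr1; have := hf x.
  suff -> : f x = g x by [].
  by apply: contrapT => /fgA.
rewrite -!integralT_nnsfun; apply: ae_eq_integral => //.
- by apply/measurable_EFinP.
- by apply/measurable_EFinP.
- exists A; split => // x /= /not_implyP[_ h1]; apply: contrapT => xA; apply: h1.
  by rewrite mindicE mem_set// mulr1.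
Qed.

(** Needed because K is only a.e. equal to a Borel function: the integrand of [nonlocal_form] may
    fail to be measurable for the Borel sigma-algebra. *)
Lemma ae_eq_integral_nonmeasurable (f g : T -> \bar R) : {ae mu, forall x, f x = g x} ->
  (\int[mu]_x f x = \int[mu]_x g x)%E.
Proof.
move=> fg; rewrite [LHS]integralE [RHS]integralE.
have pos (h k : T -> \bar R) : {ae mu, forall x, h x = k x} ->
    (\int[mu]_x (h^\+ x) = \int[mu]_x (k^\+ x))%E.
  move=> hk; apply/eqP; rewrite eq_le !ae_le_integral//.
  - by apply: filterS hk => x hk; rewrite !funeposE hk.
  - by apply: filterS hk => x hk; rewrite !funeposE hk.
rewrite (pos f g fg); congr (_ - _)%E.
have := pos (\- f)%E (\- g)%E; rewrite !funeposN; apply.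
by apply: filterS fg => x ->.
Qed.

Lemma ae_eq_Rintegral (f g : T -> R) : {ae mu, forall x, f x = g x} ->
  \int[mu]_x f x = \int[mu]_x g x.
Proof.
move=> fg; rewrite /Rintegral; congr fine; apply: ae_eq_integral_nonmeasurable.
by apply: filterS fg => x ->.
Qed.

Lemma Rintegral0_ae (f : T -> R) : mu.-integrable setT (EFin \o f) -> (forall x, 0 <= f x) ->
  \int[mu]_x f x = 0 -> {ae mu, forall x, f x = 0}.
Proof.
move=> fi f0 h; have mf := integrable_mfun fi.
have : (\int[mu]_x `|(f x)%:E|)%E = 0.
  under eq_integral do rewrite gee0_abs ?lee_fin//.
  by rewrite -RintegralE// h.
have mfE : measurable_fun setT (EFin \o f) by exact/measurable_EFinP.
move/(ae_eq_integral_abs mu measurableT mfE).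
by apply: filterS => x /(_ I) /= [].
Qed.

End almost_everywhere_integral.

(** * Dyadic cells of R^N *)

Section euclidean_measure.
Context (R : realType).

(** [lebesgue_rV_box] treats closed boxes; dyadic cells have half-open sides. *)
Lemma lebesgue_rV_prod n (A : 'I_n -> set R) (m : 'I_n -> R) :
  (forall i, measurable (A i)) -> (forall i, lebesgue_measure (A i) = (m i)%:E) ->
  lebesgue_rV R n [set v : 'rV[R]_n | forall i, A i (v ord0 i)] = (\prod_i m i)%:E.
Proof.
elim: n A m => [A m _ _|n IHn A m mA Am].
  by rewrite big_ord0 /= diracE mem_set// => -[].
rewrite [LHS](_ : _ = (lebesgue_measure \x lebesgue_rV R n)%E
    (A ord0 `*` [set v : 'rV[R]_n | forall i, A (lift ord0 i) (v ord0 i)])); last first.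
  congr ((_ \x _)%E _).
  have E0 z : rV_cons z ord0 ord0 = z.1 :> R by have := congr1 fst (rV_consK z).
  have ES (z : measurableTypeR R * 'rV[R]_n) i :
      rV_cons z ord0 (lift ord0 i) = z.2 ord0 i.
    rewrite /rV_cons (_ : lift _ _ = rshift 1 i); last exact: val_inj.
    by rewrite (@row_mxEr _ 1 1 n).
  apply/seteqP; split => z.
    move=> zA; split; first by have := zA ord0; rewrite /= E0.
    by move=> i; have := zA (lift ord0 i); rewrite ES.
  case=> /= z1 z2 i; case: (unliftP ord0 i) => [j ->|->]; first by rewrite ES; exact: z2.
  by rewrite E0.
rewrite product_measure1E; last 2 first.
- exact: mA.
- rewrite (_ : mkset _ = \bigcap_(i in [set: 'I_n])
      ((fun v : 'rV[R]_n => v ord0 i) @^-1` A (lift ord0 i))).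
    apply: fin_bigcap_measurable => [|i _]; first exact: finite_finset.
    by rewrite -[X in measurable X]setTI; apply: measurable_coord => //.
  by apply/seteqP; split => v /= vA i; [move=> _; exact: vA|exact: (vA i I)].
by rewrite (IHn (fun i => A (lift ord0 i)) (fun i => m (lift ord0 i)))// [X in (X * _)%E](Am ord0) big_ord_recl EFinM.
Qed.

Lemma rV_norm_le n (v : 'rV[R]_n) (c : R) : 0 <= c ->
  (`|v| <= c) = [forall i, `|v ord0 i| <= c].
Proof.
move=> c0; apply/idP/forallP => [vc i|vc]; first exact: le_trans (coord_le_norm v i) vc.
rewrite [leLHS]/Num.norm/= mx_normrE; apply/bigmax_leP; split => // -[i j] _ /=.
by rewrite (ord1 i).
Qed.

End euclidean_measure.

Section dyadic_cells.
Context (R : realType) (N : nat).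
Local Notation mu := (lebesgue_rV R N).
Implicit Types (x y : 'rV[R]_N) (k : nat).

(** The index of the half-open dyadic cube of side 2^-k containing x. Indices form a countable type,
    so cells are handled by countable unions. *)
Definition cell k x : {ffun 'I_N -> int} := [ffun i => Num.floor (2 ^+ k * x ord0 i)].

Lemma cellP k x (m : {ffun 'I_N -> int}) :
  (cell k x == m) = [forall i, (m i)%:~R / 2 ^+ k <= x ord0 i < (m i + 1)%:~R / 2 ^+ k].
Proof.
have k0 : 0 < (2 : R) ^+ k by rewrite exprn_gt0.
apply/eqP/forallP => [<- i|h].
  rewrite ffunE ler_pdivrMr// ltr_pdivlMr// mulrC.
  exact: floor_itv.
apply/ffunP => i; rewrite ffunE; apply/eqP; rewrite floor_eq mulrC.
by rewrite -ler_pdivrMr// -ltr_pdivlMr.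
Qed.

Lemma cell_dist k x y : cell k x = cell k y -> `|x - y| <= 2 ^- k.
Proof.
move=> xy; rewrite rV_norm_le ?invr_ge0 ?exprn_ge0//; apply/forallP => i.
rewrite !mxE; have /eqP := xy; rewrite cellP => /forallP/(_ i).
have := cellP k y (cell k y); rewrite eqxx => /esym/forallP/(_ i).
rewrite intrD mulrDl mul1r => /andP[a b] /andP[c d].
by rewrite ler_norml; lra.
Qed.

Lemma cell_refine k x y : cell k.+1 x = cell k.+1 y -> cell k x = cell k y.
Proof.
(* The coarse index is a function of the fine one: floor a = floor (floor (2 a) / 2). *)
have half z : cell k z = [ffun i => Num.floor ((cell k.+1 z i)%:~R / 2 : R)].
  apply/ffunP => i; rewrite !ffunE; apply/eqP.
  set a := 2 ^+ k * z ord0 i.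
  have -> : 2 ^+ k.+1 * z ord0 i = 2 * a by rewrite exprS mulrA.
  rewrite eq_sym floor_eq; apply/andP; split.
    rewrite ler_pdivlMr//.
    rewrite (_ : _ * 2 = (Num.floor a * 2)%:~R); last by rewrite intrM.
    rewrite ler_int floor_ge_int intrM mulrC ler_pM2l//.
    exact: floor_le.
  rewrite ltr_pdivrMr//; apply: (@le_lt_trans _ _ (2 * a)); first exact: floor_le.
  by rewrite mulrC ltr_pM2r// floorD1_gt.
by move=> h; rewrite !half h.
Qed.

Lemma measurable_cell k (m : {ffun 'I_N -> int}) : measurable [set x | cell k x = m].
Proof.
rewrite (_ : [set x | _] = \bigcap_(i in [set: 'I_N])
      ((fun v : 'rV[R]_N => v ord0 i) @^-1` `[(m i)%:~R / 2 ^+ k, (m i + 1)%:~R / 2 ^+ k[)).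
  apply: fin_bigcap_measurable => [|i _]; first exact: finite_finset.
  by rewrite -[X in measurable X]setTI; apply: measurable_coord => //.
apply/seteqP; split => x /=.
  by move=> /eqP; rewrite cellP => /forallP h i _; rewrite /= in_itv/=; exact: h.
move=> h; apply/eqP; rewrite cellP; apply/forallP => i.
by have := h i I; rewrite /= in_itv.
Qed.

Lemma measure_cell k (m : {ffun 'I_N -> int}) :
  mu [set x | cell k x = m] = (2 ^- (k * N))%:E.
Proof.
rewrite (_ : [set x | _] = [set v : 'rV[R]_N | forall i,
   `[(m i)%:~R / 2 ^+ k, (m i + 1)%:~R / 2 ^+ k[%classic (v ord0 i)]); last first.
  apply/seteqP; split => x /=.
    by move=> /eqP; rewrite cellP => /forallP h i; rewrite /= in_itv/=; exact: h.
  move=> h; apply/eqP; rewrite cellP; apply/forallP => i.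
  by have := h i; rewrite /= in_itv.
rewrite (@lebesgue_rV_prod _ _ (fun i => `[(m i)%:~R / 2 ^+ k, (m i + 1)%:~R / 2 ^+ k[%classic) (fun=> 2 ^- k)).
- by rewrite prodr_const card_ord exprM exprVn.
- by move=> i; exact: measurable_itv.
- move=> i; rewrite lebesgue_measure_itv/= lte_fin ltr_pM2r ?invr_gt0 ?exprn_gt0//.
  rewrite ltr_int ltrDl ltr01 -EFinB intrD mulrDl mul1r.
  by rewrite addrC addKr.
Qed.

(** The sigma-algebra is generated by coordinates; an open set is the countable union of the dyadic
    cells that it contains. *)
Lemma open_measurable_rV (A : set 'rV[R]_N) : open A -> measurable A.
Proof.
move=> oA.
have -> : A = \bigcup_k \bigcup_(m : {ffun 'I_N -> int})
    [set x | (forall y, cell k y = m -> A y) /\ cell k x = m].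
  apply/seteqP; split => [x Ax|x [k _ [m _ [/= mA xm]]]]; last exact: mA.
  have /nbhs_ballP[e /= e0 eA] : nbhs x A by exact: open_nbhs_nbhs.
  have [k ke] : exists k, 2 ^- k < e.
    have [k _ /(_ k (leqnn k))] := near_infty_natSinv_expn_lt (PosNum e0).
    by rewrite /= div1r => ?; exists k.
  exists k => //; exists (cell k x) => //=; split => // y yx; apply: eA.
  rewrite -ball_normE/=; apply: le_lt_trans ke; exact: cell_dist.
apply: bigcup_measurable => k _; apply: countable_bigcupT_measurable => // m.
have [mA|mA] := pselect (forall y, cell k y = m -> A y).
  rewrite (_ : [set _ | _] = [set x | cell k x = m]); first exact: measurable_cell.
  by apply/seteqP; split => x //= -[].
by rewrite (_ : [set _ | _] = set0)// -subset0 => x [].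
Qed.

Lemma continuous_measurable_rV (f : 'rV[R]_N -> R) : continuous f -> measurable_fun setT f.
Proof.
move=> cf; apply: (measurability _ (RGenOInfty.measurableE R)) => //.
move=> _ [_ [x ->] <-]; rewrite setTI; apply: open_measurable_rV.
by apply: open_comp => //; exact: interval_open.
Qed.

Lemma measurable_same_cell k : measurable [set z : 'rV[R]_N * 'rV[R]_N | cell k z.1 = cell k z.2].
Proof.
have -> : [set z : 'rV[R]_N * 'rV[R]_N | cell k z.1 = cell k z.2] =
    \bigcup_(m : {ffun 'I_N -> int}) ([set x | cell k x = m] `*` [set x | cell k x = m]).
  apply/seteqP; split => z /=; first by move=> h; exists (cell k z.1).
  by move=> [m _ [/= -> ->]].
apply: countable_bigcupT_measurable => // m.
by apply: measurableX; exact: measurable_cell.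
Qed.

End dyadic_cells.

(** * Jensen's inequality and geometric chaining *)

Section jensen.
Context d (T : measurableType d) (R : realType).
Variable mu : {measure set T -> \bar R}.

(** Convexity of the p-th power in tangent form at a, read off from Young's inequality with
    exponents p and p / (p - 1). *)
Lemma powR_tangent (p a t : R) : 1 < p -> 0 <= a -> 0 <= t ->
  p * a `^ (p - 1) * t <= t `^ p + (p - 1) * a `^ p.
Proof.
move=> p1 a0 t0.
have p0 : 0 < p by rewrite (lt_trans ltr01).
have pm1 : 0 < p - 1 by rewrite subr_gt0.
have := @conjugate_powR R t (a `^ (p - 1)) p (p / (p - 1)) t0 (powR_ge0 _ _) p0 (divr_gt0 p0 pm1).
have -> : p^-1 + (p / (p - 1))^-1 = 1.
  by field; rewrite !gt_eqF.
move=> /(_ erefl); rewrite -powRrM.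
have -> : (p - 1) * (p / (p - 1)) = p by field; rewrite gt_eqF.
rewrite -(ler_pM2l p0) => h.
have -> : p * a `^ (p - 1) * t = p * (t * a `^ (p - 1)) by ring.
apply: le_trans h _; rewrite le_eqVlt; apply/orP; left; apply/eqP.
by field; rewrite !gt_eqF.
Qed.

(** Integrate the tangent inequality taken at the mean of f; if the right-hand side is infinite
    there is nothing to prove. *)
Lemma jensen_powR (Q : set T) (m p : R) (f : T -> R) :
  measurable Q -> mu Q = m%:E -> 0 < m -> 1 < p -> measurable_fun setT f ->
  (forall x, 0 <= f x) -> mu.-integrable Q (EFin \o f) ->
  (((m^-1 * \int[mu]_(x in Q) f x) `^ p)%:E <=
   m^-1%:E * \int[mu]_(x in Q) (f x `^ p)%:E)%E.
Proof.
move=> mQ Qm m0 p1 mf f0 fQ.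
have p0 : 0 < p by rewrite (lt_trans ltr01).
have mfQ : measurable_fun Q f by exact: measurable_funTS.
have mfp : measurable_fun Q (fun x => (f x `^ p)%:E).
  by apply/measurable_EFinP; exact: (measurableT_comp (@measurable_powR R p) mfQ).
have [Iy|] := eqVneq (\int[mu]_(x in Q) (f x `^ p)%:E)%E +oo%E.
  by rewrite Iy gt0_muley ?leey// lte_fin invr_gt0.
rewrite -ltey => Iy.
set I := (\int[mu]_(x in Q) (f x `^ p)%:E)%E in Iy *.
have I0 : (0 <= I)%E by apply: integral_ge0 => x _; rewrite lee_fin powR_ge0.
set a := m^-1 * \int[mu]_(x in Q) f x.
have a0 : 0 <= a by rewrite mulr_ge0 ?invr_ge0 ?(ltW m0)// Rintegral_ge0.
have fE : (\int[mu]_(x in Q) (f x)%:E = (m * a)%:E)%E.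
  rewrite /a mulVKf ?gt_eqF// /Rintegral fineK//.
  exact: integrable_fin_num.
have : (\int[mu]_(x in Q) ((p * a `^ (p - 1))%:E * (f x)%:E) <=
        \int[mu]_(x in Q) ((f x `^ p)%:E + ((p - 1) * a `^ p)%:E))%E.
  apply: ge0_le_integral => //.
  - by move=> x _; rewrite -EFinM lee_fin !mulr_ge0 ?powR_ge0// ltW.
  - by under eq_fun do rewrite -EFinM; apply/measurable_EFinP; exact: measurable_funM.
  - by apply: emeasurable_funD.
  - by move=> x _; rewrite -EFinM -EFinD lee_fin powR_tangent.
rewrite ge0_integralZl_EFin//; last 3 first.
- by move=> x _; rewrite lee_fin.
- exact/measurable_EFinP.
- by rewrite mulr_ge0 ?powR_ge0// ltW.
have pm1 : 0 <= p - 1 by rewrite subr_ge0 ltW.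
rewrite ge0_integralD//; last 2 first.
- by move=> x _; rewrite lee_fin powR_ge0.
- by move=> x _; rewrite lee_fin mulr_ge0 ?powR_ge0.
rewrite integral_cst// Qm fE -!EFinM -/I.
have Ifin : I \is a fin_num by rewrite ge0_fin_numE.
rewrite -(fineK Ifin) -EFinD lee_fin -EFinM lee_fin => h.
rewrite ler_pdivlMl//.
have aE : a `^ (p - 1) * a = a `^ p by rewrite mulrC mulr_powRB1.
have : p * a `^ (p - 1) * (m * a) = p * m * a `^ p by rewrite -aE; ring.
by move: h => /[swap] ->; lra.
Qed.

Lemma jensen_mean (Q : set T) (m p c : R) (g : T -> R) :
  measurable Q -> mu Q = m%:E -> 0 < m -> 1 < p -> measurable_fun setT g ->
  mu.-integrable Q (EFin \o g) ->
  ((`|m^-1 * \int[mu]_(x in Q) g x - c| `^ p)%:E <=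
   m^-1%:E * \int[mu]_(x in Q) (`|g x - c| `^ p)%:E)%E.
Proof.
move=> mQ Qm m0 p1 mg gQ.
have cQ : mu.-integrable Q (EFin \o cst c).
  by apply: measurable_bounded_integrable => //; [rewrite Qm ltry|exact: bounded_cst].
have gcQ : mu.-integrable Q (EFin \o (fun x => g x - c)).
  by have := integrableB mQ gQ cQ; apply: eq_integrable.
have mgc : measurable_fun setT (fun x => `|g x - c|).
  by apply: measurableT_comp => //; exact: measurable_funB.
have ngcQ : mu.-integrable Q (EFin \o (fun x => `|g x - c|)).
  by have := integrable_abse gcQ; apply: eq_integrable.
apply: le_trans (jensen_powR mQ Qm m0 p1 mgc _ ngcQ) => //.
rewrite lee_fin norm_le_powR//; first by rewrite ltW// (lt_trans ltr01).
have -> : m^-1 * \int[mu]_(x in Q) g x - c = m^-1 * \int[mu]_(x in Q) (g x - c).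
  rewrite RintegralB// Rintegral_cst// Qm /=; field; rewrite gt_eqF//.
rewrite normrM gtr0_norm ?invr_gt0// ler_pM2l ?invr_gt0//.
exact: le_normr_Rintegral.
Qed.

End jensen.

Section chaining.
Context (R : realType).

Lemma nneseries_term_le (u : nat -> \bar R) (k : nat) : (forall n, 0 <= u n)%E ->
  (u k <= \sum_(0 <= n <oo) u n)%E.
Proof.
move=> u0; apply: le_trans (nneseries_lim_ge k.+1 (fun n _ _ => u0 n)).
by rewrite big_nat_recr//= leeDr// sume_ge0.
Qed.

(* Each increment is at most [r ^+ k] times the q-th root of the series. *)
Lemma geometric_chaining (a : nat -> R) (l r q : R) (K : nat) : 0 < r -> r < 1 -> 0 < q ->
  a n @[n --> \oo] --> l ->
  ((`|l - a K| `^ q)%:E <= ((r ^+ K / (1 - r)) `^ q)%:E *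
     \sum_(0 <= k <oo) ((r ^- k * `|a k.+1 - a k|) `^ q)%:E)%E.
Proof.
move=> r0 r1 q0 al.
set X := (\sum_(0 <= k <oo) _)%E.
have X0 : (0 <= X)%E by apply: nneseries_ge0 => k _ _; rewrite lee_fin powR_ge0.
have c0 : 0 < r ^+ K / (1 - r) by rewrite divr_gt0 ?exprn_gt0// subr_gt0.
have [Xy|] := eqVneq X +oo%E.
  by rewrite Xy gt0_muley ?leey// lte_fin powR_gt0.
rewrite -ltey => Xy.
have Xfin : X \is a fin_num by rewrite ge0_fin_numE.
pose x := fine X `^ q^-1.
have x0 : 0 <= x by exact: powR_ge0.
have dk k : `|a k.+1 - a k| <= r ^+ k * x.
  rewrite -ler_pdivrMl ?exprn_gt0// /x.
  have -> : r ^- k * `|a k.+1 - a k| = ((r ^- k * `|a k.+1 - a k|) `^ q) `^ q^-1.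
    by rewrite -powRrM mulfV ?gt_eqF// powRr1// mulr_ge0 ?invr_ge0 ?exprn_ge0// ltW.
  rewrite ge0_ler_powR ?nnegrE ?powR_ge0 ?invr_ge0 ?(ltW q0)//.
    exact: fine_ge0.
  rewrite -lee_fin fineK//.
  by apply: (nneseries_term_le (u := fun k => ((r ^- k * `|a k.+1 - a k|) `^ q)%:E)) => j; rewrite lee_fin powR_ge0.
have aK n : `|a (n + K)%N - a K| <= r ^+ K / (1 - r) * x.
  have : `|a (n + K)%N - a K| <= r ^+ K * ((1 - r ^+ n) / (1 - r)) * x.
    elim: n => [|n IH]; first by rewrite subrr normr0 expr0 subrr mul0r mulr0 mul0r.
    rewrite addSn; have := ler_distD (a (n + K)%N) (a (n + K).+1) (a K).
    move=> /le_trans; apply; apply: le_trans (lerD (dk _) IH) _.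
    rewrite exprD exprS le_eqVlt; apply/orP; left; apply/eqP; field.
    by rewrite subr_eq0 gt_eqF.
  move=> /le_trans; apply; rewrite ler_wpM2r// ler_wpM2l ?exprn_ge0 ?(ltW r0)//.
  rewrite -[leRHS]mul1r ler_wpM2r ?invr_ge0 ?subr_ge0 ?(ltW r1)//.
  by rewrite lerBlDr lerDl exprn_ge0// ltW.
have lK : `|l - a K| <= r ^+ K / (1 - r) * x.
  have : (fun n => `|a (n + K)%N - a K|) @ \oo --> `|l - a K|.
    by apply: cvg_norm; apply: cvgB; [rewrite (cvg_shiftn K)|exact: cvg_cst].
  move=> /cvg_lim <-//; apply: limr_le.
    by apply: is_cvg_norm; apply: is_cvgB; [apply/cvg_ex; exists l; rewrite (cvg_shiftn K)|exact: is_cvg_cst].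
  by apply: nearW => n; exact: aK.
rewrite -(fineK Xfin) -EFinM lee_fin.
apply: le_trans (norm_le_powR (ltW q0) lK) _.
rewrite powRM ?(ltW c0)// /x -powRrM mulVf ?gt_eqF// powRr1//.
exact: fine_ge0.
Qed.

End chaining.

(** * The fractional seminorm and cell averages *)

Section kernel.
Context (R : realType) (N : nat) (s p : R).
Hypotheses (s0 : 0 < s) (p1 : 1 < p).
Implicit Types (x y v : 'rV[R]_N) (u : 'rV[R]_N -> R) (z : 'rV[R]_N * 'rV[R]_N).
Local Notation mu := (lebesgue_rV R N).

Let p0 : 0 < p. Proof. by rewrite (lt_trans ltr01). Qed.

Lemma le_enorm v : `|v| <= enorm v.
Proof.
rewrite rV_norm_le ?sqrtr_ge0//; apply/forallP => i.
rewrite -(ler_pXn2r (ltn0Sn 1)) ?nnegrE ?sqrtr_ge0//.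
rewrite /enorm sqr_sqrtr; last by apply: sumr_ge0 => j _; exact: sqr_ge0.
rewrite real_normK ?num_real// (bigD1 i)//= lerDl.
by apply: sumr_ge0 => j _; exact: sqr_ge0.
Qed.

Lemma enorm_le v : enorm v <= Num.sqrt N%:R * `|v|.
Proof.
rewrite -[X in _ * X]ger0_norm// -sqrtr_sqr -sqrtrM// ler_wsqrtr//.
rewrite -[X in X%:R * _]card_ord -sum1_card natr_sum mulr_suml ler_sum// => i _.
rewrite mul1r -[leLHS]real_normK ?num_real// ler_pXn2r ?nnegrE//.
exact: coord_le_norm.
Qed.

(** For positive s and p the value on the diagonal is 0, by the convention for the inverse of 0;
    increments vanish there anyway. *)
Definition sing_kernel z : R := (enorm (z.1 - z.2) `^ (N%:R + s * p))^-1.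
Local Notation w := sing_kernel.

Lemma sing_kernel_ge0 z : 0 <= w z.
Proof. by rewrite invr_ge0 powR_ge0. Qed.

Let sigma0 : 0 < N%:R + s * p. Proof. by rewrite ltr_wpDl// mulr_gt0. Qed.

Lemma measurable_enorm_diff : measurable_fun setT (fun z => enorm (z.1 - z.2)).
Proof.
apply: (@measurableT_comp _ _ _ _ _ _ (@Num.sqrt R)); first exact: (continuous_measurable_fun (@sqrt_continuous R)).
apply: measurable_sum => i; apply: measurable_funX.
under eq_fun do rewrite !mxE.
apply: measurable_funB.
  by apply: (measurableT_comp (@measurable_coord _ _ i)).
by apply: (measurableT_comp (@measurable_coord _ _ i)).
Qed.

Lemma measurable_sing_kernel : measurable_fun setT w.
Proof.
rewrite (_ : w = fun z => enorm (z.1 - z.2) `^ (- (N%:R + s * p))).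
  exact: measurableT_comp (@measurable_powR R _) measurable_enorm_diff.
by apply/funext => z; rewrite /w powRN.
Qed.

Definition seminorm_density u z := `|u z.1 - u z.2| `^ p * w z.
Local Notation dens := seminorm_density.

Lemma seminorm_density_ge0 u z : 0 <= dens u z.
Proof. by rewrite mulr_ge0 ?powR_ge0 ?sing_kernel_ge0. Qed.

Lemma measurable_diff u : measurable_fun setT u -> measurable_fun setT (fun z => u z.1 - u z.2).
Proof.
by move=> mu_; apply: measurable_funB; exact: measurableT_comp.
Qed.

Lemma measurable_seminorm_density u : measurable_fun setT u -> measurable_fun setT (dens u).
Proof.
move=> mu_; apply: measurable_funM; last exact: measurable_sing_kernel.
apply: (measurableT_comp (@measurable_powR R p)).
by apply: measurableT_comp => //; exact: measurable_diff.
Qed.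

(** For distinct points at sup distance at most e the kernel is bounded below; [Num.sqrt N%:R]
    converts the sup norm into the Euclidean one. *)
Lemma diff_le_seminorm_density u x y (e : R) : 0 <= e -> `|x - y| <= e ->
  `|u x - u y| `^ p <= (Num.sqrt N%:R * e) `^ (N%:R + s * p) * dens u (x, y).
Proof.
move=> e0 xye; have [->|xy] := eqVneq x y.
  rewrite subrr normr0 powR0 ?gt_eqF// mulr_ge0 ?powR_ge0//.
  exact: seminorm_density_ge0.
rewrite /dens/= mulrCA ler_peMr ?powR_ge0//.
have en0 : 0 < enorm (x - y).
  by apply: lt_le_trans (le_enorm _); rewrite normr_gt0 subr_eq0.
rewrite /w/= ler_pdivlMr ?powR_gt0// mul1r.
rewrite ge0_ler_powR ?(ltW sigma0) ?nnegrE ?(ltW en0)//.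
  by rewrite mulr_ge0 ?sqrtr_ge0.
by apply: le_trans (enorm_le _) _; rewrite ler_wpM2l ?sqrtr_ge0.
Qed.

(** The p-th power of the Gagliardo seminorm, not the seminorm itself. *)
Definition seminorm u : \bar R := (\int[mu \x mu]_z (dens u z)%:E)%E.
Definition local_seminorm u x : \bar R := (\int[mu]_y (dens u (x, y))%:E)%E.

Lemma local_seminorm_ge0 u x : (0 <= local_seminorm u x)%E.
Proof. by apply: integral_ge0 => y _; rewrite lee_fin seminorm_density_ge0. Qed.

Lemma measurable_local_seminorm u : measurable_fun setT u ->
  measurable_fun setT (local_seminorm u).
Proof.
move=> mu_.
have md : measurable_fun setT (EFin \o dens u).
  by apply/measurable_EFinP; exact: measurable_seminorm_density.
have d0 z : (0 <= (EFin \o dens u) z)%E by rewrite lee_fin seminorm_density_ge0.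
exact: (measurable_fun_fubini_tonelli_F (m2 := mu) (EFin \o dens u) md d0).
Qed.

Lemma seminormE u : measurable_fun setT u ->
  seminorm u = (\int[mu]_x local_seminorm u x)%E.
Proof.
move=> mu_.
have md : measurable_fun setT (EFin \o dens u).
  by apply/measurable_EFinP; exact: measurable_seminorm_density.
have d0 z : (0 <= (EFin \o dens u) z)%E by rewrite lee_fin seminorm_density_ge0.
exact: (fubini_tonelli1 (EFin \o dens u) md d0).
Qed.

End kernel.

Section cell_averages.
Context (R : realType) (N : nat) (s p q : R).
Hypotheses (N0 : (0 < N)%N) (s0 : 0 < s) (p1 : 1 < p).
Implicit Types (x y : 'rV[R]_N) (u : 'rV[R]_N -> R) (k : nat).
Local Notation mu := (lebesgue_rV R N).
Local Notation Q k x := [set y | cell k y = cell k x].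
Local Notation dens := (seminorm_density s p).
Local Notation lsemi := (local_seminorm s p).
Local Notation semi := (seminorm s p).
Local Notation sigma := (N%:R + s * p).

Let p0 : 0 < p. Proof. by rewrite (lt_trans ltr01). Qed.

Definition cell_avg k u x : R := (2 ^+ (k * N)) * \int[mu]_(y in Q k x) u y.
Local Notation E := cell_avg.

Lemma cell_avg_cell k u x y : cell k x = cell k y -> E k u x = E k u y.
Proof. by rewrite /cell_avg => ->. Qed.

Lemma measurable_comp_cell d (T : measurableType d) k (g : {ffun 'I_N -> int} -> T) :
  measurable_fun setT (fun x : 'rV[R]_N => g (cell k x)).
Proof.
move=> _ Y mY; rewrite setTI.
rewrite (_ : _ @^-1` _ = \bigcup_(m : {ffun 'I_N -> int}) [set x | Y (g m) /\ cell k x = m]); last first.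
  apply/seteqP; split => [x /= Yx|x [m _ [/= Ym xm]]]; first by exists (cell k x).
  by rewrite /= xm.
apply: countable_bigcupT_measurable => // m.
have [Ym|Ym] := pselect (Y (g m)).
  rewrite (_ : [set _ | _] = [set x | cell k x = m]); first exact: measurable_cell.
  by apply/seteqP; split => x //= -[].
by rewrite (_ : [set _ | _] = set0)// -subset0 => x [].
Qed.

Lemma measurable_cell_avg k u : measurable_fun setT (E k u).
Proof.
exact: (measurable_comp_cell k (fun m => 2 ^+ (k * N) * \int[mu]_(y in [set y | cell k y = m]) u y)).
Qed.

Let m_gt0 k : 0 < (2 : R) ^- (k * N). Proof. by rewrite invr_gt0 exprn_gt0. Qed.

Variable u : 'rV[R]_N -> R.
Hypothesis (mu_ : measurable_fun setT u) (iu : mu.-integrable setT (EFin \o u)).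

Let iuQ k x : mu.-integrable (Q k x) (EFin \o u).
Proof. by apply: integrableS iu => //; exact: measurable_cell. Qed.

Lemma cell_avg_mean k x (c : R) :
  ((`|E k u x - c| `^ p)%:E <=
   (2 ^+ (k * N))%:E * \int[mu]_(y in Q k x) (`|u y - c| `^ p)%:E)%E.
Proof.
have := jensen_mean c (measurable_cell k (cell k x)) (measure_cell R k (cell k x)) (m_gt0 k) p1 mu_ (iuQ k x).
by rewrite invrK.
Qed.

(** Jensen around the value u x, followed by the lower bound of the kernel on a cell, whose diameter
    is at most 2^-k. *)
Lemma dist_cell_avg k x :
  ((`|u x - E k u x| `^ p)%:E <=
   (2 ^+ (k * N) * (Num.sqrt N%:R * 2 ^- k) `^ sigma)%:E * lsemi u x)%E.
Proof.
rewrite distrC; apply: le_trans (cell_avg_mean _ _ _) _.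
rewrite EFinM -muleA lee_wpmul2l ?lee_fin ?exprn_ge0//.
have c0 : 0 <= (Num.sqrt N%:R * 2 ^- k) `^ sigma :> R by exact: powR_ge0.
have mdx : measurable_fun setT (fun y => (dens u (x, y))%:E).
  apply/measurable_EFinP.
  exact: (measurableT_comp (measurable_seminorm_density s p mu_) (pair1_measurable x)).
rewrite -ge0_integralZl_EFin//; last first.
  by move=> y _; rewrite lee_fin seminorm_density_ge0.
have mQ := measurable_cell k (cell k x).
have mcd : measurable_fun setT (fun y => (((Num.sqrt N%:R * 2 ^- k) `^ sigma)%:E * (dens u (x, y))%:E)%E).
  by apply: emeasurable_funM.
apply: (@le_trans _ _ (\int[mu]_(y in Q k x) (((Num.sqrt N%:R * 2 ^- k) `^ sigma)%:E * (dens u (x, y))%:E))%E).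
  apply: ge0_le_integral => //.
  - exact: mQ.
  - apply: measurable_funTS; apply/measurable_EFinP.
    apply: (measurableT_comp (@measurable_powR R p)); apply: measurableT_comp => //.
    by apply: measurable_funB.
  - exact: measurable_funTS.
  - move=> y /= yx; rewrite -EFinM lee_fin distrC diff_le_seminorm_density//.
    by apply: cell_dist; rewrite yx.
apply: ge0_subset_integral => //; first exact: mQ.
by move=> y _; rewrite -EFinM lee_fin mulr_ge0// seminorm_density_ge0.
Qed.

End cell_averages.

Lemma nneseries_geometric_le (R : realType) (r : R) : 0 < r -> r < 1 ->
  (\sum_(0 <= k <oo) (r ^+ k)%:E <= ((1 - r)^-1)%:E)%E.
Proof.
move=> r0 r1; have r1' : 0 < 1 - r by rewrite subr_gt0.
apply: lime_le.
  by apply: is_cvg_nneseries => n _ _; rewrite lee_fin exprn_ge0// ltW.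
apply: nearW => n; rewrite sumEFin lee_fin.
have -> : \sum_(0 <= i < n) r ^+ i = (1 - r ^+ n) / (1 - r).
  elim: n => [|n IH]; first by rewrite big_nil expr0 subrr mul0r.
  by rewrite big_nat_recr//= IH exprSr; field; rewrite gt_eqF.
by rewrite -[leRHS]mul1r ler_wpM2r ?invr_ge0 ?(ltW r1')// lerBlDr lerDl exprn_ge0// ltW.
Qed.

Section increments.
Context (R : realType) (N : nat) (s p q : R).
Hypotheses (N0 : (0 < N)%N) (s0 : 0 < s) (p1 : 1 < p) (pq : p < q).
Hypothesis subcrit : (N%:R - s * p) * q < N%:R * p.
Implicit Types (x y : 'rV[R]_N) (u : 'rV[R]_N -> R) (k : nat).
Local Notation mu := (lebesgue_rV R N).
Local Notation Q k x := [set y | cell k y = cell k x].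
Local Notation lsemi := (local_seminorm s p).
Local Notation semi := (seminorm s p).
Local Notation sigma := (N%:R + s * p).
Local Notation E := cell_avg.

Let p0 : 0 < p. Proof. by rewrite (lt_trans ltr01). Qed.
Let q0 : 0 < q. Proof. by rewrite (lt_trans p0). Qed.

(** By Tonelli each y is counted by the x of its own cell, a set of measure 2^-(k N). *)
Lemma integral_cells k (h : 'rV[R]_N -> \bar R) : measurable_fun setT h ->
  (forall x, 0 <= h x)%E ->
  (\int[mu]_x \int[mu]_(y in Q k x) h y = (2 ^- (k * N))%:E * \int[mu]_x h x)%E.
Proof.
move=> mh h0.
pose S := [set z : 'rV[R]_N * 'rV[R]_N | cell k z.1 = cell k z.2].
pose f (z : 'rV[R]_N * 'rV[R]_N) := (h z.2 * (\1_S z)%:E)%E.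
have mf : measurable_fun setT f.
  apply: emeasurable_funM; first exact: measurableT_comp.
  apply/measurable_EFinP; apply: measurable_indic; exact: measurable_same_cell.
have f0 z : (0 <= f z)%E by rewrite mule_ge0// lee_fin.
have mQ (m : {ffun 'I_N -> int}) := @measurable_cell R N k m.
have h1 x : (\int[mu]_(y in Q k x) h y = \int[mu]_y f (x, y))%E.
  rewrite integral_mkcond epatch_indic; apply: eq_integral => y _.
  rewrite /f/= /S !indicE; congr (h y * _%:E)%E; congr (_%:R); congr nat_of_bool.
  by apply/idP/idP; rewrite !inE/= => ->.
under eq_integral do rewrite h1.
rewrite (fubini_tonelli f mf f0).
transitivity (\int[mu]_y ((2 ^- (k * N))%:E * h y))%E; last first.
  by rewrite ge0_integralZl_EFin// invr_ge0 exprn_ge0.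
apply: eq_integral => y _; rewrite /f/=.
rewrite ge0_integralZl//.
- rewrite muleC; congr (_ * _)%E.
  rewrite (eq_integral (fun x => (\1_(Q k y) x)%:E)).
    by rewrite integral_indic ?setIT//; exact: measure_cell.
  move=> x _ /=; rewrite /S !indicE; congr (_%:E); congr (_%:R); congr nat_of_bool.
- apply/measurable_EFinP.
  have mS : measurable_fun setT (\1_S : _ -> R).
    by apply: measurable_indic; exact: measurable_same_cell.
  exact: (measurableT_comp mS (pair2_measurable y)).
Qed.

(** The passage from exponent p to q: a cell integral H is at most M, so H^(q/p) <= M^(q/p - 1) H,
    and H integrates to a fraction of the total. *)
Lemma integral_powR_cells k (g : 'rV[R]_N -> R) (h : 'rV[R]_N -> \bar R) (c M : R) :
  measurable_fun setT g -> measurable_fun setT h -> (forall x, 0 <= h x)%E ->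
  0 <= c -> 0 <= M -> (\int[mu]_x h x <= M%:E)%E ->
  (forall x, (`|g x| `^ p)%:E <= c%:E * \int[mu]_(y in Q k x) h y)%E ->
  (\int[mu]_x (`|g x| `^ q)%:E <= (c `^ (q / p) * 2 ^- (k * N) * M `^ (q / p))%:E)%E.
Proof.
move=> mg mh h0 c0 M0 hM gh.
have mQ j (m : {ffun 'I_N -> int}) := @measurable_cell R N j m.
pose H x := (\int[mu]_(y in Q k x) h y)%E.
have H0 x : (0 <= H x)%E by apply: integral_ge0.
have HM x : (H x <= M%:E)%E.
  by apply: le_trans hM; apply: ge0_subset_integral.
have Hfin x : H x \is a fin_num by rewrite ge0_fin_numE// (le_lt_trans (HM x))// ltry.
have mH : measurable_fun setT H.
  exact: (measurable_comp_cell k (fun m => \int[mu]_(y in [set y | cell k y = m]) h y)%E).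
pose b := c `^ (q / p) * M `^ (q / p - 1).
have b0 : 0 <= b by rewrite mulr_ge0 ?powR_ge0.
have qp1 : 0 < q / p - 1 by rewrite subr_gt0 ltr_pdivlMr// mul1r.
apply: (@le_trans _ _ (\int[mu]_x (b%:E * H x))%E).
  apply: ge0_le_integral => //.
  - apply/measurable_EFinP; apply: (measurableT_comp (@measurable_powR R q)).
    exact: measurableT_comp.
  - exact: emeasurable_funM.
  - move=> x _; have := gh x.
    rewrite -/(H x) -(fineK (Hfin x)) -!EFinM !lee_fin => ghx.
    have fH0 : 0 <= fine (H x) by exact: fine_ge0.
    have -> : `|g x| `^ q = (`|g x| `^ p) `^ (q / p).
      by rewrite -powRrM; congr (_ `^ _); field; rewrite gt_eqF.
    apply: (@le_trans _ _ ((c * fine (H x)) `^ (q / p))).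
      by rewrite ge0_ler_powR ?nnegrE ?powR_ge0 ?divr_ge0 ?(ltW p0) ?(ltW q0)// mulr_ge0.
    rewrite powRM// /b -mulrA ler_wpM2l ?powR_ge0//.
    rewrite -(mulr_powRB1 fH0) ?divr_gt0// mulrC ler_wpM2r//.
    rewrite ge0_ler_powR ?nnegrE ?(ltW qp1)//.
    by rewrite -lee_fin fineK.
rewrite ge0_integralZl_EFin// integral_cells//.
rewrite -[in leRHS](mulr_powRB1 M0) ?divr_gt0//.
apply: (@le_trans _ _ (b%:E * ((2 ^- (k * N))%:E * M%:E))%E).
  by rewrite lee_wpmul2l ?lee_fin// lee_wpmul2l ?lee_fin ?invr_ge0 ?exprn_ge0.
rewrite -!EFinM lee_fin le_eqVlt; apply/orP; left; apply/eqP.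
by rewrite /b; ring.
Qed.

Variable u : 'rV[R]_N -> R.
Hypothesis (cu : continuous u) (iu : mu.-integrable setT (EFin \o u)).

Let mu_ : measurable_fun setT u. Proof. exact: integrable_mfun iu. Qed.

(** The first factor is the reciprocal measure of a cell of level k + 1, the second the constant of
    [dist_cell_avg]. *)
Let incr_cst k : R := 2 ^+ (k.+1 * N) * (2 ^+ (k * N) * (Num.sqrt N%:R * 2 ^- k) `^ sigma).

Let incr_cst_ge0 k : 0 <= incr_cst k.
Proof. by rewrite !mulr_ge0 ?exprn_ge0 ?powR_ge0. Qed.

Lemma cell_avg_increment k x :
  ((`|E k.+1 u x - E k u x| `^ p)%:E <=
   (incr_cst k)%:E * \int[mu]_(y in Q k x) lsemi u y)%E.
Proof.
apply: le_trans (cell_avg_mean p1 mu_ iu k.+1 x (E k u x)) _.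
rewrite /incr_cst EFinM -muleA lee_wpmul2l ?lee_fin ?exprn_ge0//.
set c := (_ * _ `^ _); have c0 : 0 <= c by rewrite mulr_ge0 ?exprn_ge0 ?powR_ge0.
have ml := measurable_local_seminorm s p mu_.
have l0 := local_seminorm_ge0 s p u.
have mQ j (m : {ffun 'I_N -> int}) := @measurable_cell R N j m.
apply: (@le_trans _ _ (\int[mu]_(y in Q k.+1 x) (c%:E * lsemi u y))%E).
  apply: ge0_le_integral => //.
  - apply: measurable_funTS; apply/measurable_EFinP.
    apply: (measurableT_comp (@measurable_powR R p)); apply: measurableT_comp => //.
    by apply: measurable_funB.
  - apply: measurable_funTS; exact: emeasurable_funM.
  (* The coarse average is constant on the finer cell, so it may be evaluated at y instead of x. *)
  - move=> y /= yx; rewrite (cell_avg_cell u (esym (cell_refine yx))).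
    exact: dist_cell_avg.
rewrite ge0_integralZl_EFin//; last exact: measurable_funTS.
rewrite lee_wpmul2l ?lee_fin//; apply: ge0_subset_integral => //.
- exact: measurable_funTS.
- by move=> y; exact: cell_refine.
Qed.

Lemma integral_cell_avg_increment (M : R) k : 0 <= M -> (semi u <= M%:E)%E ->
  (\int[mu]_x (`|E k.+1 u x - E k u x| `^ q)%:E <=
   (incr_cst k `^ (q / p) * 2 ^- (k * N) * M `^ (q / p))%:E)%E.
Proof.
move=> M0 uM.
apply: (integral_powR_cells (h := lsemi u)) => //.
- by apply: measurable_funB; exact: measurable_cell_avg.
- exact: measurable_local_seminorm.
- exact: local_seminorm_ge0.
- by rewrite -seminormE.
- exact: cell_avg_increment.
Qed.

(** The increments of level k have q-th power integral of order 2^(k * growth): [incr_cst k] is of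
    order 2^(k (N - s p)) and a cell has measure 2^-(k N). Subcriticality says exactly that [growth]
    is negative. *)
Let growth := (N%:R - s * p) * (q / p) - N%:R.

Let growth_lt0 : growth < 0.
Proof. by rewrite subr_lt0 mulrA ltr_pdivrMr. Qed.

Let pow2D (a b : R) : 2 `^ (a + b) = 2 `^ a * 2 `^ b :> R.
Proof. by rewrite powRD// pnatr_eq0 implybT. Qed.

Let incr_cstE k : incr_cst k `^ (q / p) * 2 ^- (k * N) =
  (2 `^ N%:R * (Num.sqrt N%:R) `^ sigma) `^ (q / p) * 2 `^ (k%:R * growth).
Proof.
have two : 0 <= 2 :> R by [].
have e2 n : 2 ^+ n = 2 `^ n%:R :> R by rewrite powR_mulrn.
have -> : incr_cst k = 2 `^ N%:R * (Num.sqrt N%:R) `^ sigma * 2 `^ (k%:R * (N%:R - s * p)).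
  rewrite /incr_cst powRM ?sqrtr_ge0 ?invr_ge0 ?exprn_ge0//.
  have -> : (2 ^- k) `^ sigma = 2 `^ (- (k%:R * sigma)) :> R.
    by rewrite e2 -powRN -powRrM mulNr.
  rewrite [2 ^+ (k.+1 * N)]e2 [2 ^+ (k * N)]e2.
  have -> : 2 `^ (k%:R * (N%:R - s * p)) = 2 `^ (k * N)%:R * 2 `^ (k * N)%:R * 2 `^ (- (k%:R * sigma)) :> R.
    rewrite -!pow2D; congr (_ `^ _).
    by rewrite !natrM; ring.
  have -> : 2 `^ (k.+1 * N)%:R = 2 `^ N%:R * 2 `^ (k * N)%:R :> R.
    by rewrite -pow2D -natrD.
  by ring.
rewrite powRM ?mulr_ge0 ?powR_ge0// -mulrA; congr (_ * _).
rewrite -powRrM e2 -powRN -pow2D; congr (_ `^ _).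
by rewrite /growth natrM; ring.
Qed.

(** Chosen so that r^(q + 1) = 2^growth: after weighting the increments by r^-k, the series of q-th
    powers is still geometric of ratio r. *)
Let r : R := 2 `^ (growth / (q + 1)).

Let q1 : 0 < q + 1. Proof. by rewrite addr_gt0. Qed.

Let r_gt0 : 0 < r. Proof. by rewrite powR_gt0. Qed.

Let r_lt1 : r < 1.
Proof.
rewrite /r /powR pnatr_eq0/= expR_lt1 pmulr_llt0 ?ln_gt0 ?ltr1n//.
by rewrite pmulr_llt0 ?invr_gt0.
Qed.

Let rE k : (r ^- k) `^ q * 2 `^ (k%:R * growth) = r ^+ k.
Proof.
have e k' : r ^+ k' = 2 `^ (k'%:R * (growth / (q + 1))).
  by rewrite -powR_mulrn ?powR_ge0// -powRrM mulrC.
rewrite !e -powRN -powRrM -pow2D; congr (_ `^ _).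
by field; rewrite gt_eqF.
Qed.

Lemma cell_avg_cvg x : E k u x @[k --> \oo] --> u x.
Proof.
apply/cvgrPdist_le => e e0.
have cux : u y @[y --> x] --> u x by exact: cu.
move/cvgrPdist_le : cux => /(_ _ e0) /nbhs_ballP[d /= d0 hd].
have := near_infty_natSinv_expn_lt (PosNum d0); apply: filterS => k /=; rewrite div1r => kd.
have mQ := @measurable_cell R N k (cell k x).
have h : ((`|E k u x - u x| `^ p)%:E <= (e `^ p)%:E)%E.
  apply: le_trans (cell_avg_mean p1 mu_ iu k x (u x)) _.
  apply: (@le_trans _ _ ((2 ^+ (k * N))%:E * \int[mu]_(y in Q k x) cst (e `^ p)%:E y)%E).
    rewrite lee_wpmul2l ?lee_fin ?exprn_ge0//; apply: ge0_le_integral => //.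
    - apply: measurable_funTS; apply/measurable_EFinP.
      apply: (measurableT_comp (@measurable_powR R p)); apply: measurableT_comp => //.
      by apply: measurable_funB.
    - move=> y /= yx; rewrite lee_fin norm_le_powR ?(ltW p0)// distrC; apply: hd.
      by rewrite -ball_normE/=; apply: le_lt_trans kd; apply: cell_dist.
  rewrite integral_cst// [X in (_ * (_ * X))%E](measure_cell R k (cell k x)) -!EFinM lee_fin mulrCA.
  by rewrite mulfV ?mulr1// gt_eqF// exprn_gt0.
rewrite distrC leNgt; apply/negP => eh; move: h; rewrite lee_fin leNgt => /negP; apply.
by rewrite gt0_ltr_powR// nnegrE// ltW.
Qed.

(** Since the averages converge to u pointwise, chaining bounds the distance to the K-th one by a
    weighted series of increments; integrating term by term leaves a geometric series. The bound
    sees u only through M. *)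
Lemma cell_avg_approx (M : R) (K : nat) : 0 <= M -> (semi u <= M%:E)%E ->
  (\int[mu]_x (`|u x - E K u x| `^ q)%:E <=
   ((r ^+ K / (1 - r)) `^ q * (1 - r)^-1 *
    (2 `^ N%:R * (Num.sqrt N%:R) `^ sigma) `^ (q / p) * M `^ (q / p))%:E)%E.
Proof.
move=> M0 uM.
pose d k x := ((r ^- k * `|E k.+1 u x - E k u x|) `^ q)%:E.
have md k : measurable_fun setT (d k).
  apply/measurable_EFinP; apply: (measurableT_comp (@measurable_powR R q)).
  apply: measurable_funM => //; apply: measurableT_comp => //.
  by apply: measurable_funB; exact: measurable_cell_avg.
have d0 k x : (0 <= d k x)%E by rewrite lee_fin powR_ge0.
set c := (r ^+ K / (1 - r)) `^ q; have c0 : 0 <= c by exact: powR_ge0.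
set B := (2 `^ N%:R * _) `^ (q / p); have B0 : 0 <= B by exact: powR_ge0.
have mS : measurable_fun setT (fun x => \sum_(0 <= k <oo) d k x)%E.
  by apply: ge0_emeasurable_sum.
apply: (@le_trans _ _ (\int[mu]_x (c%:E * \sum_(0 <= k <oo) d k x))%E).
  apply: ge0_le_integral => //.
  - apply/measurable_EFinP; apply: (measurableT_comp (@measurable_powR R q)).
    apply: measurableT_comp => //.
    by apply: measurable_funB => //; exact: measurable_cell_avg.
  - exact: emeasurable_funM.
  - move=> x _; have cvx : E k u x @[k --> \oo] --> u x by exact: cell_avg_cvg.
    exact: (geometric_chaining K r_gt0 r_lt1 q0 cvx).
rewrite ge0_integralZl_EFin//; last by move=> x _; exact: nneseries_ge0.
rewrite -!mulrA EFinM lee_wpmul2l ?lee_fin// integral_nneseries//.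
apply: (@le_trans _ _ (\sum_(0 <= k <oo) ((B * M `^ (q / p))%:E * (r ^+ k)%:E))%E).
  apply: lee_nneseries => [k _ _|k _]; first by apply: integral_ge0.
  rewrite /d; under eq_integral do rewrite powRM ?invr_ge0 ?exprn_ge0 ?(ltW r_gt0)// EFinM.
  rewrite ge0_integralZl_EFin ?powR_ge0//; last first.
    apply/measurable_EFinP; apply: (measurableT_comp (@measurable_powR R q)).
    apply: measurableT_comp => //.
    by apply: measurable_funB => //; exact: measurable_cell_avg.
  apply: le_trans (lee_wpmul2l _ (integral_cell_avg_increment k M0 uM)) _.
    by rewrite lee_fin powR_ge0.
  rewrite -!EFinM lee_fin incr_cstE -/B le_eqVlt; apply/orP; left; apply/eqP.
  by rewrite -[in RHS](rE k); ring.
rewrite nneseriesZl; last by move=> k _; rewrite lee_fin exprn_ge0// ltW.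
rewrite [leRHS]EFinM muleC.
by rewrite lee_wpmul2r ?lee_fin ?mulr_ge0 ?powR_ge0// nneseries_geometric_le.
Qed.

End increments.

Section boxes.
Context (R : realType) (N : nat).
Implicit Types (x y : 'rV[R]_N).
Local Notation mu := (lebesgue_rV R N).

Lemma measurable_box (a b : R) : measurable [set y : 'rV[R]_N | forall i, a <= y ord0 i <= b].
Proof.
rewrite (_ : [set y | _] = \bigcap_(i in [set: 'I_N])
      ((fun v : 'rV[R]_N => v ord0 i) @^-1` `[a, b])).
  apply: fin_bigcap_measurable => [|i _]; first exact: finite_finset.
  by rewrite -[X in measurable X]setTI; apply: measurable_coord => //.
apply/seteqP; split => v /= vA i; first by rewrite /= in_itv/= => _; exact: vA.
by have := vA i I; rewrite /= in_itv.
Qed.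

Lemma measure_box (a b : R) : a <= b ->
  mu [set y | forall i, a <= y ord0 i <= b] = ((b - a) ^+ N)%:E.
Proof.
move=> ab.
have ab' i : (const_mx a : 'rV[R]_N) ord0 i <= (const_mx b : 'rV[R]_N) ord0 i by rewrite !mxE.
have h := lebesgue_rV_box ab'.
rewrite [X in mu X](_ : _ = [set v : 'rV[R]_N | forall i, (const_mx a : 'rV[R]_N) ord0 i <= v ord0 i <= (const_mx b : 'rV[R]_N) ord0 i]); last first.
  by apply/seteqP; split => v /= vA i; have := vA i; rewrite !mxE.
rewrite [LHS]h; congr (_%:E); under eq_bigr do rewrite !mxE.
by rewrite prodr_const card_ord.
Qed.

Lemma measure_ball_le x (e : R) : 0 <= e ->
  mu [set y | `|x - y| <= e] = ((2 * e) ^+ N)%:E.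
Proof.
move=> e0; have := @lebesgue_rV_box R N (x - const_mx e) (x + const_mx e).
have -> : (forall i, (x - const_mx e) ord0 i <= (x + const_mx e) ord0 i) = True.
  by apply/propext; split => // _ i; rewrite !mxE; lra.
move=> /(_ I) h.
rewrite [X in mu X](_ : _ = [set v : 'rV[R]_N | forall i, (x - const_mx e) ord0 i <= v ord0 i <= (x + const_mx e) ord0 i]); last first.
  apply/seteqP; split => v /=; rewrite rV_norm_le//.
    by move=> /forallP h' i; have := h' i; rewrite !mxE ler_norml; lra.
  by move=> h'; apply/forallP => i; have := h' i; rewrite !mxE ler_norml; lra.
rewrite [LHS]h; congr (_%:E); rewrite -[in RHS](card_ord N) -prodr_const.
by apply: eq_bigr => i _; rewrite !mxE; ring.
Qed.

Lemma measurable_ball_le x (e : R) : measurable [set y : 'rV[R]_N | `|x - y| <= e].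
Proof.
have -> : [set y : 'rV[R]_N | `|x - y| <= e] = ~` [set y | e < `|x - y|].
  by apply/seteqP; split => y /=; rewrite leNgt => /negP.
apply: measurableC; apply: open_measurable_rV.
rewrite (_ : [set _ | _] = (fun y => `|x - y|) @^-1` `]e, +oo[); last first.
  by apply/seteqP; split => y /=; rewrite in_itv/= andbT.
apply: open_comp => [y _|]; last exact: interval_open.
apply: (@continuous_comp _ _ _ (fun y => x - y) (@Num.norm _ _)); last exact: norm_continuous.
by apply: (@continuousB _ _ _ (cst x) id); [exact: cst_continuous|move=> ?].
Qed.

End boxes.

(** * Poincare and Sobolev inequalities *)

Section poincare.
Context (R : realType) (N : nat) (s p q b : R).
Hypotheses (N0 : (0 < N)%N) (s0 : 0 < s) (p1 : 1 < p) (pq : p < q) (b0 : 0 < b).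
Hypothesis subcrit : (N%:R - s * p) * q < N%:R * p.
Implicit Types (x y : 'rV[R]_N).
Local Notation mu := (lebesgue_rV R N).
Local Notation sigma := (N%:R + s * p).
Local Notation dens := (seminorm_density s p).
Local Notation lsemi := (local_seminorm s p).
Local Notation semi := (seminorm s p).

Let p0 : 0 < p. Proof. by rewrite (lt_trans ltr01). Qed.
Let q0 : 0 < q. Proof. by rewrite (lt_trans p0). Qed.

Variable u : 'rV[R]_N -> R.
Hypotheses (cu : continuous u) (iu : mu.-integrable setT (EFin \o u)).
Hypothesis (u0 : forall x, b < `|x| -> u x = 0).

Let mu_ : measurable_fun setT u. Proof. exact: integrable_mfun iu. Qed.

(** [b ^+ N] is the measure of the comparison box, and [Num.sqrt N%:R * (4 * b)] bounds the
    Euclidean distance from its points to those of norm at most b. *)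
Definition poincare_cst : R := (b ^+ N)^-1 * (Num.sqrt N%:R * (4 * b)) `^ sigma.

Lemma poincare_cst_ge0 : 0 <= poincare_cst.
Proof. by rewrite mulr_ge0 ?powR_ge0 ?invr_ge0 ?exprn_ge0// ltW. Qed.

(* Compare with the box [2b, 3b]^N, where u vanishes, at distance at most 4b
   from the support. *)
Lemma poincare_pointwise x : ((`|u x| `^ p)%:E <= poincare_cst%:E * lsemi u x)%E.
Proof.
have [bx|xb] := ltP b `|x|.
  rewrite u0// normr0 powR0 ?gt_eqF// mule_ge0//.
  - by rewrite lee_fin poincare_cst_ge0.
  - exact: local_seminorm_ge0.
rewrite /poincare_cst EFinM -muleA.
set B := [set y : 'rV[R]_N | forall i, 2 * b <= y ord0 i <= 3 * b].
have mB : measurable B by exact: measurable_box.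
have muB : mu B = (b ^+ N)%:E.
  rewrite measure_box; first by congr ((_ ^+ _)%:E); ring.
  by rewrite ler_pM2r// ler_nat.
have b0N : 0 < b ^+ N by rewrite exprn_gt0.
have c0 : 0 <= (Num.sqrt N%:R * (4 * b)) `^ sigma by exact: powR_ge0.
set c := _ `^ sigma in c0 *.
have mdx : measurable_fun setT (fun y => (dens u (x, y))%:E).
  apply/measurable_EFinP.
  exact: (measurableT_comp (measurable_seminorm_density s p mu_) (pair1_measurable x)).
have uB y : B y -> `|u x| `^ p <= c * dens u (x, y).
  move=> By; have -> : u x = u x - u y.
    rewrite (u0 (x := y)) ?subr0//; apply: lt_le_trans (coord_le_norm y (Ordinal N0)).
    have /andP[h _] := By (Ordinal N0).
    by apply: lt_le_trans (ler_norm _); apply: lt_le_trans h; rewrite ltr_pMl// ltr1n.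
  apply: diff_le_seminorm_density => //; first by rewrite mulr_ge0// ltW.
  apply: (le_trans (ler_normB _ _)).
  have : `|y| <= 3 * b.
    rewrite rV_norm_le ?mulr_ge0 ?(ltW b0)//; apply/forallP => i.
    by have := By i; rewrite ler_norml; lra.
  by move: xb; lra.
rewrite lee_pdivlMl//.
apply: (@le_trans _ _ (\int[mu]_(y in B) (cst (`|u x| `^ p)%:E y))%E).
  by rewrite integral_cst// muleC lee_wpmul2l ?lee_fin ?powR_ge0// [leRHS]muB.
rewrite -ge0_integralZl_EFin//; last first.
  by move=> y _; rewrite lee_fin seminorm_density_ge0.
have mcd : measurable_fun setT (fun y => (c%:E * (dens u (x, y))%:E)%E).
  exact: emeasurable_funM.
apply: (@le_trans _ _ (\int[mu]_(y in B) (c%:E * (dens u (x, y))%:E))%E).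
  apply: ge0_le_integral => //; first by move=> y _; rewrite lee_fin powR_ge0.
  exact: measurable_funTS.
apply: ge0_subset_integral => //.
by move=> y _; rewrite -EFinM lee_fin mulr_ge0// seminorm_density_ge0.
Qed.

Lemma poincare : (\int[mu]_x (`|u x| `^ p)%:E <= poincare_cst%:E * semi u)%E.
Proof.
have ml := measurable_local_seminorm s p mu_.
rewrite seminormE// -ge0_integralZl_EFin//; last 2 first.
- by move=> x _; exact: local_seminorm_ge0.
- exact: poincare_cst_ge0.
apply: ge0_le_integral => //.
- by apply/measurable_EFinP; apply: (measurableT_comp (@measurable_powR R p)); exact: measurableT_comp.
- exact: emeasurable_funM.
- by move=> x _; exact: poincare_pointwise.
Qed.

End poincare.

Section sobolev.
Context (R : realType) (N : nat) (s p q b : R).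
Hypotheses (N0 : (0 < N)%N) (s0 : 0 < s) (p1 : 1 < p) (pq : p < q) (b0 : 0 < b).
Hypothesis subcrit : (N%:R - s * p) * q < N%:R * p.
Local Notation mu := (lebesgue_rV R N).
Local Notation semi := (seminorm s p).

Let p0 : 0 < p. Proof. by rewrite (lt_trans ltr01). Qed.
Let q0 : 0 < q. Proof. by rewrite (lt_trans p0). Qed.

(** One level K serves the whole seminorm ball, because the error is r^(K q) times a constant
    depending on u only through M. This is the analytic input of the compactness theorem. *)
Lemma cell_avg_uniform_approx (e M : R) : 0 < e -> 0 <= M -> exists K : nat,
  forall u : 'rV[R]_N -> R, continuous u -> mu.-integrable setT (EFin \o u) ->
  (semi u <= M%:E)%E ->
  (\int[mu]_x (`|u x - cell_avg K u x| `^ q)%:E <= e%:E)%E.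
Proof.
move=> e0 M0.
have [r [r0 [r1 [C H]]]] : exists r : R, 0 < r /\ r < 1 /\ exists C : R, forall K (u : 'rV[R]_N -> R),
    continuous u -> mu.-integrable setT (EFin \o u) -> (semi u <= M%:E)%E ->
  (\int[mu]_x (`|u x - cell_avg K u x| `^ q)%:E <= ((r ^+ K) `^ q * C)%:E)%E.
  have g0 : (N%:R - s * p) * (q / p) - N%:R < 0.
    by rewrite subr_lt0 mulrA ltr_pdivrMr.
  set r : R := 2 `^ (((N%:R - s * p) * (q / p) - N%:R) / (q + 1)).
  have r1 : r < 1.
    rewrite /r /powR pnatr_eq0/= expR_lt1 pmulr_llt0 ?ln_gt0 ?ltr1n//.
    by rewrite pmulr_llt0 ?invr_gt0// addr_gt0.
  exists r; split; first by rewrite powR_gt0.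
  split => //; exists ((1 - r)^-1 `^ q * (1 - r)^-1 *
    (2 `^ N%:R * (Num.sqrt N%:R) `^ (N%:R + s * p)) `^ (q / p) * M `^ (q / p)) => K u cu iu uM.
  have := cell_avg_approx s0 p1 pq subcrit cu iu K M0 uM; rewrite -/r => /le_trans; apply.
  rewrite lee_fin powRM ?exprn_ge0 ?powR_ge0// ?invr_ge0 ?subr_ge0 ?(ltW r1)//.
  by rewrite !mulrA lexx.
have [K HK] : exists K : nat, (r ^+ K) `^ q * C <= e.
  have C0 : 0 < `|C| + 1 by rewrite ltr_wpDl.
  pose d := (e / (`|C| + 1)) `^ q^-1.
  have d0 : 0 < d by rewrite powR_gt0// divr_gt0.
  have : (r ^+ K @[K --> \oo]) --> (0 : R) by apply: cvg_expr; rewrite ger0_norm// ltW.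
  move=> /cvgrPdist_le/(_ _ d0)[K _ /(_ K (leqnn K))].
  rewrite sub0r normrN ger0_norm ?exprn_ge0 ?(ltW r0)// => rKd; exists K.
  apply: (@le_trans _ _ ((r ^+ K) `^ q * (`|C| + 1))).
    by rewrite ler_wpM2l ?powR_ge0// (le_trans (ler_norm _))// lerDl.
  rewrite -ler_pdivlMr//.
  have -> : e / (`|C| + 1) = d `^ q.
    by rewrite /d -powRrM mulVf ?gt_eqF// powRr1// ltW// divr_gt0.
  by rewrite ge0_ler_powR ?nnegrE ?exprn_ge0 ?(ltW q0) ?(ltW r0) ?(ltW d0).
by exists K => u cu iu uM; apply: le_trans (H K u cu iu uM) _; rewrite lee_fin.
Qed.

(** Split u into u - E_0 u and its average E_0 u over unit cells: the first is bounded by chaining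
    from level 0, the second by Poincare in L^p and the gain of [integral_powR_cells]. *)
Lemma sobolev : exists2 C : R, 0 < C & forall (u : 'rV[R]_N -> R) (M : R),
  continuous u -> mu.-integrable setT (EFin \o u) -> (forall x, b < `|x| -> u x = 0) ->
  0 <= M -> (semi u <= M%:E)%E ->
  (\int[mu]_x (`|u x| `^ q)%:E <= (C * M `^ (q / p))%:E)%E.
Proof.
set r : R := 2 `^ (((N%:R - s * p) * (q / p) - N%:R) / (q + 1)).
pose C1 : R := (r ^+ 0 / (1 - r)) `^ q * (1 - r)^-1 *
    (2 `^ N%:R * (Num.sqrt N%:R) `^ (N%:R + s * p)) `^ (q / p).
pose C2 : R := poincare_cst N s p b `^ (q / p).
exists (2 `^ q * (`|C1| + C2) + 1).
  by rewrite ltr_wpDl// mulr_ge0 ?powR_ge0// addr_ge0 ?powR_ge0.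
move=> u M cu iu u0 M0 uM.
have mu_ := integrable_mfun iu.
have mE := @measurable_cell_avg R N 0 u.
have P0 := poincare_cst_ge0 N s p b0.
have up : (\int[mu]_x (`|u x| `^ p)%:E <= (poincare_cst N s p b * M)%:E)%E.
  apply: le_trans (poincare N0 s0 p1 b0 iu u0) _.
  by rewrite [leRHS]EFinM lee_wpmul2l ?lee_fin.
have mup : measurable_fun setT (fun x => (`|u x| `^ p)%:E).
  by apply/measurable_EFinP; apply: (measurableT_comp (@measurable_powR R p)); exact: measurableT_comp.
have E0 : (\int[mu]_x (`|cell_avg 0 u x| `^ q)%:E <= (C2 * M `^ (q / p))%:E)%E.
  have := integral_powR_cells p1 pq (k := 0) (c := 1) mE mup _ _ _ up.
  rewrite powR1 !mul1r mul0n expr0 invr1 mul1r powRM// => h.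
  apply: h => //.
  - by rewrite mulr_ge0.
  - move=> x; have := cell_avg_mean p1 mu_ iu 0 x 0; rewrite mul0n expr0 subr0.
    by under eq_integral do rewrite subr0.
have uE := cell_avg_approx s0 p1 pq subcrit cu iu 0 M0 uM.
apply: (@le_trans _ _ (\int[mu]_x ((2 `^ q)%:E * ((`|u x - cell_avg 0 u x| `^ q)%:E + (`|cell_avg 0 u x| `^ q)%:E))))%E.
  apply: ge0_le_integral => //.
  - apply/measurable_EFinP; apply: (measurableT_comp (@measurable_powR R q)); exact: measurableT_comp.
  - apply: emeasurable_funM => //; apply: emeasurable_funD.
      apply/measurable_EFinP; apply: (measurableT_comp (@measurable_powR R q)).
      by apply: measurableT_comp => //; exact: measurable_funB.
    apply/measurable_EFinP; apply: (measurableT_comp (@measurable_powR R q)).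
    exact: measurableT_comp.
  - move=> x _; rewrite -EFinD -EFinM lee_fin.
    by apply: le_trans (norm_powRD_le _ _ (ltW q0)); rewrite subrK.
rewrite ge0_integralZl_EFin ?powR_ge0//; last 2 first.
- by move=> x _; rewrite -EFinD lee_fin addr_ge0 ?powR_ge0.
- apply: emeasurable_funD.
    apply/measurable_EFinP; apply: (measurableT_comp (@measurable_powR R q)).
    by apply: measurableT_comp => //; exact: measurable_funB.
  apply/measurable_EFinP; apply: (measurableT_comp (@measurable_powR R q)).
  exact: measurableT_comp.
rewrite ge0_integralD//; last 2 first.
- apply/measurable_EFinP; apply: (measurableT_comp (@measurable_powR R q)).
  by apply: measurableT_comp => //; exact: measurable_funB.
- apply/measurable_EFinP; apply: (measurableT_comp (@measurable_powR R q)).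
  exact: measurableT_comp.
apply: (@le_trans _ _ ((2 `^ q)%:E * ((C1 * M `^ (q / p))%:E + (C2 * M `^ (q / p))%:E))%E).
  by rewrite lee_wpmul2l ?lee_fin ?powR_ge0// leeD.
rewrite -EFinD -EFinM lee_fin -mulrDl mulrA ler_wpM2r ?powR_ge0//.
rewrite (@le_trans _ _ (2 `^ q * (`|C1| + C2)))// ?lerDl//.
by rewrite ler_wpM2l ?powR_ge0// lerD2r ler_norm.
Qed.

End sobolev.

(** * Finiteness of the seminorm of Lipschitz functions with bounded support *)

Section lipschitz_seminorm.
Context (R : realType) (N : nat) (s p : R).
Hypotheses (N0 : (0 < N)%N) (s0 : 0 < s) (s1 : s < 1) (p1 : 1 < p).
Implicit Types (x y : 'rV[R]_N).
Local Notation mu := (lebesgue_rV R N).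
Local Notation sigma := (N%:R + s * p).
Local Notation dens := (seminorm_density s p).
Local Notation semi := (seminorm s p).

Let p0 : 0 < p. Proof. by rewrite (lt_trans ltr01). Qed.
Let sigma0 : 0 < sigma. Proof. by rewrite ltr_wpDl// mulr_gt0. Qed.
Let pow2D (a b : R) : 2 `^ (a + b) = 2 `^ a * 2 `^ b :> R.
Proof. by rewrite powRD// pnatr_eq0 implybT. Qed.
Let e2 n : 2 ^+ n = 2 `^ n%:R :> R. Proof. by rewrite powR_mulrn. Qed.

Definition near_diag (e : R) := [set z : 'rV[R]_N * 'rV[R]_N | `|z.1 - z.2| <= e].

Lemma measurable_near_diag (e : R) : 0 <= e -> measurable (near_diag e).
Proof.
move=> e0.
rewrite (_ : near_diag e = \bigcap_(i in [set: 'I_N])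
   ((fun z : 'rV[R]_N * 'rV[R]_N => z.1 ord0 i - z.2 ord0 i) @^-1` `[- e, e])).
  apply: fin_bigcap_measurable => [|i _]; first exact: finite_finset.
  rewrite -[X in measurable X]setTI; apply: measurable_funB => //.
    exact: (measurableT_comp (@measurable_coord _ _ i)).
  exact: (measurableT_comp (@measurable_coord _ _ i)).
apply/seteqP; split => z; rewrite /near_diag/= rV_norm_le//.
  by move=> /forallP h i _; have := h i; rewrite !mxE ler_norml /= in_itv.
by move=> h; apply/forallP => i; have := h i I; rewrite !mxE ler_norml /= in_itv.
Qed.

(* A dyadic majorant of min(1, |x - y|^p) / |x - y|^(N + s p), whose integrals are
   geometric series. *)
Definition layers (a e : nat -> R) (z : 'rV[R]_N * 'rV[R]_N) : \bar R :=
  (\sum_(0 <= j <oo) (a j * \1_(near_diag (e j)) z)%:E)%E.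

Section layers.
Variables (a e : nat -> R).
Hypotheses (a0 : forall j, 0 <= a j) (e0 : forall j, 0 <= e j).

Lemma layers_ge0 z : (0 <= layers a e z)%E.
Proof. by apply: nneseries_ge0 => j _ _; rewrite lee_fin mulr_ge0. Qed.

Let mterm j : measurable_fun setT (fun z => (a j * \1_(near_diag (e j)) z)%:E).
Proof.
apply/measurable_EFinP; apply: measurable_funM => //.
by apply: measurable_indic; exact: measurable_near_diag.
Qed.

Lemma measurable_layers : measurable_fun setT (layers a e).
Proof.
by apply: ge0_emeasurable_sum => // j z _ _; rewrite lee_fin mulr_ge0.
Qed.

Lemma layers_sym x y : layers a e (x, y) = layers a e (y, x).
Proof.
apply: eq_eseriesr => j _; congr (_ * _)%:E; rewrite !indicE; congr (_%:R).
by congr nat_of_bool; apply/idP/idP; rewrite !inE /near_diag/= distrC.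
Qed.

Lemma layers_ge j z : near_diag (e j) z -> ((a j)%:E <= layers a e z)%E.
Proof.
move=> zj; apply: le_trans (nneseries_term_le j _).
  by rewrite indicE mem_set// mulr1.
by move=> n; rewrite lee_fin mulr_ge0.
Qed.

Lemma integral_layers (r c : R) x : 0 < r -> r < 1 -> 0 <= c ->
  (forall j, a j * (2 * e j) ^+ N = c * r ^+ j) ->
  (\int[mu]_y layers a e (x, y) <= (c / (1 - r))%:E)%E.
Proof.
move=> r0 r1 c0 aer.
have mpair := @pair1_measurable _ _ ('rV[R]_N) ('rV[R]_N) x.
rewrite /layers integral_nneseries//; last 2 first.
- by move=> j; exact: (measurableT_comp (mterm j) mpair).
- by move=> j y _; rewrite lee_fin mulr_ge0.
apply: (@le_trans _ _ (\sum_(0 <= j <oo) (c%:E * (r ^+ j)%:E))%E); last first.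
  rewrite nneseriesZl; last by move=> k _; rewrite lee_fin exprn_ge0// ltW.
  by rewrite EFinM lee_wpmul2l ?lee_fin// nneseries_geometric_le.
apply: lee_nneseries => [j _ _|j _]; first by apply: integral_ge0 => y _; rewrite lee_fin mulr_ge0.
under eq_integral do rewrite EFinM.
rewrite ge0_integralZl_EFin//; last first.
  apply/measurable_EFinP.
  have mS : measurable_fun setT (\1_(near_diag (e j)) : _ -> R).
    by apply: measurable_indic; exact: measurable_near_diag.
  exact: (measurableT_comp mS mpair).
rewrite -EFinM -aer EFinM lee_wpmul2l ?lee_fin//.
rewrite (eq_integral (fun y => (\1_([set y | `|x - y| <= e j]) y)%:E)); last by [].
rewrite integral_indic// ?setIT; last exact: measurable_ball_le.
by rewrite [leLHS]measure_ball_le.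
Qed.

End layers.

Lemma dyadic_small (t : R) : 0 < t -> t <= 1 -> exists j : nat, 2 ^- j.+1 < t <= 2 ^- j.
Proof.
move=> t0 t1.
have ex : exists j : nat, 2 ^- j.+1 < t.
  have [k _ /(_ k (leqnn k))] := near_infty_natSinv_expn_lt (PosNum t0).
  rewrite /= div1r => kt; exists k; apply: le_lt_trans kt.
  by rewrite lef_pV2 ?posrE ?exprn_gt0// ler_weXn2l// ler1n.
exists (ex_minn ex); case: ex_minnP => -[|m] mt min; rewrite mt/=.
  by rewrite expr0 invr1.
by rewrite leNgt; apply/negP => /min; rewrite ltnn.
Qed.

Lemma dyadic_large (t : R) : 1 < t -> exists j : nat, 2 ^+ j < t <= 2 ^+ j.+1.
Proof.
move=> t1.
have ex : exists j : nat, t <= 2 ^+ j.+1.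
  exists (Num.truncn t); apply: le_trans (ltW (truncnS_gt t)) _.
  by rewrite -natrX ler_nat ltnW// ltn_expl.
exists (ex_minn ex); case: ex_minnP => -[|m] mt min; rewrite mt andbT.
  by rewrite expr0.
by rewrite ltNge; apply/negP => /min; rewrite ltnn.
Qed.

(** The heights bound t^(p - sigma) for 2^-(j+1) < t <= 2^-j and t^-sigma for 2^j < t <= 2^(j+1).
    Multiplied by the volumes of the layers they form geometric series of ratios 2^(s p - p) and
    2^-(s p), convergent since s < 1 and s > 0. *)
Let a_near (j : nat) : R := 2 `^ (j.+1%:R * sigma) * 2 `^ (- (j%:R * p)).
Let e_near (j : nat) : R := 2 ^- j.
Let a_far (j : nat) : R := 2 `^ (- (j%:R * sigma)).
Let e_far (j : nat) : R := 2 ^+ j.+1.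

Definition truncated_kernel z : \bar R := (layers a_near e_near z + layers a_far e_far z)%E.

Let a_near0 j : 0 <= a_near j. Proof. by rewrite mulr_ge0 ?powR_ge0. Qed.
Let a_far0 j : 0 <= a_far j. Proof. exact: powR_ge0. Qed.
Let e_near0 j : 0 <= e_near j. Proof. by rewrite invr_ge0 exprn_ge0. Qed.
Let e_far0 j : 0 <= e_far j. Proof. by rewrite exprn_ge0. Qed.

Lemma truncated_kernel_ge0 z : (0 <= truncated_kernel z)%E.
Proof. by rewrite adde_ge0// layers_ge0. Qed.

Lemma truncated_kernel_sym x y : truncated_kernel (x, y) = truncated_kernel (y, x).
Proof. by rewrite /truncated_kernel !(layers_sym _ _ x). Qed.

Lemma measurable_truncated_kernel : measurable_fun setT truncated_kernel.
Proof. by apply: emeasurable_funD; exact: measurable_layers. Qed.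

Lemma integral_truncated_kernel : exists2 S : R, 0 <= S &
  forall x, (\int[mu]_y truncated_kernel (x, y) <= S%:E)%E.
Proof.
have lt1 (t : R) : t < 0 -> 0 < 2 `^ t /\ 2 `^ t < 1 :> R.
  move=> t0; split; first by rewrite powR_gt0.
  by rewrite /powR pnatr_eq0/= expR_lt1 pmulr_llt0 ?ln_gt0 ?ltr1n.
have spp : s * p - p < 0 by rewrite -{2}(mul1r p) -mulrBl pmulr_llt0// subr_lt0.
have sp0 : - (s * p) < 0 by rewrite oppr_lt0 mulr_gt0.
have [r0 r1] := lt1 _ spp; have [r0' r1'] := lt1 _ sp0.
pose c : R := 2 `^ (sigma + N%:R); pose c' : R := 2 `^ (N%:R + N%:R).
have pX (t : R) (j : nat) : (2 `^ t) ^+ j = 2 `^ (j%:R * t) :> R.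
  by rewrite -powR_mulrn ?powR_ge0// -powRrM mulrC.
exists (c / (1 - 2 `^ (s * p - p)) + c' / (1 - 2 `^ (- (s * p)))).
  by rewrite addr_ge0 ?divr_ge0 ?powR_ge0 ?subr_ge0 ?(ltW r1) ?(ltW r1').
move=> x; have mpair := @pair1_measurable _ _ ('rV[R]_N) ('rV[R]_N) x.
rewrite ge0_integralD//; last 4 first.
- by move=> y _; exact: layers_ge0.
- exact: (measurableT_comp (measurable_layers a_near0 e_near0) mpair).
- by move=> y _; exact: layers_ge0.
- exact: (measurableT_comp (measurable_layers a_far0 e_far0) mpair).
rewrite EFinD leeD//.
- apply: integral_layers => //; first exact: powR_ge0.
  move=> j; rewrite /a_near /e_near /c pX exprMn exprVn -exprM !e2 -powRN -!pow2D.
  by congr (_ `^ _); rewrite natrM -natr1; ring.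
- apply: integral_layers => //; first exact: powR_ge0.
  move=> j; rewrite /a_far /e_far /c' pX exprMn -exprM !e2 -!pow2D.
  by congr (_ `^ _); rewrite natrM -natr1; ring.
Qed.

Variables (u : 'rV[R]_N -> R) (L b : R).
Hypotheses (L0 : 0 <= L) (b0 : 0 < b) (uL : forall x y, `|u x - u y| <= L * `|x - y|).
Hypothesis (u0 : forall x, b < `|x| -> u x = 0).

(** Compare with the constant vector 2b, where u vanishes; it lies at distance at most 3b from every
    point of norm at most b. *)
Lemma lipschitz_bounded x : `|u x| <= L * (3 * b).
Proof.
have [bx|xb] := ltP b `|x|; first by rewrite u0// normr0 !mulr_ge0// ltW.
have y2 : `|const_mx (2 * b) : 'rV[R]_N| = 2 * b.
  apply/le_anti/andP; split.
    by rewrite rV_norm_le ?mulr_ge0 ?(ltW b0)//; apply/forallP => i; rewrite mxE ger0_norm ?mulr_ge0 ?(ltW b0).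
  have := coord_le_norm (const_mx (2 * b) : 'rV[R]_N) (Ordinal N0).
  by rewrite mxE; apply: le_trans; exact: ler_norm.
rewrite -[u x]subr0 -(u0 (x := const_mx (2 * b))); last by rewrite y2 ltr_pMl// ltr1n.
apply: le_trans (uL _ _) _; rewrite ler_wpM2l//.
by apply: le_trans (ler_normB _ _) _; rewrite y2; move: xb; lra.
Qed.

Let C : R := L `^ p + (2 * (L * (3 * b))) `^ p.
Let C0 : 0 <= C. Proof. by rewrite addr_ge0// powR_ge0. Qed.

Lemma seminorm_density_le_kernel z : ((dens u z)%:E <= C%:E * truncated_kernel z)%E.
Proof.
case: z => x y; have [->|xy] := eqVneq x y.
  rewrite /dens/= subrr normr0 powR0 ?gt_eqF// mul0r mule_ge0 ?lee_fin//.
  exact: truncated_kernel_ge0.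
set t := `|x - y|; have t0 : 0 < t by rewrite normr_gt0 subr_eq0.
have wt : sing_kernel s p (x, y) <= (t `^ sigma)^-1.
  rewrite /sing_kernel/= lef_pV2 ?posrE ?powR_gt0//; last exact: lt_le_trans (le_enorm _).
  by rewrite ge0_ler_powR ?nnegrE ?(ltW sigma0) ?(ltW t0) ?sqrtr_ge0// le_enorm.
have [t1|t1] := leP t 1.
- have [j /andP[tj jt]] := dyadic_small t0 t1.
  apply: (@le_trans _ _ (C%:E * (a_near j)%:E)%E); last first.
    rewrite lee_wpmul2l ?lee_fin//; apply: (@le_trans _ _ (layers a_near e_near (x, y))).
      by apply: layers_ge.
    by rewrite leeDl// layers_ge0.
  rewrite -EFinM lee_fin /dens/= /C mulrDl -[leLHS]addr0 lerD//; last first.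
    by rewrite mulr_ge0 ?powR_ge0.
  apply: (@le_trans _ _ ((L * t) `^ p * (t `^ sigma)^-1)).
    apply: ler_pM => //; first exact: sing_kernel_ge0.
    by rewrite norm_le_powR ?(ltW p0)//; exact: uL.
  rewrite powRM ?(ltW t0)// -mulrA ler_wpM2l ?powR_ge0// /a_near [leRHS]mulrC.
  apply: ler_pM; rewrite ?powR_ge0 ?invr_ge0 ?powR_ge0//.
    have -> : 2 `^ (- (j%:R * p)) = (2 ^- j) `^ p :> R by rewrite e2 -powRN -powRrM mulNr.
    by rewrite ge0_ler_powR ?nnegrE ?(ltW p0) ?(ltW t0)// invr_ge0 exprn_ge0.
  have -> : 2 `^ (j.+1%:R * sigma) = ((2 ^- j.+1) `^ sigma)^-1 :> R.
    by rewrite -powRN e2 -powRN -powRrM mulrNN.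
  rewrite lef_pV2 ?posrE ?powR_gt0 ?invr_gt0 ?exprn_gt0//.
  by rewrite ge0_ler_powR ?nnegrE ?(ltW sigma0) ?(ltW t0) ?(ltW tj)// invr_ge0 exprn_ge0.
- have [j /andP[jt tj]] := dyadic_large t1.
  apply: (@le_trans _ _ (C%:E * (a_far j)%:E)%E); last first.
    rewrite lee_wpmul2l ?lee_fin//; apply: (@le_trans _ _ (layers a_far e_far (x, y))).
      by apply: layers_ge.
    by rewrite leeDr// layers_ge0.
  rewrite -EFinM lee_fin /dens/= /C mulrDl -[leLHS]add0r lerD//.
    by rewrite mulr_ge0 ?powR_ge0.
  apply: ler_pM; rewrite ?powR_ge0 ?sing_kernel_ge0//.
    rewrite norm_le_powR ?(ltW p0)//.
    apply: le_trans (ler_normB _ _) _.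
    by have := lipschitz_bounded x; have := lipschitz_bounded y; lra.
  apply: le_trans wt _.
  have -> : a_far j = ((2 ^+ j) `^ sigma)^-1 :> R.
    by rewrite /a_far e2 -powRrM powRN.
  rewrite lef_pV2 ?posrE ?powR_gt0 ?exprn_gt0//.
  by rewrite ge0_ler_powR ?nnegrE ?(ltW sigma0) ?(ltW t0) ?(ltW jt)// exprn_ge0.
Qed.

Lemma lipschitz_continuous : continuous u.
Proof.
suff h (x : 'rV[R]_N) : u y @[y --> x] --> u x by move=> x; exact: h.
apply/(@cvgrPdist_le _ _ _ (nbhs x) (nbhs_filter x) u (u x)) => e e0.
have L1 : 0 < L + 1 by rewrite ltr_wpDl.
apply/nbhs_ballP; exists (e / (L + 1)) => /=; first by rewrite divr_gt0.
move=> y; rewrite -ball_normE/= => /ltW; rewrite ler_pdivlMr// => xy.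
apply: le_trans (uL _ _) _; apply: le_trans xy.
by rewrite mulrC ler_wpM2l// lerDl.
Qed.

(** The density vanishes unless x or y lies in the ball of radius b. Each of the two cases
    integrates the majorant in the free variable first, and symmetry of the majorant reduces the
    second case to the first. *)
Lemma lipschitz_seminorm_lty : (semi u < +oo)%E.
Proof.
have [S S0 HS] := integral_truncated_kernel.
pose B := [set x : 'rV[R]_N | `|0 - x| <= b].
have mB : measurable B by exact: measurable_ball_le.
have muB : mu B = ((2 * b) ^+ N)%:E by rewrite measure_ball_le// ltW.
have mu_ : measurable_fun setT u by exact: continuous_measurable_rV lipschitz_continuous.
have mT := measurable_truncated_kernel.
have T0 := truncated_kernel_ge0.
have mB1 : measurable_fun setT (\1_B : _ -> R) by exact: measurable_indic.
have mI1 : measurable_fun setT (fun z : 'rV[R]_N * 'rV[R]_N => (\1_B z.1)%:E : \bar R).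
  by apply/measurable_EFinP; apply: (measurableT_comp mB1).
have mI2 : measurable_fun setT (fun z : 'rV[R]_N * 'rV[R]_N => (\1_B z.2)%:E : \bar R).
  by apply/measurable_EFinP; apply: (measurableT_comp mB1).
pose f1 (z : 'rV[R]_N * 'rV[R]_N) := ((\1_B z.1)%:E * truncated_kernel z)%E.
pose f2 (z : 'rV[R]_N * 'rV[R]_N) := ((\1_B z.2)%:E * truncated_kernel z)%E.
have mf1 : measurable_fun setT f1 by exact: emeasurable_funM.
have mf2 : measurable_fun setT f2 by exact: emeasurable_funM.
have f10 z : (0 <= f1 z)%E by rewrite mule_ge0 ?lee_fin.
have f20 z : (0 <= f2 z)%E by rewrite mule_ge0 ?lee_fin.
have if1 : (\int[mu]_x \int[mu]_y f1 (x, y) <= (S * (2 * b) ^+ N)%:E)%E.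
  apply: (@le_trans _ _ (\int[mu]_x (S%:E * (\1_B x)%:E))%E).
    apply: ge0_le_integral => //.
    - by move=> x _; apply: integral_ge0.
    - exact: (measurable_fun_fubini_tonelli_F (m2 := mu) f1 mf1 f10).
    - apply: emeasurable_funM => //; apply/measurable_EFinP; exact: measurable_indic.
    - move=> x _; rewrite /f1/= ge0_integralZl_EFin//.
      + by rewrite muleC lee_wpmul2r ?lee_fin.
      + exact: (measurableT_comp mT (pair1_measurable x)).
  rewrite ge0_integralZl_EFin//; last by apply/measurable_EFinP; exact: measurable_indic.
  by rewrite integral_indic// setIT EFinM [X in (_ * X)%E]muB.
have if2 : (\int[mu]_x \int[mu]_y f2 (x, y) <= (S * (2 * b) ^+ N)%:E)%E.
  rewrite (fubini_tonelli f2 mf2 f20).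
  have -> : (fun y => \int[mu]_x f2 (x, y))%E = (fun y => \int[mu]_x f1 (y, x))%E.
    apply/funext => y; apply: eq_integral => x _.
    by rewrite /f1 /f2/= truncated_kernel_sym.
  exact: if1.
apply: (@le_lt_trans _ _ (\int[mu \x mu]_z (C%:E * (f1 z + f2 z)))%E).
  apply: ge0_le_integral => //.
  - by move=> z _; rewrite lee_fin seminorm_density_ge0.
  - by apply/measurable_EFinP; exact: measurable_seminorm_density.
  - by apply: emeasurable_funM => //; exact: emeasurable_funD.
  - move=> [x y] _; have [xB|xB] := boolP (x \in B).
      apply: le_trans (seminorm_density_le_kernel _) _.
      rewrite lee_wpmul2l ?lee_fin// /f1/= indicE xB mul1e leeDl//.
    have [yB|yB] := boolP (y \in B).
      apply: le_trans (seminorm_density_le_kernel _) _.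
      rewrite lee_wpmul2l ?lee_fin// /f2/= indicE yB mul1e leeDr//.
    rewrite (_ : dens u (x, y) = 0); first by rewrite mule_ge0 ?lee_fin// adde_ge0.
    rewrite /dens/= !u0 ?subrr ?normr0 ?powR0 ?mul0r ?gt_eqF//.
    - by move: yB; rewrite notin_setE /B/= sub0r normrN => /negP; rewrite -ltNge.
    - by move: xB; rewrite notin_setE /B/= sub0r normrN => /negP; rewrite -ltNge.
rewrite ge0_integralZl_EFin//; last 2 first.
- by move=> z _; rewrite adde_ge0.
- exact: emeasurable_funD.
rewrite ge0_integralD// lte_mul_pinfty// ?lee_fin//.
rewrite (fubini_tonelli1 f1 mf1 f10) (fubini_tonelli1 f2 mf2 f20).
apply: le_lt_trans (leeD if1 if2) _.
by rewrite -EFinD ltry.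
Qed.

End lipschitz_seminorm.

(** The image of the ultrafilter clusters in a segment, and for an ultrafilter clustering is
    convergence. *)
Lemma ultra_bounded_cvg (R : realType) (T : Type) (G : set_system T) (g : T -> R) (C : R) :
  UltraFilter G -> G [set u | `|g u| <= C] ->
  exists l : R, forall e : R, 0 < e -> G [set u | `|l - g u| <= e].
Proof.
move=> UG GC.
have GI : (g @ G) `[- C, C]%classic.
  rewrite /fmap/=; move: GC; apply: filterS => u /=.
  by rewrite in_itv/= ler_norml.
have [l [_ gl]] := @segment_compact R (- C) C (g @ G) _ GI.
exists l => e e0.
have [//|Gn] := in_ultra_setVsetC [set u | `|l - g u| <= e] UG.
have Gn' : (g @ G) [set y | ~ `|l - y| <= e] by exact: Gn.
have [y [/= ny]] := gl _ _ Gn' (nbhsx_ballx l e e0).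
by rewrite -ball_normE/= => /ltW.
Qed.

(** * Compactness of seminorm-bounded families *)

Section ae_series.
Context d (T : measurableType d) (R : realType).
Variable mu : {measure set T -> \bar R}.

Lemma ae_nneseries_lty (f : nat -> T -> \bar R) :
  (forall n, measurable_fun setT (f n)) -> (forall n x, 0 <= f n x)%E ->
  (\sum_(0 <= n <oo) \int[mu]_x f n x < +oo)%E ->
  {ae mu, forall x, (\sum_(0 <= n <oo) f n x < +oo)%E}.
Proof.
move=> mf f0; rewrite -integral_nneseries// => foo.
have mS : measurable_fun setT (fun x => \sum_(0 <= n <oo) f n x)%E.
  by apply: ge0_emeasurable_sum.
have S0 x : (0 <= \sum_(0 <= n <oo) f n x)%E by apply: nneseries_ge0 => n _ _.
have iS : mu.-integrable setT (fun x => \sum_(0 <= n <oo) f n x)%E.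
  apply/integrableP; split => //.
  by under eq_integral do rewrite gee0_abs//.
have := integrable_ae measurableT iS; apply: filterS => x /(_ I).
by rewrite ge0_fin_numE.
Qed.

(** The rate is what makes the q-th powers of 2^n [|a n x|] have integrals at most 2^-n; their
    series is then finite a.e., and its q-th root is the constant y. *)
Lemma ae_geometric_of_Lq (q : R) (a : nat -> T -> R) :
  0 < q -> (forall n, measurable_fun setT (a n)) ->
  (forall n, \int[mu]_x (`|a n x| `^ q)%:E <= ((2 `^ (- q) * 2^-1) ^+ n)%:E)%E ->
  {ae mu, forall x, exists y : R, forall n, `|a n x| <= geometric y 2^-1 n}.
Proof.
move=> q0 ma Ha.
pose f n x := ((2 ^+ n * `|a n x|) `^ q)%:E.
have mf n : measurable_fun setT (f n).
  apply/measurable_EFinP; apply: (measurableT_comp (@measurable_powR R q)).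
  by apply: measurable_funM => //; apply: measurableT_comp => //.
have f0 n x : (0 <= f n x)%E by rewrite lee_fin powR_ge0.
have half : 0 < 2^-1 :> R by [].
have half1 : 2^-1 < 1 :> R by rewrite invf_lt1// ltr1n.
have foo : (\sum_(0 <= n <oo) \int[mu]_x f n x < +oo)%E.
  apply: (@le_lt_trans _ _ (\sum_(0 <= n <oo) (2^-1 ^+ n)%:E)%E); last first.
    by apply: (@le_lt_trans _ _ ((1 - 2^-1)^-1%:E)%E); [exact: nneseries_geometric_le|exact: ltry].
  apply: lee_nneseries => [n _ _|n _]; first exact: integral_ge0.
  rewrite /f; under eq_integral do rewrite powRM ?exprn_ge0// EFinM.
  rewrite ge0_integralZl_EFin ?powR_ge0//; last first.
    apply/measurable_EFinP; apply: (measurableT_comp (@measurable_powR R q)).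
    exact: measurableT_comp.
  apply: (@le_trans _ _ (((2 ^+ n) `^ q)%:E * ((2 `^ (- q) * 2^-1) ^+ n)%:E)%E).
    by rewrite lee_wpmul2l// lee_fin powR_ge0.
  rewrite -EFinM lee_fin exprMn mulrA.
  rewrite (_ : (2 ^+ n) `^ q * 2 `^ (- q) ^+ n = 1) ?mul1r//.
  rewrite -!powR_mulrn ?powR_ge0// -!powRrM -powRD; last by rewrite pnatr_eq0 implybT.
  by rewrite (_ : _ + _ = 0) ?powRr0//; ring.
have := ae_nneseries_lty mf f0 foo; apply: filterS => x Xoo.
set X := (\sum_(0 <= n <oo) f n x)%E in Xoo.
have X0 : (0 <= X)%E by apply: nneseries_ge0.
have Xfin : X \is a fin_num by rewrite ge0_fin_numE.
exists (fine X `^ q^-1) => n.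
rewrite /geometric/= exprVn ler_pdivlMr ?exprn_gt0// mulrC.
have -> : 2 ^+ n * `|a n x| = ((2 ^+ n * `|a n x|) `^ q) `^ q^-1.
  by rewrite -powRrM mulfV ?gt_eqF// powRr1// mulr_ge0.
rewrite ge0_ler_powR ?nnegrE ?powR_ge0 ?invr_ge0 ?(ltW q0)//.
  exact: fine_ge0.
rewrite -lee_fin fineK//.
exact: (nneseries_term_le (u := f^~ x)).
Qed.

Lemma ae_cvg_of_Lq (q : R) (u : nat -> T -> R) (l : T -> R) :
  0 < q -> (forall n, measurable_fun setT (u n)) -> measurable_fun setT l ->
  (forall n, \int[mu]_x (`|u n x - l x| `^ q)%:E <= ((2 `^ (- q) * 2^-1) ^+ n)%:E)%E ->
  {ae mu, forall x, u ^~ x @ \oo --> l x}.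
Proof.
move=> q0 mu_ ml Hu.
have := ae_geometric_of_Lq (a := fun n x => u n x - l x) q0 _ Hu.
move=> /(_ (fun n => measurable_funB (mu_ n) ml)); apply: filterS => x [y Hy].
apply/subr_cvg0; apply: norm_cvg0.
apply: (@squeeze_cvgr _ _ _ _ (cst 0) (geometric y 2^-1)).
- by apply: nearW => n; rewrite normr_ge0 Hy.
- exact: cvg_cst.
- by apply: cvg_geometric; rewrite ger0_norm// invf_lt1// ltr1n.
Qed.

Lemma ae_cauchy_of_Lq (q : R) (u : nat -> T -> R) :
  0 < q -> (forall n, measurable_fun setT (u n)) ->
  (forall n, \int[mu]_x (`|u n.+1 x - u n x| `^ q)%:E <= ((2 `^ (- q) * 2^-1) ^+ n)%:E)%E ->
  {ae mu, forall x, cvgn (u ^~ x)}.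
Proof.
move=> q0 mu_ Hu.
have := ae_geometric_of_Lq (a := fun n x => u n.+1 x - u n x) q0 _ Hu.
move=> /(_ (fun n => measurable_funB (mu_ n.+1) (mu_ n))); apply: filterS => x [y dk].
have cs : cvgn (series (fun n => u n.+1 x - u n x)).
  apply: normed_cvg; apply: (@series_le_cvg _ _ (geometric y 2^-1)) => //.
  - by move=> n /=.
  - by move=> n; exact: le_trans (normr_ge0 _) (dk n).
  - by apply: is_cvg_geometric_series; rewrite ger0_norm// invf_lt1// ltr1n.
have -> : u ^~ x = (fun n => u 0%N x + series (fun n => u n.+1 x - u n x) n).
  by apply/funext => n; rewrite /series/= telescope_sumr// addrC subrK.
by apply: is_cvgD => //; exact: is_cvg_cst.
Qed.

End ae_series.

Lemma norm_powR_continuous (R : realType) (r : R) : 1 < r -> continuous (fun t : R => `|t| `^ r).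
Proof.
move=> r1 t; apply: differentiable_continuous; apply/derivable1_diffP.
by have [] := is_derive_norm_powR t r1.
Qed.

Section compactness.
Context (R : realType) (N : nat) (s p q b M : R).
Hypotheses (N0 : (0 < N)%N) (s0 : 0 < s) (p1 : 1 < p) (pq : p < q) (b0 : 0 < b) (M0 : 0 <= M).
Hypothesis subcrit : (N%:R - s * p) * q < N%:R * p.
Local Notation mu := (lebesgue_rV R N).
Local Notation semi := (seminorm s p).
Implicit Types (u v : 'rV[R]_N -> R).

Let p0 : 0 < p. Proof. by rewrite (lt_trans ltr01). Qed.
Let q0 : 0 < q. Proof. by rewrite (lt_trans p0). Qed.

Definition seminorm_ball : set ('rV[R]_N -> R) := [set u |
  [/\ continuous u, mu.-integrable setT (EFin \o u),
      forall x, b < `|x| -> u x = 0 & (semi u <= M%:E)%E]].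
Local Notation BB := seminorm_ball.

(** The q-th power of the L^q distance; hence the factor 2^q in the triangle inequality. *)
Definition Lq_dist u v : \bar R := (\int[mu]_x (`|u x - v x| `^ q)%:E)%E.

Lemma seminorm_ball_measurable u : BB u -> measurable_fun setT u.
Proof. by case=> _ iu _ _; exact: integrable_mfun iu. Qed.

Lemma measurable_Lq u v : measurable_fun setT u -> measurable_fun setT v ->
  measurable_fun setT (fun x => (`|u x - v x| `^ q)%:E).
Proof.
move=> mu_ mv; apply/measurable_EFinP; apply: (measurableT_comp (@measurable_powR R q)).
by apply: measurableT_comp => //; exact: measurable_funB.
Qed.

Lemma Lq_distC u v : Lq_dist u v = Lq_dist v u.
Proof. by apply: eq_integral => x _; rewrite distrC. Qed.

Lemma Lq_dist_triangle u v (w : 'rV[R]_N -> R) (a c : R) :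
  measurable_fun setT u -> measurable_fun setT v -> measurable_fun setT w ->
  (Lq_dist u v <= a%:E)%E -> (Lq_dist v w <= c%:E)%E ->
  (Lq_dist u w <= (2 `^ q * (a + c))%:E)%E.
Proof.
move=> mu_ mv mw ua vc.
apply: (@le_trans _ _ (\int[mu]_x ((2 `^ q)%:E * ((`|u x - v x| `^ q)%:E + (`|v x - w x| `^ q)%:E)))%E).
  apply: ge0_le_integral => //.
  - exact: measurable_Lq.
  - by apply: emeasurable_funM => //; apply: emeasurable_funD; exact: measurable_Lq.
  - move=> x _; rewrite -EFinD -EFinM lee_fin.
    by apply: le_trans (norm_powRD_le _ _ (ltW q0)); rewrite addrA subrK.
rewrite ge0_integralZl_EFin ?powR_ge0//; last 2 first.
- by move=> x _; rewrite -EFinD lee_fin addr_ge0 ?powR_ge0.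
- by apply: emeasurable_funD; exact: measurable_Lq.
rewrite ge0_integralD//; [|exact: measurable_Lq|exact: measurable_Lq].
by rewrite EFinM lee_wpmul2l ?lee_fin ?powR_ge0// EFinD leeD.
Qed.

(** Indexed by cells rather than points, so that finitely many indices describe the averages on a
    bounded set. *)
Let cavg k u (m : {ffun 'I_N -> int}) : R :=
  2 ^+ (k * N) * \int[mu]_(y in [set y | cell k y = m]) u y.

Let cavgE k u x : cell_avg k u x = cavg k u (cell k x). Proof. by []. Qed.

Let cell_surj k (m : {ffun 'I_N -> int}) : exists x : 'rV[R]_N, cell k x = m.
Proof.
exists (\row_i ((m i)%:~R / 2 ^+ k)); apply/ffunP => i.
by rewrite ffunE mxE mulrCA mulfV ?mulr1 ?intrKfloor// gt_eqF// exprn_gt0.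
Qed.

Lemma cell_avg_bounded k : exists C : R, forall u x, BB u -> `|cell_avg k u x| <= C.
Proof.
pose A := 2 ^+ (k * N) * (poincare_cst N s p b * M).
have A0 : 0 <= A by apply: mulr_ge0; [exact: exprn_ge0|apply: mulr_ge0 => //; exact: poincare_cst_ge0].
exists (A `^ p^-1) => u x Bu; have mu_ := seminorm_ball_measurable Bu.
case: Bu => cu iu u0 uM.
have up : (\int[mu]_x (`|u x| `^ p)%:E <= (poincare_cst N s p b * M)%:E)%E.
  apply: le_trans (poincare N0 s0 p1 b0 iu u0) _.
  by rewrite [leRHS]EFinM lee_wpmul2l ?lee_fin ?poincare_cst_ge0.
have h : ((`|cell_avg k u x| `^ p)%:E <= A%:E)%E.
  have := cell_avg_mean p1 mu_ iu k x 0; rewrite subr0 => /le_trans; apply.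
  rewrite /A EFinM lee_wpmul2l ?lee_fin ?exprn_ge0//; apply: le_trans up.
  under eq_integral do rewrite subr0.
  apply: ge0_subset_integral => //; first exact: measurable_cell.
  by apply/measurable_EFinP; apply: (measurableT_comp (@measurable_powR R p)); exact: measurableT_comp.
have -> : `|cell_avg k u x| = (`|cell_avg k u x| `^ p) `^ p^-1.
  by rewrite -powRrM mulfV ?gt_eqF// powRr1.
by rewrite ge0_ler_powR ?nnegrE ?powR_ge0 ?invr_ge0 ?(ltW p0)// -lee_fin.
Qed.

Lemma cell_avg_support k u x : BB u -> b + 1 < `|x| -> cell_avg k u x = 0.
Proof.
move=> [_ _ u0 _] bx; rewrite /cell_avg /Rintegral integral0_eq ?mulr0//.
move=> y /= yx; rewrite u0//.
have := cell_dist yx; have : 2 ^- k <= 1 :> R.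
  by rewrite invf_le1 ?exprn_gt0// exprn_ege1// ler1n.
have := ler_distD y x 0; rewrite !subr0 (distrC x y); move: bx; lra.
Qed.

(** Up to a uniform error u is its average of some fixed level k, which is determined by finitely
    many bounded numbers. The ultrafilter converges in each of them, hence contains a set on which
    all of them are almost constant. *)
Lemma totally_bounded_ultra (G : set_system ('rV[R]_N -> R)) (e : R) :
  UltraFilter G -> G BB -> 0 < e ->
  exists S : set ('rV[R]_N -> R), [/\ G S, S `<=` BB &
    forall u v, S u -> S v -> (Lq_dist u v <= e%:E)%E].
Proof.
move=> UG GB e0.
pose c : R := 2 `^ q.
have c0 : 0 < c by rewrite powR_gt0.
(* Two uses of the triangle inequality give (2 c + 1) c e1, at most 4 c^2 e1 because c >= 1. *)
pose e1 := e / (4 * c * c).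
have e10 : 0 < e1 by rewrite divr_gt0 ?mulr_gt0.
have [k Hk] := cell_avg_uniform_approx s0 p1 pq subcrit e10 M0.
have [C HC] := cell_avg_bounded k.
pose V : R := (2 * (b + 1)) ^+ N.
have V0 : 0 < V by rewrite exprn_gt0// mulr_gt0// addr_gt0.
(* A uniform difference of 2 eta on a set of measure V has q-th power integral e1. *)
pose eta := (e1 / V) `^ q^-1 / 2.
have eta0 : 0 < eta by rewrite divr_gt0// powR_gt0// divr_gt0.
have [J HJ] : exists J : nat, 2 ^+ k * (b + 1) < J%:R.
  by exists (Num.truncn (2 ^+ k * (b + 1))).+1; exact: truncnS_gt.
(* A finite enumeration of the cells with indices between -J and J, which include all cells meeting
   the ball of radius b + 1. *)
pose dec (t : {ffun 'I_N -> 'I_(J.*2.+1)}) : {ffun 'I_N -> int} := [ffun i => (t i)%:Z - J%:Z].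
have /choice[l Hl] : forall t, exists l : R, forall d : R, 0 < d -> G [set u | `|l - cavg k u (dec t)| <= d].
  move=> t; apply: (ultra_bounded_cvg (C := C)).
  have [x xt] := cell_surj k (dec t); apply: filterS GB => u Bu /=.
  by rewrite -xt -cavgE; exact: HC.
pose S := BB `&` [set u | forall t, `|l t - cavg k u (dec t)| <= eta].
exists S; split => [|u []//|].
  apply: filterI => //.
  have := @filter_forall _ _ (fun t u => `|l t - cavg k u (dec t)| <= eta) G _.
  by apply => t; exact: Hl.
move=> u v [Bu Su] [Bv Sv].
have dec_surj x : `|x| <= b + 1 -> exists t, dec t = cell k x.
  move=> xb; have xJ i : `|cell k x i| <= J%:Z.
    rewrite ffunE; have := coord_le_norm x i => /le_trans/(_ xb) xib.
    have h : `|2 ^+ k * x ord0 i| <= 2 ^+ k * (b + 1) by rewrite normrM ger0_norm ?exprn_ge0// ler_wpM2l ?exprn_ge0.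
    rewrite ler_norml; apply/andP; split.
      rewrite floor_ge_int mulrNz; move: h; rewrite ler_norml => /andP[h _].
      by apply: le_trans h; rewrite lerN2 ltW.
    rewrite -(ler_int R); apply: le_trans (floor_le _) _.
    by move: h; rewrite ler_norml => /andP[_ h]; apply: le_trans h _; rewrite ltW.
  exists [ffun i => inord (absz (cell k x i + J%:Z))]; apply/ffunP => i.
  have := xJ i; set m := cell k x i; rewrite ler_norml => /andP[m1 m2].
  rewrite 2!ffunE -/m inordK; last first.
    rewrite -ltz_nat gez0_abs; last by rewrite -lerBlDr sub0r.
    by rewrite -addnn -addn1 !PoszD ltzD1 lerD2r.
  by rewrite gez0_abs ?addrK// -lerBlDr sub0r.
have E1 x : `|cell_avg k u x - cell_avg k v x| <= 2 * eta.
  have [bx|xb] := ltP (b + 1) `|x|.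
    by rewrite !cell_avg_support// subrr normr0 mulr_ge0// ltW.
  have [t tx] := dec_surj x xb; rewrite !cavgE -tx.
  have := Su t; have := Sv t; have := ler_distD (l t) (cavg k u (dec t)) (cavg k v (dec t)).
  by rewrite (distrC _ (l t)); lra.
have muE w : measurable_fun setT (@cell_avg R N k w) by exact: measurable_cell_avg.
have mu_ := seminorm_ball_measurable Bu; have mv_ := seminorm_ball_measurable Bv.
have Euv : (Lq_dist (cell_avg k u) (cell_avg k v) <= e1%:E)%E.
  pose B := [set x : 'rV[R]_N | `|0 - x| <= b + 1].
  have mB : measurable B by exact: measurable_ball_le.
  have muB : mu B = V%:E by rewrite measure_ball_le// addr_ge0// ltW.
  apply: (@le_trans _ _ (\int[mu]_x ((e1 / V)%:E * (\1_B x)%:E))%E).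
    apply: ge0_le_integral => //.
    - exact: measurable_Lq.
    - by apply: emeasurable_funM => //; apply/measurable_EFinP; exact: measurable_indic.
    - move=> x _; rewrite -EFinM lee_fin.
      have [xB|xB] := boolP (x \in B).
        rewrite indicE xB mulr1.
        have -> : e1 / V = (2 * eta) `^ q.
          rewrite /eta mulrCA mulfV ?mulr1// -powRrM mulVf ?gt_eqF// powRr1//.
          by rewrite divr_ge0// ltW.
        exact: norm_le_powR (ltW q0) (E1 x).
      rewrite indicE (negbTE xB) mulr0.
      have bx : b + 1 < `|x|.
        by move: xB; rewrite notin_setE /B/= sub0r normrN => /negP; rewrite -ltNge.
      by rewrite !cell_avg_support// subrr normr0 powR0 ?gt_eqF.
  rewrite ge0_integralZl_EFin//; last 2 first.
  - by apply/measurable_EFinP; exact: measurable_indic.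
  - by rewrite divr_ge0// ltW.
  by rewrite integral_indic// setIT [X in (_ * X)%E]muB -EFinM lee_fin divfK// gt_eqF.
have [cu iu u0 uM] := Bu; have [cv iv v0 vM] := Bv.
have h1 : (Lq_dist u (cell_avg k u) <= e1%:E)%E by exact: Hk.
have h2 : (Lq_dist (cell_avg k v) v <= e1%:E)%E by rewrite Lq_distC; exact: Hk.
have h3 := Lq_dist_triangle mu_ (muE u) (muE v) h1 Euv.
have := Lq_dist_triangle mu_ (muE v) mv_ h3 h2 => /le_trans; apply; rewrite lee_fin -/c.
have c1 : 1 <= c by rewrite -(powRr0 2); apply: ler_powR; rewrite ?ler1n ?(ltW q0).
have -> : e = 4 * c * c * e1 by rewrite /e1 mulrCA mulfV ?mulr1// gt_eqF// !mulr_gt0.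
rewrite (_ : c * (c * (e1 + e1) + e1) = (2 * c + 1) * (c * e1)); last by ring.
rewrite (_ : 4 * c * c * e1 = (4 * c) * (c * e1)); last by ring.
have aux (t : R) : 1 <= t -> 2 * t + 1 <= 4 * t by lra.
by rewrite ler_wpM2r ?aux// mulr_ge0 ?(ltW c0) ?(ltW e10).
Qed.

(** The rate at which convergence in L^q implies convergence a.e. without passing to a
    subsequence. *)
Let rate (n : nat) : R := (2 `^ (- q) * 2^-1) ^+ n.

Let base_gt0 : 0 < 2 `^ (- q) * 2^-1 :> R.
Proof. by rewrite mulr_gt0 ?powR_gt0. Qed.

Let base_lt1 : 2 `^ (- q) * 2^-1 < 1 :> R.
Proof.
rewrite mulr_ilt1 ?powR_ge0//; last by rewrite invf_lt1// ltr1n.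
by rewrite /powR pnatr_eq0/= expR_lt1 pmulr_llt0 ?ln_gt0 ?ltr1n// oppr_lt0.
Qed.

Let rate_gt0 n : 0 < rate n. Proof. by rewrite exprn_gt0. Qed.

Let rate_le n m : (n <= m)%N -> rate m <= rate n.
Proof. by move=> nm; rewrite /rate ler_wiXn2l// ltW. Qed.

(* An ultrafilter containing all the [A i] replaces the extraction of
   subsequences, as [I] need not be countable. *)
Let intersect (I : Type) (A : I -> set ('rV[R]_N -> R)) (l : seq I) : set ('rV[R]_N -> R) :=
  foldr (fun i P => A i `&` P) BB l.

(** The sets [B n] are nested members of the ultrafilter of diameter at most [rate n]. A choice from
    each converges a.e. to some u, and by Fatou all of [B n] is within [rate n] of u. As each [A i]
    belongs to the ultrafilter, it meets every [B n], which yields a sequence in [A i] with the same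
    limit. *)
Theorem seminorm_ball_compact (I : Type) (A : I -> set ('rV[R]_N -> R)) :
  (forall l : seq I, exists u, BB u /\ forall i, List.In i l -> A i u) ->
  exists u : 'rV[R]_N -> R, measurable_fun setT u /\
    forall i, exists w : nat -> 'rV[R]_N -> R, [/\ (forall n, BB (w n) /\ A i (w n)),
      {ae mu, forall x, w ^~ x @ \oo --> u x} &
      Lq_dist (w n) u @[n --> \oo] --> 0%E].
Proof.
move=> finA; have AI (l : seq I) : intersect A l !=set0.
  have [u [Bu lu]] := finA l; exists u; elim: l lu => //= i l IH lA; split.
    by apply: lA; left.
  by apply: IH => j jl; apply: lA; right.
have subBB l : intersect A l `<=` BB by elim: l => // i l IH u [_ /IH].
have cat1 l1 l2 : intersect A (l1 ++ l2) `<=` intersect A l1.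
  elim: l1 => [|i l1 IH] u; first exact: subBB.
  by move=> [Au /IH ul].
have cat2 l1 l2 : intersect A (l1 ++ l2) `<=` intersect A l2.
  by elim: l1 => [//|i l1 IH] u [_ /IH].
pose F : set_system ('rV[R]_N -> R) := [set P | exists l, intersect A l `<=` P].
have FF : ProperFilter F.
  split; first by move=> [l Al]; have [u /Al] := AI l.
  split.
  - by exists [::].
  - move=> P Q [l1 P1] [l2 Q2]; exists (l1 ++ l2) => u ul; split.
      by apply: P1; exact: cat1 ul.
    by apply: Q2; exact: cat2 ul.
  - by move=> P Q PQ [l Pl]; exists l => u /Pl /PQ.
have [G [UG FG]] := ultraFilterLemma FF.
have GB : G BB by apply: FG; exists [::].
have GA i : G (A i) by apply: FG; exists [:: i] => u [].
have /choice[S HS] : forall n : nat, exists S : set ('rV[R]_N -> R), [/\ G S, S `<=` BB &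
    forall u v, S u -> S v -> (Lq_dist u v <= (rate n)%:E)%E].
  by move=> n; exact: totally_bounded_ultra.
pose B n := [set u | forall k, (k <= n)%N -> S k u].
have GBn n : G (B n).
  elim: n => [|n IH].
    have [GS _ _] := HS 0%N; apply: filterS GS => u Su k.
    by rewrite leqn0 => /eqP ->.
  have [GS _ _] := HS n.+1; apply: filterS2 GS IH => u Su Bu k.
  by rewrite leq_eqVlt => /predU1P[->//|]; exact: Bu.
have Bmono n m : (n <= m)%N -> B m `<=` B n.
  by move=> nm u Bu k kn; apply: Bu; exact: leq_trans nm.
have BBB n u : B n u -> BB u by move=> Bu; have [_ + _] := HS n; apply; exact: Bu.
have Bd n u v : B n u -> B n v -> (Lq_dist u v <= (rate n)%:E)%E.
  by move=> Bu Bv; have [_ _] := HS n; apply; [exact: Bu|exact: Bv].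
have /choice[w Hw] : forall n, exists u, B n u by move=> n; exact: filter_ex (GBn n).
have mw n : measurable_fun setT (w n) by exact: (seminorm_ball_measurable (BBB _ _ (Hw n))).
have cauchy : {ae mu, forall x, cvgn (w ^~ x)}.
  apply: (ae_cauchy_of_Lq q0 mw) => n; apply: (Bd n) => //.
  exact: Bmono (leqnSn n) _ (Hw _).
(* The upper limit is measurable on the whole space; off the set of convergence its values do not
   matter. *)
pose u x := fine (limn_esup (fun n => (w n x)%:E)).
have mu_ : measurable_fun setT u.
  have ml : measurable_fun setT (fun x => limn_esup (fun n => (w n x)%:E)).
    by apply: (@measurable_fun_limn_esup _ _ _ _ (fun n => EFin \o w n)) => n; exact/measurable_EFinP.
  by apply: (@measurableT_comp _ _ _ _ _ _ fine) => //.
have wu : {ae mu, forall x, w ^~ x @ \oo --> u x}.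
  apply: filterS cauchy => x cx; rewrite /u.
  have cE : (w n x)%:E @[n --> \oo] --> (limn (w ^~ x))%:E.
    by apply: cvg_EFin => //; exact: nearW.
  by have [_ ->] := cvg_limn_einf_sup cE.
have Bu n v : B n v -> (Lq_dist v u <= (rate n)%:E)%E.
  move=> Bv; have mv := seminorm_ball_measurable (BBB _ _ Bv).
  apply: (@fatou_ae _ _ _ mu (fun k x => `|v x - w (k + n)%N x| `^ q)).
  - move=> k; apply: (measurableT_comp (@measurable_powR R q)).
    by apply: measurableT_comp => //; exact: measurable_funB.
  - apply: (measurableT_comp (@measurable_powR R q)).
    by apply: measurableT_comp => //; exact: measurable_funB.
  - by move=> k x; exact: powR_ge0.
  - apply: filterS wu => x cx.
    apply: (@continuous_cvg _ _ _ _ _ (fun k => v x - w (k + n)%N x) (fun t => `|t| `^ q) (v x - u x)).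
      by apply: norm_powR_continuous; rewrite (lt_trans p1).
    apply: cvgB; first exact: cvg_cst.
    by rewrite (cvg_shiftn n (w ^~ x)).
  - move=> k; apply: (Bd n) => //.
    exact: Bmono (leq_addl k n) _ (Hw _).
exists u; split => //.
- move=> i; have /choice[v Hv] : forall n, exists v, B n v /\ A i v.
    by move=> n; exact: filter_ex (filterI (GBn n) (GA i)).
  exists v; split.
  + by move=> n; have [Bv Av] := Hv n; split => //; exact: BBB Bv.
  + apply: (ae_cvg_of_Lq q0) => // [n|n].
      by have [Bv _] := Hv n; exact: (seminorm_ball_measurable (BBB _ _ Bv)).
    by have [Bv _] := Hv n; exact: Bu.
  + apply: (@squeeze_cvge _ _ _ _ (cst 0%E) _ (fun n => (rate n)%:E)).
    * apply: nearW => n; rewrite integral_ge0/=; last by move=> x _; rewrite lee_fin powR_ge0.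
      by have [Bv _] := Hv n; exact: Bu.
    * exact: cvg_cst.
    * apply: cvg_EFin; first exact: nearW.
      by apply: cvg_expr; rewrite ger0_norm// ltW.
Qed.

End compactness.

(** * Growth of powers, of [Phi] and of its primitive; Young's inequality *)

Section scalar_growth.
Context (R : realType).
Implicit Types (t a b : R).

Lemma norm_powR2 (r : R) t : 1 < r -> `|t| `^ (r - 2) * t * t = `|t| `^ r.
Proof.
move=> r1; have [->|t0] := eqVneq t 0.
  by rewrite mulr0 normr0 powR0// gt_eqF// (lt_trans ltr01).
rewrite -mulrA -expr2 -[t ^+ 2]real_normK ?num_real// -powR_mulrn// -powRD.
  by congr (_ `^ _); ring.
by rewrite normr_eq0 t0 implybT.
Qed.

Lemma norm_sgn_powR (r : R) t : 1 < r -> `| `|t| `^ (r - 2) * t | = `|t| `^ (r - 1).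
Proof.
move=> r1; rewrite normrM ger0_norm ?powR_ge0//.
have [->|t0] := eqVneq t 0.
  by rewrite normr0 mulr0 powR0// subr_eq0 gt_eqF.
rewrite -[X in _ * X]powRr1// -powRD; first by congr (_ `^ _); ring.
by rewrite normr_eq0 t0 implybT.
Qed.

Lemma powR_small (r e : R) : 0 < r -> 0 < e ->
  exists2 d : R, 0 < d & forall t, `|t| <= d -> `|t| `^ r <= e.
Proof.
move=> r0 e0; exists (e `^ r^-1); first exact: powR_gt0.
move=> t td; have -> : e = (e `^ r^-1) `^ r.
  by rewrite -powRrM mulVf ?gt_eqF// powRr1// ltW.
by apply: norm_le_powR => //; exact: ltW.
Qed.

Lemma sgn_powR_continuous (r : R) : 1 < r -> continuous (fun t => `|t| `^ (r - 2) * t).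
Proof.
move=> r1 t; have [->|t0] := eqVneq t 0.
  apply/(@cvgrPdist_le _ _ _ (nbhs (0 : R)) (nbhs_filter (0 : R)) (fun t => `|t| `^ (r - 2) * t)) => e e0.
  rewrite mulr0.
  have r10 : 0 < r - 1 by rewrite subr_gt0.
  have [d d0 hd] := powR_small r10 e0.
  near=> x; rewrite sub0r normrN norm_sgn_powR//; apply: hd.
  have : `|0 - x| < d by near: x; exact: nbhsx_ballx.
  by rewrite sub0r normrN; exact: ltW.
apply: (@continuousM _ _ (fun t => `|t| `^ (r - 2)) id); last by move=> ?.
apply: (@continuous_comp _ _ _ (@Num.norm _ R) (fun t => t `^ (r - 2))).
  exact: norm_continuous.
apply: differentiable_continuous; apply/derivable1_diffP.
by apply: derivable_powR; rewrite in_itv/= andbT normr_gt0.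
Unshelve. all: by end_near. Qed.

(** Either b <= e a or a < b / e; each case gives one of the two terms. The small factor sits on the
    r-th power of a, as [cvg_Rintegral_unif] requires. *)
Lemma young_powR (r e a b : R) : 1 < r -> 0 < e -> 0 <= a -> 0 <= b ->
  a `^ (r - 1) * b <= e * a `^ r + e `^ (1 - r) * b `^ r.
Proof.
move=> r1 e0 a0 b0.
have r0 : 0 < r by rewrite (lt_trans ltr01).
have r10 : 0 <= r - 1 by rewrite subr_ge0 ltW.
have [ba|ab] := leP b (e * a).
  rewrite -[leLHS]addr0 lerD ?mulr_ge0 ?powR_ge0//.
  apply: (@le_trans _ _ (a `^ (r - 1) * (e * a))); first by rewrite ler_wpM2l ?powR_ge0.
  by rewrite mulrCA ler_wpM2l ?(ltW e0)// mulrC mulr_powRB1.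
rewrite -[leLHS]add0r lerD ?mulr_ge0 ?powR_ge0 ?(ltW e0)//.
have ae : a <= e^-1 * b by rewrite ler_pdivlMl// ltW.
apply: (@le_trans _ _ ((e^-1 * b) `^ (r - 1) * b)).
  by rewrite ler_wpM2r// ge0_ler_powR// nnegrE// mulr_ge0// invr_ge0 ltW.
rewrite powRM ?invr_ge0 ?(ltW e0)// -mulrA [X in _ * X]mulrC mulr_powRB1//.
by rewrite -powR_inv1 ?(ltW e0)// -powRrM mulN1r opprB.
Qed.

(** The version for the load, where b stands for f and is only in the dual Lebesgue space. *)
Lemma young_dual (r e a b : R) : 1 < r -> 0 < e -> 0 <= a -> 0 <= b ->
  b * a <= e * a `^ r + e `^ (- (r - 1)^-1) * b `^ (r / (r - 1)).
Proof.
move=> r1 e0 a0 b0.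
have r0 : 0 < r by rewrite (lt_trans ltr01).
have r10 : 0 < r - 1 by rewrite subr_gt0.
have [ba|ab] := leP b (e * a `^ (r - 1)).
  rewrite -[leLHS]addr0 lerD ?mulr_ge0 ?powR_ge0//.
  apply: (@le_trans _ _ (e * a `^ (r - 1) * a)); first by rewrite ler_wpM2r.
  by rewrite -mulrA [X in _ * X]mulrC mulr_powRB1.
rewrite -[leLHS]add0r lerD ?mulr_ge0 ?powR_ge0 ?(ltW e0)//.
have ae : a <= (e^-1 * b) `^ (r - 1)^-1.
  have -> : a = (a `^ (r - 1)) `^ (r - 1)^-1.
    by rewrite -powRrM mulfV ?gt_eqF// powRr1.
  rewrite ge0_ler_powR ?nnegrE ?powR_ge0 ?invr_ge0 ?(ltW r10)//.
    by rewrite mulr_ge0// invr_ge0 ltW.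
  by rewrite ler_pdivlMl// ltW.
apply: (@le_trans _ _ (b * (e^-1 * b) `^ (r - 1)^-1)); first by rewrite ler_wpM2l.
rewrite powRM ?invr_ge0 ?(ltW e0)// mulrCA.
rewrite -powR_inv1 ?(ltW e0)// -powRrM mulN1r.
rewrite le_eqVlt; apply/orP; left; apply/eqP; congr (_ * _).
rewrite -[in RHS](mulr_powRB1 b0 (divr_gt0 r0 r10)); congr (_ * _ `^ _).
by field; rewrite gt_eqF.
Qed.

Section operator_growth.
Variables (Phi : R -> R) (Lambda p : R).
Hypotheses (L1 : 1 <= Lambda) (p1 : 1 < p) (Phi_cont : continuous Phi) (Phi0 : Phi 0 = 0).
Hypothesis Phi_growth : forall t : R,
  Lambda^-1 * `|t| `^ p <= Phi t * t <= Lambda * `|t| `^ p.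

Let L0 : 0 < Lambda. Proof. by rewrite (lt_le_trans ltr01). Qed.
Let p0 : 0 < p. Proof. by rewrite (lt_trans ltr01). Qed.

Lemma Phi_le t : `|Phi t| <= Lambda * `|t| `^ (p - 1).
Proof.
have [->|t0] := eqVneq t 0.
  by rewrite Phi0 normr0 mulr_ge0 ?powR_ge0// ltW.
rewrite -(ler_pM2r (x := `|t|)) ?normr_gt0// -mulrA [X in _ <= _ * X]mulrC mulr_powRB1//.
rewrite -normrM; have /andP[h1 h2] := Phi_growth t.
by rewrite ger0_norm// (le_trans _ h1)// mulr_ge0 ?powR_ge0// invr_ge0 ltW.
Qed.

Variable P : R -> R.
Hypotheses (P0 : P 0 = 0) (dP : forall t : R, is_derive t 1 P (Phi t)).

Let pow00 : `|0 : R| `^ p = 0. Proof. by rewrite normr0 powR0// gt_eqF. Qed.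

Let dpow (c t : R) : is_derive t 1 (fun x : R => c * `|x| `^ p) (c * (p * (`|t| `^ (p - 2) * t))).
Proof. by apply: is_deriveZ; exact: is_derive_norm_powR. Qed.

(** The difference of the two sides vanishes at 0 and its derivative has the sign of t, by the lower
    growth bound. *)
Lemma potential_ge t : (p * Lambda)^-1 * `|t| `^ p <= P t.
Proof.
rewrite -subr_ge0.
apply: (@derive_sign_ge0 _ (fun t => P t - (p * Lambda)^-1 * `|t| `^ p)
  (fun t => Phi t - (p * Lambda)^-1 * (p * (`|t| `^ (p - 2) * t)))).
- by rewrite P0 pow00 mulr0 subr0.
- by move=> x; apply: is_deriveB.
- move=> x; rewrite mulrBl.
  have -> : (p * Lambda)^-1 * (p * (`|x| `^ (p - 2) * x)) * x = Lambda^-1 * `|x| `^ p.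
    by rewrite -(norm_powR2 x p1); field; rewrite !gt_eqF.
  by rewrite subr_ge0; have /andP[] := Phi_growth x.
Qed.

Lemma potential_le t : P t <= Lambda / p * `|t| `^ p.
Proof.
rewrite -subr_ge0.
apply: (@derive_sign_ge0 _ (fun t => Lambda / p * `|t| `^ p - P t)
  (fun t => Lambda / p * (p * (`|t| `^ (p - 2) * t)) - Phi t)).
- by rewrite P0 pow00 mulr0 subr0.
- by move=> x; apply: is_deriveB.
- move=> x; rewrite mulrBl.
  have -> : Lambda / p * (p * (`|x| `^ (p - 2) * x)) * x = Lambda * `|x| `^ p.
    by rewrite -(norm_powR2 x p1); field; rewrite gt_eqF.
  by rewrite subr_ge0; have /andP[] := Phi_growth x.
Qed.

Lemma potential_le_dual t : P t <= Lambda ^+ 2 / p * (Phi t * t).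
Proof.
apply: le_trans (potential_le t) _.
have /andP[h _] := Phi_growth t; rewrite ler_pdivrMl// in h.
have Lp0 : 0 <= Lambda / p by rewrite divr_ge0// ltW.
apply: le_trans (ler_wpM2l Lp0 h) _.
by rewrite le_eqVlt; apply/orP; left; apply/eqP; ring.
Qed.

End operator_growth.

Lemma is_derive_power_potential (q : R) t : 1 < q ->
  is_derive t 1 (fun x : R => q^-1 * `|x| `^ q) (`|t| `^ (q - 2) * t).
Proof.
move=> q1; have q0 : 0 < q by rewrite (lt_trans ltr01).
have := is_deriveZ q^-1 (is_derive_norm_powR t q1) => h.
by apply: (is_derive_eq h); rewrite /GRing.scale/= mulKf// gt_eqF.
Qed.

End scalar_growth.

(** * The energy functional *)

Section energy.
Context (R : realType) (N : nat) (s p q Lambda b : R).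
Local Notation X := ('rV[R]_N).
Context (kap : X * X -> R) (Phi P : R -> R) (f0 : X -> R) (Omega : set X).
Hypotheses (N0 : (0 < N)%N) (s0 : 0 < s) (s1 : s < 1) (p1 : 1 < p) (pq : p < q) (b0 : 0 < b).
Hypothesis subcrit : (N%:R - s * p) * q < N%:R * p.
Hypothesis (L1 : 1 <= Lambda).
Hypotheses (mkap : measurable_fun setT kap)
  (kap_ge : forall z, Lambda^-1 * sing_kernel s p z <= kap z)
  (kap_le : forall z, kap z <= Lambda * sing_kernel s p z).
Hypotheses (Phi_cont : continuous Phi) (Phi0 : Phi 0 = 0).
Hypothesis Phi_growth : forall t : R,
  Lambda^-1 * `|t| `^ p <= Phi t * t <= Lambda * `|t| `^ p.
Hypotheses (P0 : P 0 = 0) (dP : forall t : R, is_derive t 1 P (Phi t)).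
Local Notation mu := (lebesgue_rV R N).
Local Notation mu2 := (mu \x mu)%E.
Hypotheses (mf0 : measurable_fun setT f0)
  (if0 : mu.-integrable setT (EFin \o (fun x => `|f0 x| `^ (p / (p - 1))))).
Hypothesis Omega_b : forall x, Omega x -> `|x| <= b.
Implicit Types (u v phi : X -> R).

Let L0 : 0 < Lambda. Proof. by rewrite (lt_le_trans ltr01). Qed.
Let p0 : 0 < p. Proof. by rewrite (lt_trans ltr01). Qed.
Let q1 : 1 < q. Proof. by rewrite (lt_trans p1). Qed.
Let q0 : 0 < q. Proof. by rewrite (lt_trans ltr01). Qed.

Definition increment u (z : X * X) : R := u z.1 - u z.2.
Local Notation T := increment.
(* The unit weight makes [weighted_Lp] an unweighted space for Lebesgue measure. *)
Let one : X -> R := fun=> 1.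
Let mone : measurable_fun setT one. Proof. exact: measurable_cst. Qed.
Let one0 x : 0 <= one x. Proof. by []. Qed.

Let kap0 z : 0 <= kap z.
Proof. by apply: le_trans (kap_ge z); rewrite mulr_ge0 ?sing_kernel_ge0// invr_ge0 ltW. Qed.

(** A vector space that contains the test functions. When [Omega] is bounded, its members are
    bounded and of finite seminorm, and the inequalities proved for continuous functions apply to
    them. *)
Definition admissible u := (exists2 L : R, 0 <= L & forall x y, `|u x - u y| <= L * `|x - y|) /\
  (forall x, ~ Omega x -> u x = 0).
Local Notation V := admissible.

Lemma admissibleD u v : V u -> V v -> V (fun x => u x + v x).
Proof.
move=> [[L L0' uL] u0] [[L' L0'' vL] v0]; split; last by move=> x nx; rewrite u0// v0// addr0.
exists (L + L'); first exact: addr_ge0.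
move=> x y; rewrite mulrDl opprD addrACA.
by rewrite (le_trans (ler_normD _ _))// lerD.
Qed.

Lemma admissibleZ c u : V u -> V (fun x => c * u x).
Proof.
move=> [[L L0' uL] u0]; split; last by move=> x nx; rewrite u0// mulr0.
exists (`|c| * L); first exact: mulr_ge0.
by move=> x y; rewrite -mulrBr normrM -mulrA ler_wpM2l.
Qed.

Lemma admissible0 : V (fun=> 0).
Proof. by split => //; exists 0 => // x y; rewrite subrr normr0 mul0r. Qed.

Lemma admissible_sum n (c : 'I_n -> R) (psi : 'I_n -> X -> R) : (forall i, V (psi i)) ->
  V (fun x => \sum_i c i * psi i x).
Proof.
elim: n c psi => [c psi _|n IH c psi Vpsi].
  by under eq_fun do rewrite big_ord0; exact: admissible0.
under eq_fun do rewrite big_ord_recl.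
by apply: admissibleD; [exact: admissibleZ|exact: IH].
Qed.

Lemma admissible_out u x : V u -> b < `|x| -> u x = 0.
Proof. by move=> [_ u0] bx; apply: u0 => /Omega_b; rewrite leNgt bx. Qed.

Lemma admissible_continuous u : V u -> continuous u.
Proof. by move=> [[L L0' uL] _]; exact: lipschitz_continuous uL. Qed.

Lemma admissible_measurable u : V u -> measurable_fun setT u.
Proof. by move=> Vu; apply: continuous_measurable_rV; exact: admissible_continuous. Qed.

Lemma admissible_bounded u : V u -> exists C : R, forall x, `|u x| <= C.
Proof.
move=> Vu; have [[L L0' uL] _] := Vu; exists (L * (3 * b)) => x.
by apply: (lipschitz_bounded N0 L0' b0 uL) => y; exact: admissible_out.
Qed.

Lemma admissible_bounded_integrable u (g : X -> R) : measurable_fun setT g ->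
  (exists C : R, forall x, `|g x| <= C) -> (forall x, b < `|x| -> g x = 0) ->
  mu.-integrable setT (EFin \o g).
Proof.
move=> mg [C gC] g0.
pose B := [set x : X | `|0 - x| <= b].
have mB : measurable B by exact: measurable_ball_le.
have muB : mu B = ((2 * b) ^+ N)%:E by rewrite measure_ball_le// ltW.
have C0 : 0 <= C by exact: le_trans (gC 0).
apply: (@le_integrableR _ _ _ mu _ (fun x => C * \1_B x)) => //.
  move=> x; have [xB|xB] := boolP (x \in B); first by rewrite indicE xB mulr1.
  rewrite indicE (negbTE xB) mulr0 g0 ?normr0//.
  by move: xB; rewrite notin_setE /B/= sub0r normrN => /negP; rewrite -ltNge.
apply: integrableZR; apply: ge0_integrable => //.
by rewrite integral_indic// setIT [ltLHS]muB ltry.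
Qed.

Lemma admissible_integrable u : V u -> mu.-integrable setT (EFin \o u).
Proof.
move=> Vu; apply: admissible_bounded_integrable => //.
- exact: admissible_measurable.
- exact: admissible_bounded.
- by move=> x; exact: admissible_out.
Qed.

Lemma admissible_Lp r u : 1 < r -> V u -> weighted_Lp mu one r u.
Proof.
move=> r1 Vu; split; first exact: admissible_measurable.
have r0 : 0 <= r by rewrite ltW// (lt_trans ltr01).
apply: admissible_bounded_integrable => //.
- by apply: measurable_norm_powRk => //; exact: admissible_measurable.
- have [C uC] := admissible_bounded Vu; exists (C `^ r) => x.
  by rewrite /one mulr1 ger0_norm ?powR_ge0// norm_le_powR.
- move=> x bx; rewrite (admissible_out Vu bx) normr0 powR0 ?mul0r//.
  by rewrite gt_eqF// (lt_trans ltr01).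
Qed.

Lemma measurable_increment u : measurable_fun setT u -> measurable_fun setT (T u).
Proof. exact: measurable_diff. Qed.

Lemma integrable_seminorm_density u : measurable_fun setT u -> (seminorm s p u < +oo)%E ->
  weighted_Lp mu2 (sing_kernel s p) p (T u).
Proof.
move=> mu_ uoo; split; first exact: measurable_increment.
apply: ge0_integrable => //; first exact: measurable_seminorm_density.
by move=> z; exact: seminorm_density_ge0.
Qed.

Lemma weighted_increment u : measurable_fun setT u -> (seminorm s p u < +oo)%E ->
  weighted_Lp mu2 kap p (T u).
Proof.
move=> mu_ uoo; have [mT iT] := integrable_seminorm_density mu_ uoo; split => //.
apply: (@le_integrableR _ _ _ mu2 _ (fun z => Lambda * (`|T u z| `^ p * sing_kernel s p z))).
- exact: measurable_norm_powRk.
- move=> z; rewrite ger0_norm ?mulr_ge0 ?powR_ge0// mulrCA.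
  by rewrite ler_wpM2l ?powR_ge0.
- exact: integrableZR.
Qed.

Lemma admissible_seminorm_lty u : V u -> (seminorm s p u < +oo)%E.
Proof.
move=> Vu; have [[L L0' uL] _] := Vu.
by apply: (lipschitz_seminorm_lty N0 s0 s1 p1 L0' b0 uL) => x; exact: admissible_out.
Qed.

Lemma admissible_increment u : V u -> weighted_Lp mu2 kap p (T u).
Proof.
move=> Vu; apply: weighted_increment; first exact: admissible_measurable.
exact: admissible_seminorm_lty.
Qed.

Definition rho u : R := \int[mu2]_z (`|T u z| `^ p * kap z).
Definition mass u : R := \int[mu]_x (`|u x| `^ q * one x).
Definition load u : R := \int[mu]_x (f0 x * u x).

Lemma rho_ge0 u : 0 <= rho u.
Proof. by apply: Rintegral_ge0 => z _; rewrite mulr_ge0 ?powR_ge0. Qed.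

Lemma mass_ge0 u : 0 <= mass u.
Proof. by apply: Rintegral_ge0 => z _; rewrite mulr_ge0 ?powR_ge0. Qed.

Lemma seminorm_le_rho u : V u -> (seminorm s p u <= (Lambda * rho u)%:E)%E.
Proof.
move=> Vu; have [mT iT] := admissible_increment Vu.
rewrite EFinM RintegralE// -ge0_integralZl_EFin//; last 3 first.
- by move=> z _; rewrite lee_fin mulr_ge0 ?powR_ge0.
- by apply/measurable_EFinP; exact: measurable_norm_powRk.
- exact: ltW.
apply: ge0_le_integral => //.
- by move=> z _; rewrite lee_fin seminorm_density_ge0.
- by apply/measurable_EFinP; apply: measurable_seminorm_density; exact: admissible_measurable.
- by apply: emeasurable_funM => //; apply/measurable_EFinP; exact: measurable_norm_powRk.
- move=> z _; rewrite -EFinM lee_fin mulrCA ler_wpM2l ?powR_ge0//.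
  by rewrite -ler_pdivrMl.
Qed.

Let seminormball u : V u -> seminorm_ball s p b (Lambda * rho u) u.
Proof.
move=> Vu; split.
- exact: admissible_continuous.
- exact: admissible_integrable.
- by move=> x; exact: admissible_out.
- exact: seminorm_le_rho.
Qed.

Lemma poincare_rho u : V u ->
  (\int[mu]_x (`|u x| `^ p)%:E <= (poincare_cst N s p b * (Lambda * rho u))%:E)%E.
Proof.
move=> Vu; have [cu iu uo uM] := seminormball Vu.
apply: le_trans (poincare N0 s0 p1 b0 iu uo) _.
by rewrite [leRHS]EFinM lee_wpmul2l ?lee_fin ?poincare_cst_ge0.
Qed.

Lemma sobolev_rho : exists2 C : R, 0 < C & forall u, V u ->
  mass u <= C * (Lambda * rho u) `^ (q / p).
Proof.
have [C C0 HC] := sobolev N0 s0 p1 pq b0 subcrit.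
exists C => // u Vu; have [cu iu uo uM] := seminormball Vu.
have := HC u _ cu iu uo (mulr_ge0 (ltW L0) (rho_ge0 u)) uM.
have [_ iq] := admissible_Lp q1 Vu.
rewrite -lee_fin /mass RintegralE//.
by under [X in _ -> (X <= _)%E]eq_integral do rewrite /one mulr1.
Qed.

Lemma load_density e : 0 < e -> exists2 C : R, 0 <= C &
  forall u x, `|f0 x * u x| <= e * `|u x| `^ p + C * `|f0 x| `^ (p / (p - 1)).
Proof.
move=> e0; exists (e `^ (- (p - 1)^-1)); first exact: powR_ge0.
by move=> u x; rewrite normrM; apply: young_dual.
Qed.

Lemma integrable_load u : weighted_Lp mu one p u ->
  mu.-integrable setT (EFin \o (fun x => f0 x * u x)).
Proof.
move=> [mu_ iu]; have [C C0 HC] := load_density ltr01.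
apply: le_integrableR (HC u) _; first exact: measurable_funM.
apply: integrableDR; last exact: integrableZR.
apply: integrableZR; move: iu; apply: eq_integrable => // x _ /=.
by rewrite /one mulr1.
Qed.

Lemma load_le e : 0 < e -> exists2 C : R, 0 <= C &
  forall u, V u -> `|load u| <= e * rho u + C.
Proof.
move=> e0.
have pc0 := poincare_cst_ge0 N s p b0.
(* Poincare bounds the L^p term by [poincare_cst N s p b * Lambda] times rho, so this choice leaves
   at most e rho; the added 1 keeps the denominator positive. *)
pose e' := e / (poincare_cst N s p b * Lambda + 1).
have d0 : 0 < poincare_cst N s p b * Lambda + 1.
  by rewrite ltr_wpDl// mulr_ge0// ltW.
have e'0 : 0 < e' by rewrite divr_gt0.
have [C C0 HC] := load_density e'0.
pose A := \int[mu]_x (`|f0 x| `^ (p / (p - 1))).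
have A0 : 0 <= A by apply: Rintegral_ge0 => x _; exact: powR_ge0.
exists (C * A); first exact: mulr_ge0.
move=> u Vu; have Lu := admissible_Lp p1 Vu.
have ifu := integrable_load Lu.
have iu : mu.-integrable setT (EFin \o (fun x => `|u x| `^ p)).
  by have [_] := Lu; apply: eq_integrable => // x _ /=; rewrite /one mulr1.
apply: (le_trans (le_normr_Rintegral _ ifu)) => //.
have i1 := integrableZR e' iu; have i2 := integrableZR C if0.
apply: (@le_trans _ _ (\int[mu]_x (e' * `|u x| `^ p + C * `|f0 x| `^ (p / (p - 1))))).
  apply: le_Rintegral => //; first exact: integrable_normR.
  exact: integrableDR.
rewrite RintegralD// !RintegralZl// lerD2r.
have : \int[mu]_x (`|u x| `^ p) <= poincare_cst N s p b * (Lambda * rho u).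
  by rewrite -lee_fin RintegralE//; exact: poincare_rho.
move=> h; apply: (le_trans (ler_wpM2l (ltW e'0) h)).
have -> : e' * (poincare_cst N s p b * (Lambda * rho u)) =
    e * rho u * (poincare_cst N s p b * Lambda / (poincare_cst N s p b * Lambda + 1)).
  by rewrite /e'; ring.
rewrite ler_piMr ?mulr_ge0 ?rho_ge0 ?(ltW e0)//.
by rewrite ler_pdivrMr// mul1r lerDl.
Qed.

Let g (t : R) := `|t| `^ (q - 2) * t.
Let G (t : R) := q^-1 * `|t| `^ q.

Definition energy lam u : R :=
  \int[mu2]_z (P (T u z) * kap z) - lam * \int[mu]_x (G (u x) * one x) - load u.

Definition denergy lam u phi : R :=
  \int[mu2]_z (Phi (T u z) * T phi z * kap z) -
  lam * \int[mu]_x (g (u x) * phi x * one x) - load phi.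

Let Phi_le' := Phi_le L1 p1 Phi0 Phi_growth.
Let g_le (t : R) : `|g t| <= 1 * `|t| `^ (q - 1).
Proof. by rewrite mul1r norm_sgn_powR. Qed.
Let g_cont : continuous g. Proof. exact: sgn_powR_continuous. Qed.
Let dG (t : R) : is_derive t 1 G (g t). Proof. exact: is_derive_power_potential. Qed.
Let G0 : G 0 = 0. Proof. by rewrite /G normr0 powR0 ?mulr0// gt_eqF. Qed.

Lemma massE u : V u -> \int[mu]_x (G (u x) * one x) = q^-1 * mass u.
Proof.
move=> Vu; have [_ iq] := admissible_Lp q1 Vu.
rewrite /mass -RintegralZl//; apply: eq_Rintegral => x _.
by rewrite /G mulrA.
Qed.

Lemma mass_dual u : \int[mu]_x (g (u x) * u x * one x) = mass u.
Proof. by apply: eq_Rintegral => x _; rewrite /g norm_powR2. Qed.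

Lemma energy_is_derive lam u v (t : R) : V u -> V v ->
  is_derive t 1 (fun t : R => energy lam (fun x => u x + t * v x))
    (denergy lam (fun x => u x + t * v x) v).
Proof.
move=> Vu Vv.
have TE (r : R) z : T (fun x => u x + r * v x) z = T u z + r * T v z.
  by rewrite /T; ring.
have h1 := superposition_is_derive mkap kap0 p1 dP P0 Phi_le' t
  (admissible_increment Vu) (admissible_increment Vv).
have h2 := superposition_is_derive mone one0 q1 dG G0 g_le t
  (admissible_Lp q1 Vu) (admissible_Lp q1 Vv).
have iu := integrable_load (admissible_Lp p1 Vu).
have iv := integrable_load (admissible_Lp p1 Vv).
have loadE (r : R) : load (fun x => u x + r * v x) = load u + r * load v.
  rewrite /load -RintegralZl// -RintegralD//; last exact: integrableZR.
  by apply: eq_Rintegral => x _; ring.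
have h3 : is_derive t 1 (fun r : R => load u + r * load v) (load v).
  have h := is_deriveM (is_derive_id t (1:R)) (is_derive_cst (load v) t (1:R)).
  apply: (is_derive_eq (is_deriveD (is_derive_cst (load u) t (1:R)) h)).
  by rewrite scaler0 !add0r /GRing.scale/= mulr1.
have -> : (fun r : R => energy lam (fun x => u x + r * v x)) =
   (fun r : R => \int[mu2]_z (P (T u z + r * T v z) * kap z)) -
   lam *: (fun r : R => \int[mu]_x (G (u x + r * v x) * one x)) -
   (fun r : R => load u + r * load v).
  apply/funext => r; rewrite /energy loadE; congr (_ - _ - _).
  by apply: eq_Rintegral => z _; rewrite TE.
apply: (is_derive_eq (is_deriveB (is_deriveB h1 (is_deriveZ lam h2)) h3)).
rewrite /denergy; congr (_ - _ - _).
by apply: eq_Rintegral => z _; rewrite TE.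
Qed.

Let ipot u : V u -> mu2.-integrable setT (EFin \o (fun z => P (T u z) * kap z)).
Proof.
move=> Vu; apply: (integrable_superposition mkap kap0 p1 dP P0 Phi_le').
exact: admissible_increment.
Qed.

Let idpot u v : V u -> V v ->
  mu2.-integrable setT (EFin \o (fun z => Phi (T u z) * T v z * kap z)).
Proof.
move=> Vu Vv.
by apply: (integrable_dsuperposition mkap kap0 p1 Phi_cont Phi_le'); exact: admissible_increment.
Qed.

Let irho u : V u -> mu2.-integrable setT (EFin \o (fun z => `|T u z| `^ p * kap z)).
Proof. by move=> /admissible_increment[]. Qed.

Let idmass u v : V u -> V v ->
  mu.-integrable setT (EFin \o (fun x => g (u x) * v x * one x)).
Proof.
move=> Vu Vv.
by apply: (integrable_dsuperposition mone one0 q1 g_cont g_le); exact: admissible_Lp.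
Qed.

Let iload u : V u -> mu.-integrable setT (EFin \o (fun x => f0 x * u x)).
Proof. by move=> Vu; apply: integrable_load; exact: admissible_Lp. Qed.

Let pot u := \int[mu2]_z (P (T u z) * kap z).
Let dpot u := \int[mu2]_z (Phi (T u z) * T u z * kap z).

Lemma energyE lam u : V u -> energy lam u = pot u - lam * (q^-1 * mass u) - load u.
Proof. by move=> Vu; rewrite /energy massE. Qed.

Lemma denergyE lam u : denergy lam u u = dpot u - lam * mass u - load u.
Proof. by rewrite /denergy mass_dual. Qed.

Lemma potential_rho_ge u : V u -> (p * Lambda)^-1 * rho u <= pot u.
Proof.
move=> Vu; rewrite /rho -RintegralZl//; last exact: irho.
apply: le_Rintegral => //; [by apply: integrableZR; exact: irho|exact: ipot|].
by move=> z _; rewrite mulrA ler_wpM2r// (potential_ge L1 p1 Phi_growth P0 dP).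
Qed.

Lemma potential_rho_le u : V u -> pot u <= Lambda / p * rho u.
Proof.
move=> Vu; rewrite /rho -RintegralZl//; last exact: irho.
apply: le_Rintegral => //; [exact: ipot|by apply: integrableZR; exact: irho|].
by move=> z _; rewrite mulrA ler_wpM2r// (potential_le p1 Phi_growth P0 dP).
Qed.

Lemma dual_rho_le u : V u -> dpot u <= Lambda * rho u.
Proof.
move=> Vu; rewrite /rho -RintegralZl//; last exact: irho.
apply: le_Rintegral => //; [exact: idpot|by apply: integrableZR; exact: irho|].
by move=> z _; rewrite mulrA ler_wpM2r//; have /andP[] := Phi_growth (T u z).
Qed.

Lemma potential_dual_le u : V u -> pot u <= Lambda ^+ 2 / p * dpot u.
Proof.
move=> Vu; rewrite /dpot -RintegralZl//; last exact: idpot.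
apply: le_Rintegral => //; [exact: ipot|by apply: integrableZR; exact: idpot|].
by move=> z _; rewrite mulrA ler_wpM2r// (potential_le_dual L1 p1 Phi_growth P0 dP).
Qed.

(** With a = 1 / (p Lambda), the potential is at least a r. The load takes a quarter of this plus
    its constant C, which a large r makes at most another quarter; small [lam] limits the power term
    to a third quarter. The last quarter is alpha. *)
Lemma energy_barrier : exists r alpha lam1 : R, [/\ 0 < r, 0 < alpha, 0 < lam1 &
  forall lam u, 0 < lam < lam1 -> V u -> rho u = r -> alpha <= energy lam u].
Proof.
have pL0 : 0 < (p * Lambda)^-1 by rewrite invr_gt0 mulr_gt0.
have e0 : 0 < (p * Lambda)^-1 / 4 by rewrite divr_gt0.
have [C C0 HC] := load_le e0.
have [Cs Cs0 HS] := sobolev_rho.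
pose r := 4 * (p * Lambda) * C + 1.
have r0 : 0 < r by rewrite ltr_wpDl// !mulr_ge0// ltW.
pose B := Cs * (Lambda * r) `^ (q / p) / q + 1.
have B0 : 0 < B by rewrite ltr_wpDl// divr_ge0 ?(ltW q0)// mulr_ge0 ?powR_ge0// ltW.
exists r, ((p * Lambda)^-1 / 4 * r), ((p * Lambda)^-1 / 4 * r / B); split => //.
- exact: mulr_gt0.
- by rewrite divr_gt0// mulr_gt0.
move=> lam u /andP[lam0 lam1] Vu ur.
rewrite energyE//; have h1 := potential_rho_ge Vu; rewrite ur in h1.
have h2 := HC u Vu; rewrite ur in h2.
have h3 := ler_norm (load u).
have h4 : lam * (q^-1 * mass u) <= (p * Lambda)^-1 / 4 * r.
  rewrite ltr_pdivlMr// in lam1; apply: le_trans (ltW lam1).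
  rewrite ler_pM2l// /B; have := HS u Vu; rewrite ur => hm.
  rewrite mulrC; apply: (@le_trans _ _ (Cs * (Lambda * r) `^ (q / p) / q)).
    by rewrite ler_pM2r ?invr_gt0.
  by rewrite lerDl.
have h5 : C <= (p * Lambda)^-1 / 4 * r.
  rewrite /r mulrDr mulr1 (_ : (p * Lambda)^-1 / 4 * (4 * (p * Lambda) * C) = C).
    by rewrite lerDl ltW.
  by field; rewrite !gt_eqF.
move: h1 h2 h3 h4 h5; set a := (p * Lambda)^-1; set m := lam * _.
by move=> *; lra.
Qed.

(* The Ambrosetti-Rabinowitz estimate: bound [q * energy - denergy] below. *)
Lemma critical_bound : Lambda ^+ 2 < q / p -> exists A B : R, 0 <= A /\
  forall lam u (beta : R), V u -> denergy lam u u = 0 -> energy lam u <= beta ->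
    rho u <= A * beta + B.
Proof.
move=> Lqp.
(* Positivity of this coefficient of rho is exactly Lambda^2 < q / p. *)
pose k0 := q / (p * Lambda) - Lambda.
have k00 : 0 < k0.
  rewrite subr_gt0 ltr_pdivlMr ?mulr_gt0// mulrCA -expr2.
  by move: Lqp; rewrite ltr_pdivlMr// mulrC.
have q10 : 0 < q - 1 by rewrite subr_gt0.
(* The term (q - 1) load is absorbed by half of [k0 * rho u]. *)
have e0 : 0 < k0 / 2 / (q - 1) by rewrite !divr_gt0.
have [C C0 HC] := load_le e0.
exists (2 / k0 * q), (2 / k0 * ((q - 1) * C)); split.
  by rewrite mulr_ge0 ?(ltW q0)// divr_ge0// ltW.
move=> lam u beta Vu; rewrite denergyE energyE// => d0 Eb.
have h1 := potential_rho_ge Vu; have h2 := dual_rho_le Vu.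
have h3 := le_trans (ler_norm _) (HC u Vu).
have h4 : (q - 1) * load u <= k0 / 2 * rho u + (q - 1) * C.
  have -> : k0 / 2 * rho u + (q - 1) * C = (q - 1) * (k0 / 2 / (q - 1) * rho u + C).
    by field; rewrite gt_eqF.
  by rewrite ler_pM2l.
have h5 : q / (p * Lambda) * rho u <= q * pot u.
  by rewrite -mulrA ler_pM2l.
have h6 : q * (pot u - lam * (q^-1 * mass u) - load u) <= q * beta by rewrite ler_pM2l.
(* The factor q makes the power terms cancel, so the bound does not involve [lam]. *)
have h7 : q * (lam * (q^-1 * mass u)) = lam * mass u by field; rewrite gt_eqF.
have hk : k0 * rho u = q / (p * Lambda) * rho u - Lambda * rho u by rewrite mulrBl.
have hk2 : k0 / 2 * rho u = 2^-1 * (k0 * rho u) by ring.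
have h8 : k0 / 2 * rho u <= q * beta + (q - 1) * C.
  rewrite hk2 in h4 *; rewrite !mulrBr h7 in h6; rewrite [(q - 1) * load u]mulrBl mul1r in h4.
  by lra.
have -> : rho u = 2 / k0 * (k0 / 2 * rho u) by field; rewrite gt_eqF.
rewrite -(mulrA _ q beta) -mulrDr ler_pM2l// divr_gt0//.
Qed.

Lemma rhoZ c u : V u -> rho (fun x => c * u x) = `|c| `^ p * rho u.
Proof.
move=> Vu; rewrite /rho -RintegralZl//; last exact: irho.
apply: eq_Rintegral => z _; rewrite mulrA -powRM// -normrM.
by congr (`|_| `^ _ * _); rewrite /T; ring.
Qed.

Lemma massZ c u : V u -> mass (fun x => c * u x) = `|c| `^ q * mass u.
Proof.
move=> Vu; have [_ iq] := admissible_Lp q1 Vu.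
rewrite /mass -RintegralZl//.
by apply: eq_Rintegral => z _; rewrite mulrA -powRM// -normrM.
Qed.

Lemma loadZ c u : V u -> load (fun x => c * u x) = c * load u.
Proof.
move=> Vu; rewrite /load -RintegralZl//; last exact: iload.
by apply: eq_Rintegral => z _; rewrite mulrCA.
Qed.

Lemma rho_gt0 u : V u -> 0 < mass u -> 0 < rho u.
Proof.
move=> Vu m0; have [C C0 HC] := sobolev_rho.
rewrite lt_neqAle rho_ge0 andbT; apply/eqP => h.
have := HC u Vu; rewrite -h mulr0 powR0 ?mulr0; first by rewrite leNgt m0.
by rewrite gt_eqF// divr_gt0.
Qed.

Let energy_le lam u : V u ->
  energy lam u <= Lambda / p * rho u - lam * (q^-1 * mass u) + `|load u|.
Proof.
move=> Vu; rewrite energyE//; have := potential_rho_le Vu.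
by have := ler_norm (- load u); rewrite normrN; lra.
Qed.

(** For t >= 1 potential and load grow at most like t^p while the power term grows like t^q. The
    threshold depends on u only through a and m, which allows its use both on one ray and uniformly
    on the coefficient sphere of a span. *)
Lemma energy_neg lam (a m : R) : 0 < lam -> 0 <= a -> 0 < m ->
  exists2 t1 : R, 1 <= t1 & forall u (t : R), V u ->
    Lambda / p * rho u + `|load u| <= a -> m <= mass u -> t1 < t ->
    energy lam (fun x => t * u x) < 0.
Proof.
move=> lam0 a0 m0.
have qp0 : 0 < q - p by rewrite subr_gt0.
(* Beyond [x1], lam (m / q) t^q exceeds a t^p. *)
pose x1 := (a * q / (lam * m)) `^ (q - p)^-1.
have x10 : 0 <= x1 by exact: powR_ge0.
exists (1 + x1); first by rewrite lerDl.
move=> u t Vu ua mu1 tt1.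
have t1 : 1 <= t by move: x10 tt1; lra.
have t0 : 0 < t by exact: lt_le_trans t1.
apply: le_lt_trans (energy_le _ (admissibleZ t Vu)) _.
rewrite rhoZ// massZ// loadZ// normrM (gtr0_norm t0).
have tp : t <= t `^ p by rewrite -[leLHS]powRr1 ?(ltW t0)// ler_powR// ltW.
have tq : t `^ q = t `^ p * t `^ (q - p).
  by rewrite -powRD ?(gt_eqF t0) ?implybT//; congr (_ `^ _); ring.
have x1t : a < lam * (q^-1 * m) * t `^ (q - p).
  have : x1 `^ (q - p) < t `^ (q - p).
    by rewrite gt0_ltr_powR ?nnegrE ?(ltW t0)//; move: tt1; lra.
  rewrite /x1 -powRrM mulVf ?gt_eqF// powRr1; last first.
    by rewrite divr_ge0 ?mulr_ge0 ?(ltW q0) ?(ltW lam0) ?(ltW m0).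
  rewrite ltr_pdivrMr ?mulr_gt0// => h.
  rewrite -(ltr_pM2r q0); apply: lt_le_trans h _.
  by rewrite le_eqVlt; apply/orP; left; apply/eqP; field; rewrite gt_eqF.
have tp0 : 0 < t `^ p by exact: powR_gt0.
have h1 : t * `|load u| <= t `^ p * `|load u| by rewrite ler_wpM2r.
have h2 : t `^ p * a < t `^ p * (lam * (q^-1 * m) * t `^ (q - p)) by rewrite ltr_pM2l.
have h3 : t `^ p * (Lambda / p * rho u + `|load u|) <= t `^ p * a by rewrite ler_pM2l.
have h3' : t `^ p * (Lambda / p * rho u + `|load u|) =
  Lambda / p * (t `^ p * rho u) + t `^ p * `|load u| by ring.
have h4 : lam * (q^-1 * (t `^ p * t `^ (q - p) * m)) =
   t `^ p * (lam * (q^-1 * m) * t `^ (q - p)) by ring.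
have h5 : lam * (q^-1 * (t `^ p * t `^ (q - p) * m)) <=
    lam * (q^-1 * (t `^ p * t `^ (q - p) * mass u)).
  by rewrite !ler_wpM2l ?mulr_ge0 ?powR_ge0 ?invr_ge0 ?(ltW q0) ?(ltW lam0).
by rewrite tq; move: h1 h2 h3 h5; rewrite h3' h4; lra.
Qed.

Lemma energy_ray lam u (r : R) : 0 < lam -> V u -> 0 < mass u ->
  exists t0 beta : R, [/\ r < rho (fun x => t0 * u x), energy lam (fun x => t0 * u x) <= 0 &
    forall t, 0 <= t <= 1 -> energy lam (fun x => t * (t0 * u x)) <= beta].
Proof.
move=> lam0 Vu m0; have r0 := rho_gt0 Vu m0.
pose a := Lambda / p * rho u + `|load u|.
have a0 : 0 <= a by rewrite addr_ge0// mulr_ge0 ?(ltW r0)// divr_ge0// ltW.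
have [t1 t11 neg] := energy_neg lam0 a0 m0.
pose x2 := (`|r| / rho u) `^ p^-1.
have x20 : 0 <= x2 by exact: powR_ge0.
(* Exceeding [t1] makes the energy negative at the end point, exceeding [x2] puts it beyond the
   barrier. *)
pose t0 := t1 + 1 + x2.
have t0x : x2 < t0 by rewrite /t0; move: t11; lra.
have t00 : 0 < t0 by exact: le_lt_trans t0x.
have Vt t : V (fun x => t * u x) by exact: admissibleZ.
(* The power term only lowers the energy and is dropped; the other terms are at most this bound
   because t <= 1 <= t0. *)
exists t0, (t0 `^ p * a); split.
- rewrite rhoZ// gtr0_norm// -ltr_pdivrMr//.
  apply: (@le_lt_trans _ _ (`|r| / rho u)); first by rewrite ler_pM2r ?invr_gt0// ler_norm.
  have -> : `|r| / rho u = x2 `^ p.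
    by rewrite /x2 -powRrM mulVf ?gt_eqF// powRr1// divr_ge0// ltW.
  by rewrite gt0_ltr_powR ?nnegrE ?(ltW t00).
- by apply/ltW/neg => //; rewrite /t0; move: t11 x20; lra.
- move=> t /andP[tge0 tle1]; apply: le_trans (energy_le _ (admissibleZ t (Vt t0))) _.
  rewrite rhoZ// rhoZ// loadZ// loadZ// !normrM (gtr0_norm t00) (ger0_norm tge0).
  have t01 : 1 <= t0 by rewrite /t0; move: t11 x20; lra.
  have tp : t0 <= t0 `^ p by rewrite -[leLHS]powRr1 ?(ltW t00)// ler_powR// ltW.
  have tp1 : t `^ p <= 1.
    have -> : 1 = (1 : R) `^ p by rewrite powR1.
    by rewrite ge0_ler_powR ?nnegrE// ltW.
  have mm : 0 <= lam * (q^-1 * mass (fun x => t * (t0 * u x))).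
    by rewrite !mulr_ge0 ?invr_ge0 ?(ltW q0) ?(ltW lam0)// mass_ge0.
  have h1 : Lambda / p * (t `^ p * (t0 `^ p * rho u)) <= Lambda / p * (t0 `^ p * rho u).
    rewrite ler_wpM2l//; first by rewrite divr_ge0// ltW.
    by rewrite ler_piMl// mulr_ge0 ?powR_ge0// ltW.
  have h2 : t * (t0 * `|load u|) <= t0 `^ p * `|load u|.
    apply: (@le_trans _ _ (t0 * `|load u|)); last by rewrite ler_wpM2r.
    by rewrite ler_piMl// mulr_ge0// ltW.
  have h3 : t0 `^ p * a = Lambda / p * (t0 `^ p * rho u) + t0 `^ p * `|load u|.
    by rewrite /a; ring.
  by rewrite h3; move: h1 h2 mm; lra.
Qed.

Let functional_sum (F : (X -> R) -> R) :
  (forall u v, V u -> V v -> F (fun x => u x + v x) = F u + F v) ->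
  (forall c u, V u -> F (fun x => c * u x) = c * F u) ->
  forall n (psi : 'I_n -> X -> R) (c : 'rV[R]_n), (forall i, V (psi i)) ->
  F (lincomb psi c) = \sum_i c ord0 i * F (psi i).
Proof.
move=> FD FZ n psi c Vpsi; suff h (d : 'I_n -> R) :
  F (fun x => \sum_i d i * psi i x) = \sum_i d i * F (psi i) by exact: h.
elim: n psi Vpsi d {c} => [psi _ d|n IH psi Vpsi d].
  rewrite big_ord0; under eq_fun do rewrite big_ord0.
  by have := FZ 0 _ admissible0; rewrite !mul0r.
rewrite big_ord_recl -IH//; under eq_fun do rewrite big_ord_recl.
rewrite FD ?FZ//; first exact: admissibleZ.
exact: admissible_sum.
Qed.

Lemma loadD u v : V u -> V v -> load (fun x => u x + v x) = load u + load v.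
Proof.
move=> Vu Vv; rewrite /load -RintegralD//; [|exact: iload..].
by apply: eq_Rintegral => x _; rewrite mulrDr.
Qed.

Lemma denergyD lam u v w : V u -> V v -> V w ->
  denergy lam u (fun x => v x + w x) = denergy lam u v + denergy lam u w.
Proof.
move=> Vu Vv Vw; rewrite /denergy loadD//.
have -> : \int[mu2]_z (Phi (T u z) * T (fun x => v x + w x) z * kap z) =
    \int[mu2]_z (Phi (T u z) * T v z * kap z) + \int[mu2]_z (Phi (T u z) * T w z * kap z).
  rewrite -RintegralD//; [|exact: idpot..].
  by apply: eq_Rintegral => z _; rewrite /T; ring.
have -> : \int[mu]_x (g (u x) * (v x + w x) * one x) =
    \int[mu]_x (g (u x) * v x * one x) + \int[mu]_x (g (u x) * w x * one x).
  rewrite -RintegralD//; [|exact: idmass..].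
  by apply: eq_Rintegral => x _; ring.
by ring.
Qed.

Lemma denergyZ lam u c v : V u -> V v ->
  denergy lam u (fun x => c * v x) = c * denergy lam u v.
Proof.
move=> Vu Vv; rewrite /denergy loadZ//.
have -> : \int[mu2]_z (Phi (T u z) * T (fun x => c * v x) z * kap z) =
    c * \int[mu2]_z (Phi (T u z) * T v z * kap z).
  rewrite -RintegralZl//; last exact: idpot.
  by apply: eq_Rintegral => z _; rewrite /T; ring.
have -> : \int[mu]_x (g (u x) * (c * v x) * one x) =
    c * \int[mu]_x (g (u x) * v x * one x).
  rewrite -RintegralZl//; last exact: idmass.
  by apply: eq_Rintegral => x _; ring.
by ring.
Qed.

(** * Critical points on the span of finitely many admissible functions *)

Section galerkin.
Variables (n : nat) (psi : 'I_n -> X -> R).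
Hypothesis Vpsi : forall i, V (psi i).

Let Vlin (c : 'rV[R]_n) : V (lincomb psi c). Proof. exact: admissible_sum. Qed.

Let increment_lincomb c z : T (lincomb psi c) z = lincomb (fun i => T (psi i)) c z.
Proof. by rewrite /T /lincomb -sumrB; apply: eq_bigr => i _; rewrite mulrBr. Qed.

Lemma load_lincomb c : load (lincomb psi c) = \sum_i c ord0 i * load (psi i).
Proof. by apply: functional_sum => // *; [exact: loadD|exact: loadZ]. Qed.

Lemma denergy_lincomb lam u c : V u ->
  denergy lam u (lincomb psi c) = \sum_i c ord0 i * denergy lam u (psi i).
Proof. by move=> Vu; apply: functional_sum => // *; [exact: denergyD|exact: denergyZ]. Qed.

Let P_cont : continuous P.
Proof.
move=> t; apply: differentiable_continuous; apply/derivable1_diffP.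
by have [] := dP t.
Qed.

Let P_le (t : R) : `|P t| <= Lambda / p * `|t| `^ p.
Proof.
rewrite ger0_norm ?(potential_le p1 Phi_growth P0 dP)//.
apply: le_trans (potential_ge L1 p1 Phi_growth P0 dP t).
by rewrite mulr_ge0 ?powR_ge0// invr_ge0 mulr_ge0// ltW.
Qed.

Lemma rho_continuous : continuous (fun c => rho (lincomb psi c)).
Proof.
rewrite /rho; under eq_fun do under eq_Rintegral do rewrite increment_lincomb.
apply: (nemytskii_continuous mkap kap0 p1 (fun i => admissible_increment (Vpsi i))
  (norm_powR_continuous p1) (C := 1)) => t.
by rewrite mul1r ger0_norm// powR_ge0.
Qed.

Lemma mass_continuous : continuous (fun c => mass (lincomb psi c)).
Proof.
apply: (nemytskii_continuous mone one0 q1 (fun i => admissible_Lp q1 (Vpsi i))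
  (norm_powR_continuous q1) (C := 1)) => t.
by rewrite mul1r ger0_norm// powR_ge0.
Qed.

Let loadc : continuous (fun c => load (lincomb psi c)).
Proof.
rewrite (_ : (fun c => _) = fun c => lincomb (fun i (_ : X) => load (psi i)) c 0).
  exact: lincomb_continuous.
by apply/funext => c; rewrite load_lincomb.
Qed.

Let potc : continuous (fun c => \int[mu2]_z (P (T (lincomb psi c) z) * kap z)).
Proof.
under eq_fun do under eq_Rintegral do rewrite increment_lincomb.
exact: (nemytskii_continuous mkap kap0 p1 (fun i => admissible_increment (Vpsi i)) P_cont P_le).
Qed.

Let powc lam : continuous (fun c => lam * \int[mu]_x (G (lincomb psi c x) * one x)).
Proof.
under eq_fun do rewrite massE//.
move=> c; apply: (@continuousM _ _ (cst lam) (fun c => q^-1 * mass (lincomb psi c))).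
  exact: cst_continuous.
apply: (@continuousM _ _ (cst q^-1) (fun c => mass (lincomb psi c))).
  exact: cst_continuous.
exact: mass_continuous.
Qed.

Lemma energy_continuous lam : continuous (fun c => energy lam (lincomb psi c)).
Proof.
move=> c; apply: (@continuousB _ _ _
  (fun c => \int[mu2]_z (P (T (lincomb psi c) z) * kap z) -
     lam * \int[mu]_x (G (lincomb psi c x) * one x)) (fun c => load (lincomb psi c))); last exact: loadc.
apply: (@continuousB _ _ _ (fun c => \int[mu2]_z (P (T (lincomb psi c) z) * kap z))
  (fun c => lam * \int[mu]_x (G (lincomb psi c x) * one x))).
  exact: potc.
exact: powc.
Qed.

Let dpotc phi : V phi ->
  continuous (fun c => \int[mu2]_z (Phi (T (lincomb psi c) z) * T phi z * kap z)).
Proof.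
move=> Vphi; under eq_fun do under eq_Rintegral do rewrite increment_lincomb.
exact: (dnemytskii_continuous mkap kap0 p1 (fun i => admissible_increment (Vpsi i))
    Phi_cont (admissible_increment Vphi) Phi_le').
Qed.

Lemma denergy_continuous lam phi : V phi -> continuous (fun c => denergy lam (lincomb psi c) phi).
Proof.
move=> Vphi c; apply: (@continuousB _ _ _
  (fun c => \int[mu2]_z (Phi (T (lincomb psi c) z) * T phi z * kap z) -
     lam * \int[mu]_x (g (lincomb psi c x) * phi x * one x)) (cst (load phi))); last exact: cst_continuous.
apply: (@continuousB _ _ _ (fun c => \int[mu2]_z (Phi (T (lincomb psi c) z) * T phi z * kap z))
  (fun c => lam * \int[mu]_x (g (lincomb psi c x) * phi x * one x))).
  exact: dpotc.
apply: (@continuousM _ _ (cst lam) (fun c => \int[mu]_x (g (lincomb psi c x) * phi x * one x))).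
  exact: cst_continuous.
exact: (dnemytskii_continuous mone one0 q1 (fun i => admissible_Lp q1 (Vpsi i))
    g_cont (admissible_Lp q1 Vphi) g_le).
Qed.

Let gradient lam (c : 'rV[R]_n) : 'rV[R]_n :=
  \row_i denergy lam (lincomb psi c) (psi i).

Let gradient_continuous lam : continuous (gradient lam).
Proof.
rewrite (_ : gradient lam = fun c =>
    \sum_i denergy lam (lincomb psi c) (psi i) *: delta_mx ord0 i); last first.
  by apply/funext => c; rewrite [LHS]row_sum_delta; apply: eq_bigr => i _; rewrite mxE.
apply: continuous_big => [|i _ c].
  by move=> z; apply: cvgD; [exact: cvg_fst|exact: cvg_snd].
apply: (@continuousZ _ _ _ (fun c => denergy lam (lincomb psi c) (psi i)) (cst (delta_mx ord0 i))).
  exact: denergy_continuous.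
exact: cst_continuous.
Qed.

Let energy_deriv lam x h (t : R) :
  is_derive t 1 (fun t : R => energy lam (lincomb psi (x + t *: h)))
     (\sum_i gradient lam (x + t *: h) ord0 i * h ord0 i).
Proof.
have lE (r : R) : lincomb psi (x + r *: h) = fun y => lincomb psi x y + r * lincomb psi h y.
  apply/funext => y; rewrite /lincomb mulr_sumr -big_split/=.
  by apply: eq_bigr => i _; rewrite !mxE mulrDl mulrA.
have -> : \sum_i gradient lam (x + t *: h) ord0 i * h ord0 i =
    denergy lam (fun y => lincomb psi x y + t * lincomb psi h y) (lincomb psi h).
  rewrite -lE denergy_lincomb//; apply: eq_bigr => i _.
  by rewrite mulrC mxE.
under eq_fun do rewrite lE.
exact: energy_is_derive.
Qed.

Hypothesis indep : forall c, mass (lincomb psi c) = 0 -> c = 0.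

Let lincombZ (t : R) c : lincomb psi (t *: c) = fun x => t * lincomb psi c x.
Proof.
by apply/funext => x; rewrite /lincomb mulr_sumr; apply: eq_bigr => i _; rewrite mxE mulrA.
Qed.

(** On the compact coefficient sphere the mass has a minimum, positive by [indep], and potential
    bound and load have a maximum; [energy_neg] then makes the energy negative outside a fixed
    ball. *)
Let energy_bounded lam beta : 0 < lam ->
  bounded_set [set c | 0 <= energy lam (lincomb psi c) <= beta].
Proof.
move=> lam0.
(* An empty sphere leaves only the coefficient vector 0, since any other could be normalised. *)
have [S0|S0] := pselect ([set c : 'rV[R]_n | `|c| = 1] !=set0); last first.
  exists 0; split => // M M0 c _ /=.
  have [->|c0] := eqVneq c 0; first by rewrite normr0 ltW.
  exfalso; apply: S0; exists (`|c|^-1 *: c).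
  by rewrite /= normrZ normfV normr_id mulVf// normr_eq0.
have cS : compact [set c : 'rV[R]_n | `|c| = 1].
  apply: bounded_closed_compact.
    by exists 1; split => // M M1 c /= ->; rewrite ltW.
  apply: (@closed_comp _ _ (fun c : 'rV[R]_n => `|c|) [set 1]); last exact: closed_eq.
  by move=> c _; exact: norm_continuous.
have [c1 c1S hc1] := EVT_min_rV S0 cS (continuous_subspaceT mass_continuous).
pose h c := Lambda / p * rho (lincomb psi c) + `|load (lincomb psi c)|.
have ch : continuous h.
  move=> c; apply: (@continuousD _ _ _ (fun c => Lambda / p * rho (lincomb psi c))
    (fun c => `|load (lincomb psi c)|)).
    apply: (@continuousM _ _ (cst (Lambda / p)) (fun c => rho (lincomb psi c))).
      exact: cst_continuous.
    exact: rho_continuous.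
  apply: (@continuous_comp _ _ _ (fun c => load (lincomb psi c)) (@Num.norm _ R)).
    exact: loadc.
  exact: norm_continuous.
have [c2 c2S hc2] := EVT_max_rV S0 cS (continuous_subspaceT ch).
have m0 : 0 < mass (lincomb psi c1).
  rewrite lt_neqAle mass_ge0 andbT eq_sym; apply/eqP => /indep c10.
  by move: c1S; rewrite inE/= c10 normr0 => /esym/eqP; rewrite oner_eq0.
have a0 : 0 <= h c2.
  by rewrite addr_ge0// mulr_ge0 ?rho_ge0// divr_ge0// ltW.
have [t1 t11 neg] := energy_neg lam0 a0 m0.
exists t1; split; first exact: num_real.
move=> M t1M c /= /andP[E0 _]; rewrite leNgt; apply/negP => Mc.
have c0 : 0 < `|c| by apply: lt_trans Mc; apply: lt_trans t1M; exact: lt_le_trans t11.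
pose c' := `|c|^-1 *: c.
have c'S : c' \in [set c : 'rV[R]_n | `|c| = 1].
  by rewrite inE /= /c' normrZ normfV normr_id mulVf// gt_eqF.
have cE : c = `|c| *: c' by rewrite scalerA divff ?gt_eqF// scale1r.
have := neg _ `|c| (Vlin c') (hc2 _ c'S) (hc1 _ c'S) (lt_trans t1M Mc).
by rewrite -lincombZ -cE ltNge E0.
Qed.

Lemma galerkin lam (e : 'rV[R]_n) (r alpha beta : R) : 0 < lam -> 0 < r -> 0 < alpha ->
  (forall u, V u -> rho u = r -> alpha <= energy lam u) ->
  r < rho (lincomb psi e) -> energy lam (lincomb psi e) <= 0 ->
  (forall t, 0 <= t <= 1 -> energy lam (fun x => t * lincomb psi e x) <= beta) ->
  exists2 c, (forall i, denergy lam (lincomb psi c) (psi i) = 0) &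
    alpha <= energy lam (lincomb psi c) <= beta.
Proof.
move=> lam0 r0 alpha0 barrier re Ee Ebeta.
(* Written as a multiple of the zero function so that the homogeneity lemmas apply. *)
have lin0 : lincomb psi 0 = fun x => 0 * 0.
  by apply/funext => x; rewrite /lincomb mul0r big1// => i _; rewrite mxE mul0r.
have rho0 : rho (lincomb psi 0) = 0.
  by rewrite lin0 (rhoZ _ admissible0) normr0 powR0 ?mul0r// gt_eqF.
have E0 : energy lam (lincomb psi 0) = 0.
  rewrite energyE//.
  have -> : pot (lincomb psi 0) = 0.
    rewrite /pot lin0 /Rintegral integral0_eq// => z _.
    by rewrite /T subrr P0 mul0r.
  rewrite lin0 (massZ _ admissible0) (loadZ _ admissible0) normr0 powR0 ?gt_eqF//.
  by rewrite !mul0r !mulr0 !subr0.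
have [|||c Dc Ec] := mountain_pass_rV (e := e) (r := r) (@energy_continuous lam) (@gradient_continuous lam)
  (@energy_deriv lam) (@energy_bounded lam beta lam0) rho_continuous _ alpha0 _ E0 Ee.
- by rewrite rho0 r0.
- by move=> c; exact: barrier.
- by move=> t t01; rewrite lincombZ; exact: Ebeta.
exists c => // i.
by have := congr1 (fun v : 'rV[R]_n => v ord0 i) Dc; rewrite !mxE.
Qed.

End galerkin.

Lemma mass_eq0 u : V u -> mass u = 0 -> {ae mu, forall x, u x = 0}.
Proof.
move=> Vu m0; have [_ iq] := admissible_Lp q1 Vu.
have := Rintegral0_ae iq (fun x => mulr_ge0 (powR_ge0 _ _) (one0 x)) m0.
apply: filterS => x /eqP; rewrite /one mulr1 powR_eq0 normr_eq0.
by move=> /andP[/eqP].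
Qed.

Lemma ae0_mass u : {ae mu, forall x, u x = 0} -> mass u = 0.
Proof.
move=> u0; rewrite /mass (@ae_eq_Rintegral _ _ _ _ _ (fun=> 0)).
  by rewrite /Rintegral integral0.
by apply: filterS u0 => x ->; rewrite normr0 powR0 ?mul0r// gt_eqF.
Qed.

Lemma denergy_ae lam u v w : {ae mu, forall x, v x = w x} ->
  denergy lam u v = denergy lam u w.
Proof.
move=> vw; rewrite /denergy /load; congr (_ - _ * _ - _); apply: ae_eq_Rintegral.
- apply: filterS2 (ae_prod_fst mu vw) (ae_prod_snd mu vw) => z.
  by rewrite /T => -> ->.
- by apply: filterS vw => x ->.
- by apply: filterS vw => x ->.
Qed.

(** Greedy selection modulo null sets: a function is added only if it is not a.e. a combination of
    the earlier ones. Starting from [e0] keeps the fixed ray inside every span. *)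
Lemma independent_family e0 (l : seq (X -> R)) : V e0 -> 0 < mass e0 ->
  (forall v, List.In v l -> V v) ->
  exists n (psi : 'I_n.+1 -> X -> R), [/\ psi ord0 = e0, forall i, V (psi i),
    forall c, mass (lincomb psi c) = 0 -> c = 0 &
    forall v, List.In v l -> exists c, {ae mu, forall x, v x = lincomb psi c x}].
Proof.
move=> Ve0 m0; elim: l => [_|a l IH Vl].
  exists 0%N, (fun=> e0); split => // c.
  have -> : lincomb (fun _ : 'I_1 => e0) c = fun x => c ord0 ord0 * e0 x.
    by apply/funext => x; rewrite /lincomb big_ord1.
  rewrite massZ// => /eqP; rewrite mulf_eq0 (gt_eqF m0) orbF powR_eq0 normr_eq0.
  by move=> /andP[/eqP c0 _]; apply/rowP => i; rewrite ord1 c0 mxE.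
have [|n [psi [psi0 Vpsi indep span]]] := IH; first by move=> v vl; apply: Vl; right.
have Va : V a by apply: Vl; left.
have [[c ac]|na] := pselect (exists c, {ae mu, forall x, a x = lincomb psi c x}).
  exists n, psi; split => // v [<-|/span//]; by exists c.
pose psi' (i : 'I_n.+2) := if unlift ord_max i is Some j then psi j else a.
have psi'l j : psi' (lift ord_max j) = psi j by rewrite /psi' liftK.
have psi'm : psi' ord_max = a by rewrite /psi' unlift_none.
have Vpsi' i : V (psi' i) by rewrite /psi'; case: unlift.
have split' (c : 'rV[R]_n.+2) x : lincomb psi' c x =
    lincomb psi (\row_j c ord0 (lift ord_max j)) x + c ord0 ord_max * a x.
  rewrite /lincomb big_ord_recr/= psi'm; congr (_ + _).
  apply: eq_bigr => j _; rewrite mxE.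
  have -> : widen_ord (leqnSn n.+1) j = lift ord_max j.
    by apply: val_inj; rewrite /= /bump leqNgt ltn_ord.
  by rewrite psi'l.
exists n.+1, psi'; split => //.
- have -> : ord0 = lift ord_max ord0 :> 'I_n.+2 by exact: val_inj.
  by rewrite psi'l.
- move=> c mc; have ae0 := mass_eq0 (admissible_sum _ Vpsi') mc.
  pose c' : 'rV[R]_n.+1 := \row_j c ord0 (lift ord_max j).
  have cm0 : c ord0 ord_max = 0.
    apply: contrapT => /eqP cm; apply: na; exists (- (c ord0 ord_max)^-1 *: c').
    apply: filterS ae0 => x; rewrite -[\sum_i _]/(lincomb psi' c x) split' -/c' => h.
    have -> : lincomb psi (- (c ord0 ord_max)^-1 *: c') x =
        - (c ord0 ord_max)^-1 * lincomb psi c' x.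
      by rewrite /lincomb mulr_sumr; apply: eq_bigr => i _; rewrite mxE mulrA.
    have -> : lincomb psi c' x = - (c ord0 ord_max * a x) by apply/eqP; rewrite -addr_eq0 h.
    by rewrite mulrNN mulrA mulVf// mul1r.
  have c'0 : c' = 0.
    apply: indep; apply: ae0_mass; apply: filterS ae0 => x.
    by rewrite -[\sum_i _]/(lincomb psi' c x) split' cm0 mul0r addr0.
  apply/rowP => i; rewrite mxE; case: (unliftP ord_max i) => [j ->|->//].
  by have := congr1 (fun v : 'rV[R]_n.+1 => v ord0 j) c'0; rewrite !mxE.
- move=> v [<-|/span[c vc]].
    exists (delta_mx ord0 ord_max); apply: filterE => x.
    rewrite split' mxE !eqxx mul1r /lincomb big1 ?add0r// => j _.
    by rewrite !mxE eqxx/= eq_sym (negbTE (neq_lift _ _)) mul0r.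
  exists (\row_i if unlift ord_max i is Some j then c ord0 j else 0).
  apply: filterS vc => x ->; rewrite split' mxE unlift_none mul0r addr0.
  by congr (lincomb _ _ _); apply/rowP => j; rewrite !mxE liftK.
Qed.

(** [beta] is chosen before the list, from the ray through [e0] alone. The equation tested with u
    itself holds because u lies in the span. *)
Lemma galerkin_solutions lam e0 (r alpha : R) : 0 < lam -> 0 < r -> 0 < alpha ->
  (forall u, V u -> rho u = r -> alpha <= energy lam u) -> V e0 -> 0 < mass e0 ->
  exists beta : R, forall l : seq (X -> R), (forall v, List.In v l -> V v) ->
    exists u, [/\ V u, forall v, List.In v l -> denergy lam u v = 0,
      denergy lam u u = 0 & alpha <= energy lam u <= beta].
Proof.
move=> lam0 r0 alpha0 barrier Ve0 m0.
have [t0 [beta [rt Et Ebeta]]] := energy_ray r lam0 Ve0 m0.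
exists beta => l Vl; have [n [psi [psi0 Vpsi indep span]]] := independent_family Ve0 m0 Vl.
have te : lincomb psi (t0 *: delta_mx ord0 ord0) = fun x => t0 * e0 x.
  apply/funext => x; rewrite /lincomb big_ord_recl big1 ?addr0 => [|j _].
    by rewrite !mxE !eqxx mulr1 psi0.
  by rewrite !mxE mulr0 mul0r.
have [|||c Dc Ec] := galerkin Vpsi indep (e := t0 *: delta_mx ord0 ord0) (beta := beta)
  lam0 r0 alpha0 barrier.
- by rewrite te.
- by rewrite te.
- by move=> t t01; rewrite te; exact: Ebeta.
have Vu : V (lincomb psi c) by exact: admissible_sum.
have lin0 c' : denergy lam (lincomb psi c) (lincomb psi c') = 0.
  by rewrite denergy_lincomb// big1// => i _; rewrite Dc mulr0.
exists (lincomb psi c); split => // v /span[c' vc'].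
by rewrite (denergy_ae _ _ vc').
Qed.

(** * Passage to the limit along sequences of bounded seminorm *)

Section weak_limit.
Variables (w : nat -> X -> R) (u : X -> R) (M : R).
Hypotheses (Vw : forall n, V (w n)) (wM : forall n, rho (w n) <= M).
Hypotheses (mu_ : measurable_fun setT u) (wu : {ae mu, forall x, w ^~ x @ \oo --> u x}).

Let mw n : measurable_fun setT (w n). Proof. exact: admissible_measurable. Qed.

Let mTw n : measurable_fun setT (T (w n)). Proof. exact: measurable_increment. Qed.

Let increment_cvg : {ae mu2, forall z, (fun n => T (w n) z) @ \oo --> T u z}.
Proof.
by apply: filterS2 (ae_prod_fst mu wu) (ae_prod_snd mu wu) => z c1 c2; exact: cvgB.
Qed.

Let M0 : 0 <= M. Proof. by apply: le_trans (wM 0%N); exact: rho_ge0. Qed.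

Lemma limit_vanishes : {ae mu, forall x, ~ Omega x -> u x = 0}.
Proof.
apply: filterS wu => x cx nx.
have w0 : w ^~ x = fun=> 0 by apply/funext => n; have [_ ->] := Vw n.
by move: cx; rewrite w0 => /cvg_lim <-//; rewrite lim_cst.
Qed.

Let poincare_w n :
  (\int[mu]_x (`|w n x| `^ p)%:E <= (poincare_cst N s p b * (Lambda * M))%:E)%E.
Proof.
apply: le_trans (poincare_rho (Vw n)) _; rewrite lee_fin.
by rewrite ler_wpM2l ?poincare_cst_ge0// ler_pM2l.
Qed.

Lemma limit_Lp : (\int[mu]_x (`|u x| `^ p)%:E < +oo)%E.
Proof.
apply: (@le_lt_trans _ _ (poincare_cst N s p b * (Lambda * M))%:E); last exact: ltry.
apply: (@fatou_ae _ _ _ mu (fun n x => `|w n x| `^ p)) => //.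
- by move=> n; exact: measurable_norm_powR.
- exact: measurable_norm_powR.
- apply: filterS wu => x cx.
  exact: (@continuous_cvg _ _ _ _ _ (fun n => w n x) (fun t => `|t| `^ p) (u x) (@norm_powR_continuous _ _ p1 _) cx).
Qed.

Lemma limit_seminorm : (seminorm s p u < +oo)%E.
Proof.
apply: (@le_lt_trans _ _ (Lambda * M)%:E); last exact: ltry.
apply: (@fatou_ae _ _ _ mu2 (fun n => seminorm_density s p (w n))) => //.
- by move=> n; exact: measurable_seminorm_density.
- exact: measurable_seminorm_density.
- by move=> n z; exact: seminorm_density_ge0.
- apply: filterS increment_cvg => z cz; apply: cvgMl.
  exact: (@continuous_cvg _ _ _ _ _ (fun n => T (w n) z) (fun t => `|t| `^ p) (T u z) (@norm_powR_continuous _ _ p1 _) cz).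
- move=> n; apply: le_trans (seminorm_le_rho (Vw n)) _.
  by rewrite lee_fin ler_pM2l.
Qed.

Let dpot_cvg v : V v ->
  \int[mu2]_z (Phi (T (w n) z) * T v z * kap z) @[n --> \oo] -->
  \int[mu2]_z (Phi (T u z) * T v z * kap z).
Proof.
move=> Vv; have [mTv iTv] := admissible_increment Vv.
have mPhi (h : X * X -> R) : measurable_fun setT h ->
    measurable_fun setT (fun z => Phi (h z) * T v z * kap z).
  move=> mh; apply: measurable_funM => //; apply: measurable_funM => //.
  by apply: measurableT_comp => //; exact: continuous_measurable_fun.
apply: (cvg_Rintegral_unif (A_ := fun n z => `|T (w n) z| `^ p * kap z) (M := M) _ _ _ _ _ _ _).2.
- by move=> n; exact: mPhi.
- by apply: mPhi; exact: measurable_increment.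
- by move=> n; apply: measurable_norm_powRk.
- by move=> n z; rewrite mulr_ge0 ?powR_ge0.
- by move=> n; rewrite -RintegralE ?lee_fin; [exact: wM|exact: irho].
- apply: filterS increment_cvg => z cz; apply: cvgMl; apply: cvgMl.
  exact: (@continuous_cvg _ _ _ _ _ (fun n => T (w n) z) Phi (T u z) (@Phi_cont _) cz).
(* Dividing by [Lambda] compensates the constant in the growth of [Phi]. *)
- move=> e e0; have e'0 : 0 < e / Lambda by rewrite divr_gt0.
  exists (fun z => Lambda * (e / Lambda) `^ (1 - p) * (`|T v z| `^ p * kap z)).
    exact: integrableZR.
  move=> n z; rewrite !normrM (ger0_norm (kap0 z)) !mulrA -mulrDl ler_wpM2r//.
  apply: (@le_trans _ _ (Lambda * (`|T (w n) z| `^ (p - 1) * `|T v z|))).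
    by rewrite mulrA ler_wpM2r.
  have := young_powR p1 e'0 (normr_ge0 (T (w n) z)) (normr_ge0 (T v z)).
  rewrite -(ler_pM2l L0) mulrDr !mulrA => /le_trans; apply.
  by rewrite [Lambda * e]mulrC mulfK ?gt_eqF.
Qed.

Let mass_bounded : exists M2 : R, forall n, mass (w n) <= M2.
Proof.
have [C C0 HC] := sobolev_rho; exists (C * (Lambda * M) `^ (q / p)) => n.
apply: le_trans (HC _ (Vw n)) _; rewrite ler_pM2l//.
apply: ge0_ler_powR; rewrite ?nnegrE.
- by rewrite divr_ge0// ltW.
- by rewrite mulr_ge0 ?rho_ge0// ltW.
- by rewrite mulr_ge0// ltW.
- by rewrite ler_pM2l.
Qed.

Let dmass_cvg v : V v ->
  \int[mu]_x (g (w n x) * v x * one x) @[n --> \oo] --> \int[mu]_x (g (u x) * v x * one x).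
Proof.
move=> Vv; have [mv iv] := admissible_Lp q1 Vv; have [M2 wM2] := mass_bounded.
have mg (h : X -> R) : measurable_fun setT h ->
    measurable_fun setT (fun x => g (h x) * v x * one x).
  move=> mh; apply: measurable_funM => //; apply: measurable_funM => //.
  by apply: measurableT_comp => //; exact: continuous_measurable_fun.
apply: (cvg_Rintegral_unif (A_ := fun n x => `|w n x| `^ q * one x) (M := M2) _ _ _ _ _ _ _).2.
- by move=> n; exact: mg.
- exact: mg.
- by move=> n; apply: measurable_norm_powRk.
- by move=> n z; rewrite mulr_ge0 ?powR_ge0.
- by move=> n; rewrite -RintegralE ?lee_fin; [exact: wM2|case: (admissible_Lp q1 (Vw n))].
- apply: filterS wu => z cz; apply: cvgMl; apply: cvgMl.
  exact: (@continuous_cvg _ _ _ _ _ (fun n => w n z) g (u z) (@g_cont _) cz).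
- move=> e e0; exists (fun x => e `^ (1 - q) * (`|v x| `^ q * one x)).
    exact: integrableZR.
  move=> n x; rewrite normrM (ger0_norm (one0 x)) [X in X * _]normrM norm_sgn_powR//.
  rewrite !mulrA -mulrDl ler_wpM2r//.
  exact: (young_powR q1 e0 (normr_ge0 (w n x)) (normr_ge0 (v x))).
Qed.

Lemma denergy_cvg lam v : V v -> denergy lam (w n) v @[n --> \oo] --> denergy lam u v.
Proof.
move=> Vv; apply: cvgB; last exact: cvg_cst.
by apply: cvgB; [exact: dpot_cvg|apply: cvgMr; exact: dmass_cvg].
Qed.

Lemma load_cvg : load (w n) @[n --> \oo] --> load u.
Proof.
apply: (cvg_Rintegral_unif (A_ := fun n x => `|w n x| `^ p)
  (M := poincare_cst N s p b * (Lambda * M)) _ _ _ _ _ _ _).2.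
- by move=> n; exact: measurable_funM.
- exact: measurable_funM.
- by move=> n; exact: measurable_norm_powR.
- by move=> n x; exact: powR_ge0.
- exact: poincare_w.
- by apply: filterS wu => x cx; exact: cvgMr.
- move=> e e0; have [C C0 HC] := load_density e0.
  exists (fun x => C * `|f0 x| `^ (p / (p - 1))); first exact: integrableZR.
  by move=> n x; exact: HC.
Qed.

Lemma limit_nontrivial lam alpha : 0 < alpha -> (forall n, alpha <= energy lam (w n)) ->
  (forall n, denergy lam (w n) (w n) = 0) -> Lq_dist q (w n) u @[n --> \oo] --> 0%E ->
  nontrivial u.
Proof.
move=> alpha0 Ew dw wq u0.
have mass0 : mass (w n) @[n --> \oo] --> 0.
  have E n : Lq_dist q (w n) u = (mass (w n))%:E.
    have [_ iq] := admissible_Lp q1 (Vw n).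
    rewrite /mass RintegralE//; apply: ae_eq_integral_nonmeasurable.
    by apply: filterS u0 => x ->; rewrite subr0 /one mulr1.
  have := wq; under eq_fun do rewrite E.
  by move/fine_cvgP => [_].
have load0 : load (w n) @[n --> \oo] --> 0.
  have -> : 0 = load u; last exact: load_cvg.
  rewrite /load (@ae_eq_Rintegral _ _ _ _ _ (fun=> 0)); first by rewrite /Rintegral integral0.
  by apply: filterS u0 => x ->; rewrite mulr0.
(* The vanishing of I'(w n)(w n) turns the dual potential into lam mass + load, so this upper bound
   of the energy contains only quantities that tend to 0. *)
pose h n := Lambda ^+ 2 / p * (lam * mass (w n) + load (w n)) -
  lam * (q^-1 * mass (w n)) - load (w n).
have h0 : h n @[n --> \oo] --> 0.
  have -> : 0 = Lambda ^+ 2 / p * (lam * 0 + 0) - lam * (q^-1 * 0) - 0 :> R by ring.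
  apply: cvgB => //; apply: cvgB; apply: cvgMr; last exact: cvgMr.
  by apply: cvgD => //; exact: cvgMr.
have hE n : alpha <= h n.
  apply: le_trans (Ew n) _; rewrite energyE// /h lerB// lerB//.
  apply: le_trans (potential_dual_le (Vw n)) _.
  have := dw n; rewrite denergyE => dn.
  rewrite le_eqVlt; apply/orP; left; apply/eqP; congr (_ * _).
  by move: dn; lra.
have /filter_ex[n] : \forall n \near \oo, h n < alpha by move/cvgr_lt: h0; apply.
by rewrite ltNge hE.
Qed.

End weak_limit.

(** Compactness is applied with the admissible functions themselves as index set, the set of index v
    recording the equation tested with v. Each equation is passed to the limit along its own
    sequence, and all sequences share the limit u. *)
Theorem energy_critical_point lam alpha M : 0 < alpha ->
  (forall l : seq (X -> R), (forall v, List.In v l -> V v) ->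
    exists u, [/\ V u, forall v, List.In v l -> denergy lam u v = 0,
      denergy lam u u = 0, alpha <= energy lam u & rho u <= M]) ->
  exists u, [/\ measurable_fun setT u, (\int[mu]_x (`|u x| `^ p)%:E < +oo)%E,
    (seminorm s p u < +oo)%E, {ae mu, forall x, ~ Omega x -> u x = 0} &
    nontrivial u /\ forall v, V v -> denergy lam u v = 0].
Proof.
move=> alpha0 Hl.
have M0 : 0 <= M.
  have [|u [_ _ _ _]] := Hl [::]; first by [].
  by apply: le_trans; exact: rho_ge0.
have LM0 : 0 <= Lambda * M by rewrite mulr_ge0// ltW.
pose A (v : {v : X -> R | V v}) := [set u : X -> R | [/\ V u, denergy lam u (sval v) = 0,
  denergy lam u u = 0, alpha <= energy lam u & rho u <= M]].
have [|u [mu_ Hu]] := seminorm_ball_compact N0 s0 p1 pq b0 LM0 subcrit (A := A).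
  move=> l; have [|u [Vu ul uu Eu uM]] := Hl (List.map sval l).
    by move=> v /List.in_map_iff[[v' Vv'] [<- _]].
  exists u; split.
    have [cu iu uo us] := seminormball Vu; split => //.
    by apply: le_trans us _; rewrite lee_fin ler_pM2l.
  by move=> v vl; split => //; apply: ul; exact: List.in_map.
(* Nontriviality concerns u alone, so any index serves; the zero function is one. *)
have [w [wA wu wq]] := Hu (exist V _ admissible0).
have Vw n : V (w n) by have [_ []] := wA n.
have wM n : rho (w n) <= M by have [_ []] := wA n.
exists u; split => //.
- exact: limit_Lp Vw wM mu_ wu.
- exact: limit_seminorm Vw wM mu_ wu.
- exact: limit_vanishes Vw wu.
- split.
    apply: (limit_nontrivial Vw wM mu_ wu alpha0 (lam := lam)) => // n.
      by have [_ []] := wA n.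
    by have [_ []] := wA n.
  move=> v Vv; have [w' [wA' wu' _]] := Hu (exist V v Vv).
  have Vw' n : V (w' n) by have [_ []] := wA' n.
  have wM' n : rho (w' n) <= M by have [_ []] := wA' n.
  have := denergy_cvg Vw' wM' mu_ wu' (lam := lam) Vv.
  have -> : (fun n => denergy lam (w' n) v) = fun=> 0.
    by apply/funext => n; have [_ []] := wA' n.
  by move=> /cvg_lim <-//; rewrite lim_cst.
Qed.

Theorem energy_solutions : Lambda ^+ 2 < q / p ->
  (exists2 e0, V e0 & ~ {ae mu, forall x, e0 x = 0}) ->
  exists2 lam1 : R, 0 < lam1 & forall lam, 0 < lam < lam1 ->
  exists u, [/\ measurable_fun setT u, (\int[mu]_x (`|u x| `^ p)%:E < +oo)%E,
    (seminorm s p u < +oo)%E, {ae mu, forall x, ~ Omega x -> u x = 0} &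
    nontrivial u /\ forall phi, V phi ->
      \int[mu2]_z (Phi (u z.1 - u z.2) * (phi z.1 - phi z.2) * kap z) =
      lam * \int[mu]_x (`|u x| `^ (q - 2) * u x * phi x) + \int[mu]_x (f0 x * phi x)].
Proof.
move=> Lqp [e0 Ve0 ne0]; have [r [alpha [lam1 [r0 alpha0 lam10 barrier]]]] := energy_barrier.
exists lam1 => // lam lam01.
have lam0 : 0 < lam by have /andP[] := lam01.
have me0 : 0 < mass e0.
  by rewrite lt_neqAle mass_ge0 andbT; apply/eqP => /esym/(mass_eq0 Ve0).
have [beta Hbeta] := galerkin_solutions lam0 r0 alpha0 (fun u => barrier lam u lam01) Ve0 me0.
have [A [B [A0 HAB]]] := critical_bound Lqp.
have [|u [mu_ up us uO [unt ueq]]] := @energy_critical_point lam alpha (A * beta + B) alpha0.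
  move=> l /Hbeta[u [Vu ul uu /andP[Eu1 Eu2]]]; exists u; split => //.
  exact: HAB Vu uu Eu2.
exists u; split => //; split => // phi Vphi.
have := ueq phi Vphi; rewrite /denergy /one.
under [X in _ - lam * X - _]eq_Rintegral do rewrite mulr1.
by move=> /eqP; rewrite -addrA -opprD subr_eq0 => /eqP.
Qed.

End energy.

(** * Test functions and the kernel *)

Section test_functions.
Context (R : realType) (N : nat) (Omega : set 'rV[R]_N).
Local Notation X := 'rV[R]_N.
Implicit Types (phi : X -> R).

Lemma support_outE phi x : ~ support_of phi x -> phi x = 0.
Proof. by move=> nx; apply: contrapT => /eqP x0; apply: nx; exact: subset_closure. Qed.

Lemma test_function_out phi : test_function Omega phi -> forall x, ~ Omega x -> phi x = 0.
Proof. by move=> [_ _ sub] x nx; apply: support_outE => /sub. Qed.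

Lemma is_derive_line phi (x v : X) (t : R) : derivable phi (x + t *: v) v ->
  is_derive t 1 (fun r : R => phi (x + r *: v)) ('D_v phi (x + t *: v)).
Proof.
move=> dphi.
have E : (fun h : R => h^-1 *: ((fun r : R => phi (x + r *: v)) (h *: 1 + t) - phi (x + t *: v))) =
    (fun h : R => h^-1 *: (phi (h *: v + (x + t *: v)) - phi (x + t *: v))).
  apply/funext => h; congr (_ *: (phi _ - _)).
  by rewrite [h *: 1]mulr1 scalerDl addrCA.
by apply: DeriveDef; [rewrite /derivable E|rewrite /derive E].
Qed.

Lemma partial_bounded phi (i : 'I_N) : smooth phi -> compact (support_of phi) ->
  exists2 C : R, 0 <= C & forall x, `|'D_(delta_mx ord0 i) phi x| <= C.
Proof.
move=> sm cpt; have cD : continuous ('D_(delta_mx ord0 i) phi) by have [] := sm [:: i].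
have [M [Mreal HM]] := compact_bounded (continuous_compact (continuous_subspaceT cD) cpt).
exists (`|M| + 1); first by rewrite addr_ge0.
move=> x; have [xs|nx] := pselect (support_of phi x).
  apply: HM; last by exists x.
  by rewrite (le_lt_trans (real_ler_norm Mreal))// ltrDl.
have -> : 'D_(delta_mx ord0 i) phi x = 0; last by rewrite normr0 addr_ge0.
rewrite (@near_eq_derive _ _ _ _ (cst 0)) ?derive_cst//.
have : nbhs x (~` support_of phi).
  by apply: open_nbhs_nbhs; split => //; apply: closed_openC; exact: closed_closure.
by apply: filterS => y; exact: support_outE.
Qed.

Lemma coordinate_lipschitz phi (i : 'I_N) (C : R) : smooth phi ->
  (forall x, `|'D_(delta_mx ord0 i) phi x| <= C) ->
  forall x (t : R), `|phi (x + t *: delta_mx ord0 i) - phi x| <= C * `|t|.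
Proof.
move=> sm DC x t; have [_ dphi] := sm [::].
have dl (r : R) := is_derive_line (dphi (x + r *: delta_mx ord0 i) i).
have cl : continuous (fun r : R => phi (x + r *: delta_mx ord0 i)).
  move=> r; apply: differentiable_continuous; apply/derivable1_diffP.
  by have [] := dl r.
have phi0 : phi x = phi (x + 0 *: delta_mx ord0 i) by rewrite scale0r addr0.
have [t0|t0] := leP 0 t.
  have [c _] := MVT_segment t0 (fun r _ => dl r) (continuous_subspaceT cl).
  rewrite phi0 => ->; rewrite subr0 normrM ler_wpM2r//; exact: DC.
have [c _] := MVT_segment (ltW t0) (fun r _ => dl r) (continuous_subspaceT cl).
rewrite distrC phi0 => ->; rewrite sub0r normrM normrN ler_wpM2r//; exact: DC.
Qed.

Lemma test_function_lipschitz phi : test_function Omega phi ->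
  exists2 L : R, 0 <= L & forall x y, `|phi x - phi y| <= L * `|x - y|.
Proof.
move=> [sm cpt _].
have /choice[C HC] : forall i : 'I_N, exists C : R, 0 <= C /\
    forall x, `|'D_(delta_mx ord0 i) phi x| <= C.
  by move=> i; have [C C0 HC] := partial_bounded i sm cpt; exists C.
exists (\sum_i C i); first by apply: sumr_ge0 => i _; case: (HC i).
move=> x y; rewrite mulr_suml.
(* Change the coordinates one at a time. *)
pose z (k : nat) : X := \row_i if (i < k)%N then x ord0 i else y ord0 i.
have z0 : z 0%N = y by apply/rowP => i; rewrite mxE.
have zN : z N = x by apply/rowP => i; rewrite mxE ltn_ord.
have zS (i : 'I_N) : z i.+1 = z i + (x ord0 i - y ord0 i) *: delta_mx ord0 i.
  apply/rowP => j; rewrite !mxE eqxx/= ltnS leq_eqVlt.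
  have [ij|ij] := eqVneq (j : nat) i.
    have -> : j = i by exact: val_inj.
    by rewrite ltnn eqxx mulr1 addrC subrK.
  have -> : (j == i) = false by apply/negbTE; move: ij; apply: contraNneq => ->.
  by rewrite mulr0 addr0.
have -> : phi x - phi y = \sum_(i < N) (phi (z i.+1) - phi (z i)).
  rewrite -{1}zN -{1}z0 -(big_mkord xpredT (fun i => phi (z i.+1) - phi (z i))).
  by rewrite telescope_sumr.
apply: (le_trans (ler_norm_sum _ _ _)); apply: ler_sum => i _.
have [C0 DC] := HC i.
rewrite zS; apply: le_trans (coordinate_lipschitz sm DC _ _) _.
rewrite ler_wpM2l//; have -> : x ord0 i - y ord0 i = (x - y) ord0 i by rewrite !mxE.
exact: coord_le_norm.
Qed.

End test_functions.

(** * Lebesgue spaces and a Borel kernel with the bounds of K *)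

Section measurability.
Context (R : realType) (N : nat).
Local Notation X := 'rV[R]_N.
Local Notation mu := (lebesgue_rV R N).

Lemma Lfun_measurable r (f : X -> R) : f \in Lfun mu r -> measurable_fun setT f.
Proof. by rewrite inE => /andP[/[!inE]/= mf _]. Qed.

Lemma Lfun_of_integral (p : R) (f : X -> R) : measurable_fun setT f ->
  (\int[mu]_x (`|f x| `^ p)%:E < +oo)%E -> f \in Lfun mu p%:E.
Proof.
move=> mf fp; rewrite inE; apply/andP; split; first by rewrite inE.
by rewrite inE/= /finite_norm unlock/=; apply: poweR_lty.
Qed.

Variables (s p Lambda : R).
Hypothesis L1 : 1 <= Lambda.
Local Notation w := (sing_kernel s p).

(* A Borel representative of K obeys the bounds of K only almost everywhere. *)
Definition clamped_kernel (k : X * X -> R) z : R :=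
  Num.max (Lambda^-1 * w z) (Num.min (Lambda * w z) (k z)).

Lemma measurable_clamped_kernel k : measurable_fun setT k -> measurable_fun setT (clamped_kernel k).
Proof.
move=> mk; have mw := measurable_sing_kernel s p.
apply: measurable_maxr; first by apply: measurable_funM => //; exact: mw.
by apply: measurable_minr => //; apply: measurable_funM => //; exact: mw.
Qed.

Lemma clamped_kernel_ge k z : Lambda^-1 * w z <= clamped_kernel k z.
Proof. by rewrite le_max lexx. Qed.

Lemma clamped_kernel_le k z : clamped_kernel k z <= Lambda * w z.
Proof.
rewrite ge_max ge_min lexx/= andbT ler_wpM2r ?sing_kernel_ge0//.
by apply: le_trans L1; rewrite invf_le1// (lt_le_trans ltr01).
Qed.

Lemma clamped_kernel_id k z : Lambda^-1 * w z <= k z <= Lambda * w z -> clamped_kernel k z = k z.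
Proof. by move=> /andP[h1 h2]; rewrite /clamped_kernel (min_idPr h2) (max_idPr h1). Qed.

End measurability.

Section parameters.
Context (R : realType) (N : nat) (s p q Lambda : R).

(** The division-free form unites both cases of the exponent: if s p >= N, the left-hand side is
    nonpositive. *)
Lemma subcritical_lt : 0 < p -> 0 < q -> (0 < N)%N -> (q%:E < critical_exponent N s p)%E ->
  (N%:R - s * p) * q < N%:R * p.
Proof.
move=> p0 q0 N0; rewrite /critical_exponent; case: ifPn => [spN|].
  by rewrite lte_fin ltr_pdivlMr ?subr_gt0// mulrC.
rewrite -leNgt => spN _; apply: (@le_lt_trans _ _ 0).
  by rewrite mulr_le0_ge0 ?subr_le0// ltW.
by rewrite mulr_gt0// ltr0n.
Qed.

(** Lambda^2 <= Lambda^4 < q / p. *)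
Lemma square_lt_of_root4 : 0 <= q / p -> 1 <= Lambda -> Lambda < (q / p) `^ (4^-1) ->
  Lambda ^+ 2 < q / p.
Proof.
move=> qp L1 Llt; have L0 : 0 <= Lambda by apply: le_trans L1.
apply: (@le_lt_trans _ _ (Lambda ^+ 4)); first exact: ler_weXn2l.
have -> : q / p = ((q / p) `^ (4^-1)) ^+ 4.
  by rewrite -powR_mulrn ?powR_ge0// -powRrM mulVf ?pnatr_eq0// powRr1.
by rewrite ltrXn2r.
Qed.

End parameters.

Lemma Rintegral_restrict (R : realType) d (T : measurableType d)
    (mu : {measure set T -> \bar R}) (D : set T) (h phi : T -> R) :
  (forall x, ~ D x -> phi x = 0) ->
  \int[mu]_(x in D) (h x * phi x) = \int[mu]_x (h x * phi x).
Proof.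
move=> phi0; rewrite Rintegral_mkcond; apply: eq_Rintegral => x _.
by rewrite patchE; case: ifPn => // /negP xD; rewrite phi0 ?mulr0// => /mem_set.
Qed.

Theorem theorem3p4 (R : realType) (N : nat) (Omega : set 'rV[R]_N)
    (s p q Lambda : R) (Phi : R -> R) (K : 'rV[R]_N -> 'rV[R]_N -> R)
    (f : 'rV[R]_N -> R)
    (N2 : (2 <= N)%N)
    (Omega_bounded : bounded_set Omega) (Omega_open : open Omega)
    (s0 : 0 < s) (s1 : s < 1)
    (p_gt : 2 - s / N%:R < p)
    (Phi_cont : continuous Phi) (Phi0 : Phi 0 = 0)
    (Phi_growth : forall t : R,
      Lambda^-1 * `|t| `^ p <= Phi t * t <= Lambda * `|t| `^ p)
    (K_meas : lebesgue_measurable2 K)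
    (K_bounds : forall x y : 'rV[R]_N, x != y ->
      (Lambda * enorm (x - y) `^ (N%:R + s * p))^-1 <= K x y <=
      Lambda / enorm (x - y) `^ (N%:R + s * p))
    (pq : p < q) (q_lt : (q%:E < critical_exponent N s p)%E)
    (f_Lp' : Lp_on Omega (p / (p - 1)) f)
    (Lambda1 : 1 <= Lambda) (Lambda_lt : Lambda < (q / p) `^ (4^-1)) :
  (exists lambda : R, 0 < lambda /\
     exists u, weak_solution Phi K Omega s p q lambda (fun=> 0) u /\
       nontrivial u) ->
  exists lambda1 : R, 0 < lambda1 /\
    forall lambda : R, 0 < lambda < lambda1 ->
      exists u, weak_solution Phi K Omega s p q lambda f u /\ nontrivial u.
Proof.
pose mu := lebesgue_rV R N.
have N0 : (0 < N)%N by exact: ltn_trans N2.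
(* This gives p > 2 - s / N > 1. *)
have sN1 : s / N%:R < 1.
  rewrite ltr_pdivrMr ?ltr0n// mul1r (lt_le_trans s1)//.
  by rewrite (ler_nat R 1 N).
have p1 : 1 < p by move: p_gt sN1; lra.
have p0 : 0 < p by rewrite (lt_trans ltr01).
have q0 : 0 < q by rewrite (lt_trans p0).
have r1 : 1 <= p / (p - 1).
  by rewrite ler_pdivlMr ?subr_gt0// mul1r gerDl lerN10.
have Lqp : Lambda ^+ 2 < q / p by apply: square_lt_of_root4 => //; rewrite divr_ge0// ltW.
have [b b0 Omega_b] : exists2 b : R, 0 < b & forall x, Omega x -> `|x| <= b.
  have [M [Mreal HM]] := Omega_bounded; exists (`|M| + 1).
    by rewrite ltr_wpDl.
  move=> x Ox; apply: HM => //.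
  by rewrite (le_lt_trans (real_ler_norm Mreal))// ltrDl.
have [P [P0 dP]] : exists P : R -> R, P 0 = 0 /\ forall t : R, is_derive t 1 P (Phi t).
  by have [P P0 dP] := continuous_primitive Phi_cont; exists P.
have [k mk Kk] := K_meas.
pose kap := clamped_kernel s p Lambda k.
have Kkap : {ae (mu \x mu)%E, forall z, z.1 != z.2 -> K z.1 z.2 = kap z}.
  apply: filterS Kk => z Kz z12; rewrite [RHS]clamped_kernel_id -Kz//.
  by have := K_bounds _ _ z12; rewrite invfM.
(* Nothing is known of K on the diagonal, but the increments vanish there, so its value does not
   change the integrand. *)
have nlE u phi : nonlocal_form Phi K u phi =
    \int[(mu \x mu)%E]_z (Phi (u z.1 - u z.2) * (phi z.1 - phi z.2) * kap z).
  apply: ae_eq_Rintegral; apply: filterS Kkap => z Kz.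
  by have [->|/Kz ->//] := eqVneq z.1 z.2; rewrite !subrr Phi0 !mul0r.
have test0 phi : test_function Omega phi -> forall x, ~ Omega x -> phi x = 0.
  exact: test_function_out.
move=> [lambda0 [_ [u0 [[u0W _] u0nt]]]].
(* If all test functions vanish a.e., both sides of the weak equation are 0 for
   every u, so u0 solves it; this spares the construction of bump functions. *)
have [[e0 [Te0 ne0]]|notest] := pselect (exists e0, test_function Omega e0 /\
    ~ {ae mu, forall x, e0 x = 0}); last first.
  have phi0 phi : test_function Omega phi -> {ae mu, forall x, phi x = 0}.
    by move=> Tphi; apply: contrapT => nphi; apply: notest; exists phi.
  exists 1; split => // lambda _; exists u0; split => //; split => // phi Tphi.
  have int0 (h : 'rV[R]_N -> R) : \int[mu]_(x in Omega) (h x * phi x) = 0.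
    rewrite (Rintegral_restrict _ _ (test0 _ Tphi)) (@ae_eq_Rintegral _ _ _ _ _ (fun=> 0)).
      by rewrite /Rintegral integral0.
    by apply: filterS (phi0 _ Tphi) => x ->; rewrite mulr0.
  rewrite nlE !int0 mulr0 addr0 (@ae_eq_Rintegral _ _ _ _ _ (fun=> 0)).
    by rewrite /Rintegral integral0.
  apply: filterS2 (ae_prod_fst mu (phi0 _ Tphi)) (ae_prod_snd mu (phi0 _ Tphi)) => z -> ->.
  by rewrite subrr mulr0 mul0r.
have adm phi : test_function Omega phi -> admissible Omega phi.
  by move=> Tphi; split; [exact: test_function_lipschitz Tphi|exact: test0].
(* The load of the energy is [f \_ Omega], which agrees with f wherever a test function is
   nonzero. *)
have mf0 := Lfun_measurable f_Lp'.
have if0 := Lfun_integrable r1 f_Lp'.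
have [|lam1 lam10 Hlam] := energy_solutions N0 s0 s1 p1 pq b0
  (subcritical_lt p0 q0 N0 q_lt) Lambda1 (measurable_clamped_kernel s p Lambda mk)
  (clamped_kernel_ge s p Lambda k) (clamped_kernel_le s p Lambda1 k)
  Phi_cont Phi0 Phi_growth P0 dP mf0 if0 Omega_b Lqp.
  by exists e0 => //; exact: adm.
exists lam1; split => // lambda /Hlam[u [mu_ up us uO [unt ueq]]].
exists u; split => //; split.
  split=> //; split; first exact: Lfun_of_integral.
  by apply: poweR_lty; move: us.
move=> phi Tphi; rewrite nlE ueq; last exact: adm.
rewrite !(Rintegral_restrict _ _ (test0 _ Tphi)); congr (_ + _).
apply: eq_Rintegral => x _; rewrite patchE; case: ifPn => // /negP xO.
by rewrite (test0 _ Tphi) ?mulr0// => /mem_set.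
Qed.
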